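(* Up to a projective transformation of the space of the image and a Möbius transformation of the space of the inverse image, there exist exactly three local diffeomorphisms which rectify rich families of circles in $\mathbb{R}^3$. They are given by: 1. $\Phi_1(x,y,z)=[x:y:z:1-x^2-y^2-z^2]$, 2. $\Phi_2(x,y,z)=[x:y:z:1]$, 3. $\Phi_3(x,y,z)=[x:y:z:1+x^2+y^2+z^2]$. That is: if $\Phi$ is a germ at a point $P\in\mathbb{R}^3$ of a diffeomorphism into $\mathbb{R}P^3$ which rectifies some rich family of circles in a neighborhood of $P$, then there are $j\in\{1,2,3\}$, a projective transformation $T$ of $\mathbb{R}P^3$ and a Möbius transformation $M$ with $M(P)\in\mathbb{R}^3$ such that $\Phi=T\circ\Phi_j\circ M$ near $P$; each of $\Phi_1,\Phi_2,\Phi_3$ rectifies a rich family of circles near points where its Jacobian is nonzero; and no two of the three types $j=1,2,3$ are equivalent in this sense.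
   Context: Möbius transformations are those of $\mathbb{R}^3\cup\{\infty\}$ (the group generated by inversions in spheres and reflections in planes); straight lines are counted among the circles (as circles through $\infty$). Projective transformations are those of $\mathbb{R}P^3$. A local diffeomorphism $\Phi$ from a neighborhood of $P\in\mathbb{R}^3$ to $\mathbb{R}P^3$ rectifies a family of circles near $P$ if, on some neighborhood of $P$, it takes the portion of each circle of the family in that neighborhood into a projective line. A family $\Delta$ of circles in a domain $U\subset\mathbb{R}^3$ is called a rich family if there exists a subfamily $\Gamma\subseteq\Delta$ such that (1) for each $P\in U$ there exists a circle $\gamma\in\Gamma$ with $P\in\gamma$; (2) if $\gamma\in\Gamma$ and $P\in\gamma$, then there exists an open cone $K_P$ of directions at $P$, depending continuously on $P$, such that the tangent line of $\gamma$ at $P$ lies inside $K_P$ and any other direction in $K_P$ is the tangent direction at $P$ of a circle in $\Gamma$ passing through $P$. *)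

(* Defs.v *)
From HB Require Import structures.
From mathcomp Require Import all_boot all_order all_algebra.
From mathcomp Require Import all_classical all_reals all_analysis.
Set Implicit Arguments.
Unset Strict Implicit.
Unset Printing Implicit Defensive.
Import Order.TTheory GRing.Theory Num.Theory.
Import numFieldNormedType.Exports.
Local Open Scope classical_set_scope.
Local Open Scope ring_scope.

(* The norm `|x| of 'rV[R]_3 is the sup norm: it is used only through the
   topology it induces, Euclidean lengths and angles being expressed with
   [dot]. *)

Section Euclidean.
Variable R : realType.
Implicit Types (u v c n x d : 'rV[R]_3) (r : R).

Definition dot u v : R := \sum_(i < 3) u 0 i * v 0 i.

Definition is_line (S : set 'rV[R]_3) :=
  exists p d, d != 0 /\ S = [set x | exists t : R, x = p + t *: d].

(* A proper circle is cut out of a sphere by a plane through its center. *)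
Definition is_proper_circle (S : set 'rV[R]_3) :=
  exists c n r, [/\ n != 0, 0 < r &
    S = [set x | dot (x - c) (x - c) = r ^+ 2 /\ dot n (x - c) = 0]].

(* Circles in the sense of Moebius geometry, with the point at infinity
   removed from the straight lines. *)
Definition is_circle (S : set 'rV[R]_3) := is_line S \/ is_proper_circle S.

Definition tangent_direction (S : set 'rV[R]_3) (P v : 'rV[R]_3) :=
  v != 0 /\
  exists c : R -> 'rV[R]_3,
    [/\ forall t, S (c t), c 0 = P & is_derive (0 : R) (1 : R) c v].

(* Inversions and reflections of R^3 together with infinity, which is None. *)
Definition inversion c r (X : option 'rV[R]_3) : option 'rV[R]_3 :=
  match X with
  | None => Some c
  | Some x =>
      if x == c then None
      else Some (c + (r ^+ 2 / dot (x - c) (x - c)) *: (x - c))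
  end.

(* Reflection in the plane of equation dot n x = a. *)
Definition reflection n (a : R) (X : option 'rV[R]_3) : option 'rV[R]_3 :=
  match X with
  | None => None
  | Some x => Some (x - (2%:R * (dot n x - a) / dot n n) *: n)
  end.

(* The generators being involutions, the monoid that they generate is the
   group that they generate. *)
Inductive moebius : (option 'rV[R]_3 -> option 'rV[R]_3) -> Prop :=
| moebius_id : moebius id
| moebius_inversion c r M :
    0 < r -> moebius M -> moebius (inversion c r \o M)
| moebius_reflection n (a : R) M :
    n != 0 -> moebius M -> moebius (reflection n a \o M).

End Euclidean.

Section Projective.
Variable R : realType.

(* Points of RP^3 are the lines through 0 in R^4. *)
Definition RP3 := {l : {vspace 'rV[R]_4} | \dim l == 1%N}.

Lemma dim_proj_point (v : 'rV[R]_4) : v != 0 -> \dim <[v]>%VS == 1%N.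
Proof. by move=> nz; rewrite dim_vline nz. Qed.

Definition proj_point (v : 'rV[R]_4) (nz : v != 0) : RP3 :=
  exist (fun l => \dim l == 1%N) <[v]>%VS (dim_proj_point nz).

Definition on_line (L : {vspace 'rV[R]_4}) (p : RP3) :=
  \dim L = 2 /\ (val p <= L)%VS.

Definition projective (T : RP3 -> RP3) :=
  exists2 A : 'M[R]_4, A \in unitmx &
    forall p, val (T p) = (linfun (mulmxr A) @: val p)%VS.

(* The affine charts [v_0 : ... : v_3] |-> (v_j / v_i)_(j != i); neither
   the domain nor the value depends on the nonzero vector chosen by vpick. *)
Definition in_chart (i : 'I_4) (p : RP3) := vpick (val p) 0 i != 0.

Definition chart (i : 'I_4) (p : RP3) : 'rV[R]_3 :=
  \row_(j < 3) (vpick (val p) 0 (lift i j) / vpick (val p) 0 i).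

End Projective.

Section Diffeomorphisms.
Variable R : realType.
Implicit Types (U : set 'rV[R]_3) (f : 'rV[R]_3 -> 'rV[R]_3).
Implicit Types (Phi : 'rV[R]_3 -> RP3 R) (P : 'rV[R]_3).

(* Class C^k on an open set U. *)
Fixpoint class_C (k : nat) U f : Prop :=
  match k with
  | 0 => forall x, U x -> {for x, continuous f}
  | k'.+1 => (forall x, U x -> differentiable f x) /\
             (forall v, class_C k' U (fun x => 'D_v f x))
  end.

Definition smooth U f := forall k, class_C k U f.

Definition diffeo_on U f :=
  [/\ open U, smooth U f, open (f @` U) &
    exists2 g, smooth (f @` U) g & forall x, U x -> g (f x) = x].

(* Phi restricts to a diffeomorphism of a neighborhood of P onto an open
   subset of RP^3 (which may be taken inside the domain of a chart); only the
   germ of Phi at P matters. *)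
Definition local_diffeo Phi P :=
  exists i : 'I_4, exists U,
    [/\ U P, forall x, U x -> in_chart i (Phi x) &
        diffeo_on U (fun x => chart i (Phi x))].

Definition nonzero_jacobian Phi P :=
  exists2 i : 'I_4, in_chart i (Phi P) &
    differentiable (fun x => chart i (Phi x)) P /\
    \det (jacobian (fun x => chart i (Phi x)) P) != 0.

End Diffeomorphisms.

Section RichFamilies.
Variable R : realType.
Implicit Types (U D V : set 'rV[R]_3) (P v : 'rV[R]_3).
Implicit Types (Delta Gamma : set (set 'rV[R]_3)).

Definition rectifies (Phi : 'rV[R]_3 -> RP3 R) Delta P :=
  exists2 V, nbhs P V &
    forall gamma, Delta gamma ->
      exists L, \dim L = 2 /\
        forall x, (gamma `&` V) x -> on_line L (Phi x).

Definition domain U := [/\ open U, connected U & U !=set0].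

(* Directions are lines: a cone is invariant under v |-> - v. *)
Definition open_cone (K : set 'rV[R]_3) :=
  [/\ open K, forall v, K v -> v != 0 &
      forall (t : R) v, t != 0 -> K v -> K (t *: v)].

(* Continuous dependence on P in D of the cone K P: both the directions inside
   the cone and those outside its closure remain so under small changes of the
   point and of the direction.  For round cones, this means that the axis and
   the aperture are continuous. *)
Definition continuous_cones D (K : 'rV[R]_3 -> set 'rV[R]_3) :=
  forall P, D P ->
    (forall v, K P v ->
       \forall Q \near P & w \near v, D Q -> K Q w) /\
    (forall v, ~ closure (K P) v ->
       \forall Q \near P & w \near v, D Q -> ~ closure (K Q) w).

Definition rich U Delta :=
  (forall gamma, Delta gamma -> is_circle gamma) /\
  exists2 Gamma, Gamma `<=` Delta &
    (forall P, U P -> exists2 gamma, Gamma gamma & gamma P) /\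
    (forall gamma, Gamma gamma ->
       exists2 K : 'rV[R]_3 -> set 'rV[R]_3,
         continuous_cones (gamma `&` U) K &
         forall P, (gamma `&` U) P ->
           [/\ open_cone (K P),
               forall v, tangent_direction gamma P v -> K P v &
               forall v, K P v ->
                 exists gamma', [/\ Gamma gamma', gamma' P &
                                    tangent_direction gamma' P v]]).

Definition rectifies_rich (Phi : 'rV[R]_3 -> RP3 R) P :=
  local_diffeo Phi P /\
  exists U Delta, [/\ domain U, U P, rich U Delta & rectifies Phi Delta P].

End RichFamilies.

Section Models.
Variable R : realType.
Implicit Types (x : 'rV[R]_3) (w : R).

(* The vector (x_0, x_1, x_2, w). *)
Definition hom x w : 'rV[R]_4 := row_mx x (w%:M : 'M[R]_1).

Lemma hom_eq0 x w : (hom x w == 0) = (x == 0) && (w == 0).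
Proof.
apply: etrans (row_mx_eq0 (n1 := 3) x (w%:M : 'M[R]_1)) _; congr (_ && _).
apply/eqP/eqP => [/matrixP/(_ 0 0)|->]; first by rewrite !mxE eqxx mulr1n.
by apply/matrixP => i j; rewrite !mxE mul0rn.
Qed.

Lemma hom_minus_neq0 x : hom x (1 - dot x x) != 0.
Proof.
rewrite hom_eq0; case: eqP => //= ->.
by rewrite /dot big1 ?subr0 ?oner_eq0 // => i _; rewrite mxE mul0r.
Qed.

Lemma hom_one_neq0 x : hom x 1 != 0.
Proof. by rewrite hom_eq0 oner_eq0 andbF. Qed.

Lemma hom_plus_neq0 x : hom x (1 + dot x x) != 0.
Proof.
rewrite hom_eq0; case: eqP => //= ->.
by rewrite /dot big1 ?addr0 ?oner_eq0 // => i _; rewrite mxE mul0r.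
Qed.

Definition Phi1 x : RP3 R := proj_point (hom_minus_neq0 x).
Definition Phi2 x : RP3 R := proj_point (hom_one_neq0 x).
Definition Phi3 x : RP3 R := proj_point (hom_plus_neq0 x).

Definition Phi_ (j : 'I_3) : 'rV[R]_3 -> RP3 R :=
  tnth [tuple Phi1; Phi2; Phi3] j.

(* Phi = T \o Psi \o M near P, with M P finite. *)
Definition equivalent_at P (Phi Psi : 'rV[R]_3 -> RP3 R) :=
  exists T M, [/\ projective T, @moebius R M, M (Some P) <> None &
    \forall x \near P, exists2 y, M (Some x) = Some y & Phi x = T (Psi y)].

End Models.

(* Main.v *)
Require Import Defs.
From mathcomp Require Import all_boot all_order all_algebra.
From mathcomp Require Import all_classical all_reals all_analysis.
From mathcomp Require Import ring lra.
Import Order.TTheory GRing.Theory Num.Theory.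
Import numFieldNormedType.Exports.
Local Open Scope classical_set_scope.
Local Open Scope ring_scope.
Set Implicit Arguments.
Unset Strict Implicit.
Unset Printing Implicit Defensive.

(** Let f be the expression of the germ in an affine chart.  If all circles
through a point Q whose directions at Q fill an open cone go to lines, then
the second and third derivatives of f along each of them are proportional to
the first one ([line_jet]).  Write the second differential of f at Q as
- Df (A (u, v)) and the third one as Df (B (u, v, w)), and a circle as the arc
with velocity v and acceleration 2 w, where w is orthogonal to v
([circ_arc]).  The condition becomes: 2 w - A (v, v) and B (v, v, v) -
6 A (v, w) are multiples of v ([circle_direction_accel]).  Eliminating w
leaves an identity between polynomials in v, true on an open cone and hence
for all v, complex ones included ([circle_identity]).  On an isotropic vector
v it forces A (v, v) to be orthogonal to v ([trace_part]), and, combined with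
the derivative of this fact, to be isotropic ([norm_null]).  In C^3 an
isotropic vector orthogonal to the isotropic vector v is a multiple of v, and
this is only possible if A (v, v) = |v|^2 c - 2 theta(v) v
([tensor_form]).  In geometric terms, all rectified circles through Q meet
again at one point, Q + 2 c / |c|^2, or at infinity if c = 0.

The symmetry of the third derivatives is then a system of first order
differential equations for c and theta ([pde_proj_part], [pde_conf_part],
[pde_proj_const]).  It says exactly that, for each homogeneous coordinate h of
the map, five explicit functions built from h and its derivatives satisfy the
same equation DF = theta F, hence are constant multiples of one function
beta; and h is a combination of them with coefficients 1, x_i and |x|^2.  So
the germ is the class of beta(x) (a0 + sum_i x_i a1_i + |x|^2 a2), with
constant vectors of R^4 ([adapted_quadric]).

Five vectors of R^4 satisfy a relation k0 a0 + sum_i k1_i a1_i + k2 a2 = 0,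
that is, the map is a linear projection of the paraboloid
[1 : x : |x|^2], the Moebius sphere in projective 4-space, from the point
[k0 : k1 : k2].  This center lies outside, on or inside the sphere according
to the sign of |k1|^2 - k0 k2, and Moebius transformations move it to a
standard position: these are the three models ([quad_normal]).

They are inequivalent because a Moebius transformation multiplies, up to a
common factor, the discriminant <q, q> - 4 p w of the functions
p + <q, x> + w |x|^2 by a positive constant ([moebius_pulls_back]), while the
coordinates of the model of sign eps span the space w = eps p, on which this
quadratic form is Lorentzian, degenerate or definite
([models_inequivalent]).

Conversely, under a model every direction at a point with 1 - eps |x|^2 <> 0
is tangent to a circle that goes into a line ([geodesic_circle]).  The
remaining points are those where the jacobian vanishes, because the model with
eps = 1 takes the same value at x and at x / |x|^2 ([jacobian_rho]). *)

(** * Smooth scalar functions *)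
Section DifferentiableGerm.
Context {R : realType} {V W : normedModType R}.

(** The differential at [x] is determined by the germ at [x]; this locality is
what makes classes of differentiability stable under equality on an open set. *)
Lemma near_eq_differentiable (g h : V -> W) (x : V) :
  (\near x, g x = h x) -> differentiable g x -> differentiable h x.
Proof.
move=> gh dg.
have [cd] := (diff_locallyP _ _).1 dg => /eqaddoP Hg.
have Hh : h \o shift x = cst (h x) + 'd g x +o_ 0 id.
  apply/eqaddoP => e e0; have := Hg e e0.
  have gh0 : \forall y \near (0 : V), g (y + x) = h (y + x).
    by move: gh; rewrite (near_shift 0 x) subr0.
  apply: filterS2 gh0 => y ghy.
  by rewrite /= !fctE /= ghy (nbhs_singleton gh).
by apply/diff_locallyP; rewrite (diff_unique cd Hh).
Qed.

End DifferentiableGerm.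

Section Smooth.
Context {R : realType} {V : normedModType R}.
Implicit Types (U : set V) (f g h : V -> R) (k : nat).

(** The scalar counterpart of [class_C]: all the analysis is done on coordinates,
where sums, products and quotients are available. *)
Fixpoint Cn k U h : Prop :=
  match k with
  | 0 => forall x, U x -> {for x, continuous h}
  | k'.+1 => (forall x, U x -> differentiable h x) /\
             (forall v, Cn k' U ('D_v h))
  end.

Definition Cinf U h := forall k, Cn k U h.

Lemma CnW k U h : Cn k.+1 U h -> Cn k U h.
Proof.
elim: k h => [h [dh _] x Ux|k IH h [dh Dh]].
  exact/differentiable_continuous/dh.
by split=> // v; exact/IH/Dh.
Qed.

Lemma Cn_sub k U U' h : U' `<=` U -> Cn k U h -> Cn k U' h.
Proof.
move=> UU; elim: k h => [h ch x /UU /ch //|k IH h [dh Dh]].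
by split=> [x /UU /dh //|v]; exact/IH/Dh.
Qed.

Lemma near_eq_in U g h x : open U -> U x -> (forall x, U x -> g x = h x) ->
  \forall y \near x, g y = h y.
Proof.
by move=> oU Ux gh; near=> y; apply: gh; near: y; exact: open_nbhs_nbhs.
Unshelve. all: by end_near. Qed.

Lemma Cn_eq k U g h : open U -> (forall x, U x -> g x = h x) ->
  Cn k U g -> Cn k U h.
Proof.
move=> oU; elim: k g h => [|k IH] g h gh.
  move=> cg x Ux; rewrite /prop_for /continuous_at -gh//.
  by apply: cvg_trans (cg x Ux); apply: near_eq_cvg; exact: near_eq_in Ux gh.
move=> [dg Dg]; split=> [x Ux|v].
  by apply: near_eq_differentiable (dg x Ux); exact: near_eq_in Ux gh.
apply: IH (Dg v) => x Ux; apply: near_eq_derive; exact: near_eq_in Ux gh.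
Qed.

Lemma Cn_cst k U (a : R) : open U -> Cn k U (fun=> a).
Proof.
move=> oU; elim: k a => [|k IH] a; first by move=> x _; exact: cst_continuous.
split=> [x _|v]; first exact: differentiable_cst.
by apply: Cn_eq (IH 0) => // x _; rewrite derive_cst.
Qed.

Lemma CnD k U g h : open U -> Cn k U g -> Cn k U h ->
  Cn k U (fun x => g x + h x).
Proof.
move=> oU; elim: k g h => [|k IH] g h.
  by move=> cg ch x Ux; apply: continuousD; [exact: cg|exact: ch].
move=> [dg Dg] [dh Dh]; split=> [x Ux|v].
  by apply: differentiableD; [exact: dg|exact: dh].
apply: Cn_eq (IH _ _ (Dg v) (Dh v)) => // x Ux.
by rewrite -deriveD//; apply: diff_derivable; [exact: dg|exact: dh].
Qed.

Lemma CnM k U g h : open U -> Cn k U g -> Cn k U h ->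
  Cn k U (fun x => g x * h x).
Proof.
move=> oU; elim: k g h => [|k IH] g h.
  by move=> cg ch x Ux; apply: continuousM; [exact: cg|exact: ch].
move=> Cg Ch; have [dg Dg] := Cg; have [dh Dh] := Ch; split=> [x Ux|v].
  by apply: differentiableM; [exact: dg|exact: dh].
apply: Cn_eq (CnD oU (IH _ _ (CnW Cg) (Dh v)) (IH _ _ (CnW Ch) (Dg v))) => // x Ux.
by rewrite deriveM//; apply: diff_derivable; [exact: dg|exact: dh].
Qed.

Lemma CnN k U g : open U -> Cn k U g -> Cn k U (fun x => - g x).
Proof.
move=> oU Cg; apply: Cn_eq (CnM oU (Cn_cst k (-1) oU) Cg) => // x _.
by rewrite mulN1r.
Qed.

Lemma CnB k U g h : open U -> Cn k U g -> Cn k U h ->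
  Cn k U (fun x => g x - h x).
Proof. by move=> oU Cg Ch; apply: CnD => //; exact: CnN. Qed.

Lemma Cn_sum k U (I : Type) (s : seq I) (P : pred I) (F : I -> V -> R) :
  open U -> (forall i, P i -> Cn k U (F i)) ->
  Cn k U (fun x => \sum_(i <- s | P i) F i x).
Proof.
move=> oU CF; elim: s => [|i s IH].
  by apply: Cn_eq (Cn_cst k 0 oU) => // x _; rewrite big_nil.
case Pi: (P i).
  by apply: Cn_eq (CnD oU (CF i Pi) IH) => // x _; rewrite big_cons Pi.
by apply: Cn_eq IH => // x _; rewrite big_cons Pi.
Qed.

Lemma Cn_prod k U (I : Type) (s : seq I) (P : pred I) (F : I -> V -> R) :
  open U -> (forall i, P i -> Cn k U (F i)) ->
  Cn k U (fun x => \prod_(i <- s | P i) F i x).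
Proof.
move=> oU CF; elim: s => [|i s IH].
  by apply: Cn_eq (Cn_cst k 1 oU) => // x _; rewrite big_nil.
case Pi: (P i).
  by apply: Cn_eq (CnM oU (CF i Pi) IH) => // x _; rewrite big_cons Pi.
by apply: Cn_eq IH => // x _; rewrite big_cons Pi.
Qed.

(** The derivative of an inverse involves the inverse itself, one degree of
smoothness lower. *)
Lemma CnV k U g : open U -> (forall x, U x -> g x != 0) -> Cn k U g ->
  Cn k U (fun x => (g x)^-1).
Proof.
move=> oU g0; elim: k => [|k IH].
  by move=> cg x Ux; apply: continuousV; [exact: g0|exact: cg].
move=> Cg; have [dg Dg] := Cg; have Cgi := IH (CnW Cg).
split=> [x Ux|v]; first by apply: differentiableV; [exact: dg|exact: g0].
apply: Cn_eq (CnN oU (CnM oU (CnM oU Cgi Cgi) (Dg v))) => // x Ux.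
rewrite deriveV ?g0//; last exact/diff_derivable/dg.
by rewrite /GRing.scale /= -invfM -expr2 mulNr.
Qed.

(** As for the inverse, the derivative of a square root is a rational expression in
that square root. *)
Lemma Cn_sqrt k U g : open U -> (forall x, U x -> 0 < g x) -> Cn k U g ->
  Cn k U (fun x => Num.sqrt (g x)).
Proof.
move=> oU g0; elim: k => [|k IH].
  move=> cg x Ux; apply: (continuous_comp (cg x Ux)); exact: sqrt_continuous.
move=> Cg; have [dg Dg] := Cg; have Cgi := IH (CnW Cg).
have dsqrt x : U x -> is_diff x (fun x => Num.sqrt (g x))
    (fun v => (2 * Num.sqrt (g x))^-1 * 'D_v g x).
  move=> Ux; have Dsg := is_derive1_sqrt (g0 x Ux).
  have ds : differentiable (Num.sqrt : R -> R) (g x).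
    by apply/derivable1_diffP; case: Dsg.
  apply: DiffDef; first exact: (differentiable_comp (dg x Ux) ds).
  rewrite (diff_comp (dg x Ux) ds); apply/funext => v /=.
  rewrite deriv1E; last by case: Dsg.
  rewrite derive1E; have [_ ->] := Dsg.
  by rewrite (deriveE v (dg x Ux)) /GRing.scale /= mulrC.
split=> [x /dsqrt[]//|v].
have s0 x : U x -> 2 * Num.sqrt (g x) != 0.
  by move=> Ux; rewrite gt_eqF// mulr_gt0// sqrtr_gt0 g0.
apply: Cn_eq (CnM oU (CnV oU s0 (CnM oU (Cn_cst k 2 oU) Cgi)) (Dg v)) => // x Ux.
have [d e] := dsqrt x Ux.
by rewrite [RHS](deriveE _ d) e.
Qed.

End Smooth.

(** * Symmetry of second derivatives *)
Section Schwarz.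
Context {R : realType} {V : normedModType R}.
Implicit Types (U : set V) (f g h : V -> R).

Lemma is_derive_comp (h : V -> R) (y : R -> V) (t : R) (d : V) :
  differentiable h (y t) -> is_derive t 1 y d ->
  is_derive t 1 (fun s => h (y s)) ('D_d h (y t)).
Proof.
move=> dh [dy <-].
have dfy : differentiable y t by exact/derivable1_diffP.
have df : differentiable (fun s => h (y s)) t := differentiable_comp dfy dh.
apply: DeriveDef; first exact: diff_derivable.
by rewrite (deriveE _ df) (diff_comp dfy dh) /= [RHS](deriveE _ dh) (deriveE _ dfy).
Qed.

Lemma is_derive_line (h : V -> R) (a v : V) (t : R) :
  differentiable h (a + t *: v) ->
  is_derive t 1 (fun s : R => h (a + s *: v)) ('D_v h (a + t *: v)).
Proof.
move=> dh; apply: is_derive_comp => //.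
have [ds Ds] := is_diff_scalel t v.
have -> : (fun s : R => a + s *: v) = cst a + (fun s : R => s *: v) by [].
rewrite -[v in X in is_derive _ _ _ X]add0r; apply: is_deriveD.
apply: DeriveDef; first exact: diff_derivable.
by rewrite (deriveE _ ds) Ds /= scale1r.
Qed.

Lemma MVT0 (f df : R -> R) (s : R) : 0 < s ->
  (forall t, 0 <= t <= s -> is_derive t 1 f (df t)) ->
  exists2 c, 0 <= c <= s & f s - f 0 = df c * s.
Proof.
move=> s0 fdf.
have [||c] := @MVT R f df 0 s s0.
- by move=> t; rewrite in_itv /= => /andP[t0 ts]; apply: fdf; rewrite !ltW.
- apply: derivable_within_continuous => t; rewrite in_itv /= => ts.
  by case: (fdf t ts).
by rewrite in_itv /= subr0 => /andP[c0 cs] ->; exists c; rewrite ?ltW.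
Qed.

(** Two applications of the mean value theorem; the left-hand side is symmetric
in [v] and [w], which is where the symmetry of second derivatives comes from. *)
Lemma second_difference U h v w x (s : R) : 0 < s -> Cn 2 U h ->
  (forall a b, 0 <= a <= s -> 0 <= b <= s -> U (x + a *: v + b *: w)) ->
  exists a b, [/\ 0 <= a <= s, 0 <= b <= s &
    h (x + s *: v + s *: w) - h (x + s *: v) - (h (x + s *: w) - h x)
    = 'D_w ('D_v h) (x + a *: v + b *: w) * s * s].
Proof.
move=> s0 [dh Dh] Us.
have s0s : 0 <= s <= s by rewrite ltW /=.
have z0s : 0 <= (0 : R) <= s by rewrite lexx ltW.
have Us0 a : 0 <= a <= s -> U (x + a *: v).
  by move=> /Us /(_ z0s); rewrite scale0r addr0.
have [|a aI Ea] := @MVT0 (fun a => h (x + s *: w + a *: v) - h (x + a *: v))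
  (fun a => 'D_v h (x + s *: w + a *: v) - 'D_v h (x + a *: v)) s s0.
  move=> t ts; apply: is_deriveB; apply: is_derive_line; apply: dh.
    by rewrite addrAC; exact: Us.
  exact: Us0.
have [|b bI Eb] := @MVT0 (fun b => 'D_v h (x + a *: v + b *: w))
  (fun b => 'D_w ('D_v h) (x + a *: v + b *: w)) s s0.
  by move=> t ts; apply: is_derive_line; apply: (Dh v).1; exact: Us.
exists a, b; split=> //; rewrite -Eb scale0r addr0.
move: Ea; rewrite !scale0r !addr0 ![x + s *: w + _]addrAC => <-.
by rewrite addrAC.
Qed.

(** Both mixed derivatives are limits of the same second difference divided by
[s ^+ 2]. *)
Lemma derive_sym U h v w x : open U -> U x -> Cn 2 U h ->
  'D_w ('D_v h) x = 'D_v ('D_w h) x.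
Proof.
move=> oU Ux Ch; have [dh Dh] := Ch.
apply/eqP; rewrite -subr_eq0 -normr_le0; apply/ler_addgt0Pl => e e0.
rewrite addr0.
have e20 : 0 < e / 2 by rewrite divr_gt0.
have c1 := ((cvgrPdist_lt _ _).1 ((Dh v).2 w x Ux)) _ e20.
have c2 := ((cvgrPdist_lt _ _).1 ((Dh w).2 v x Ux)) _ e20.
have /nbhs_ballP[r /= r0 rP] : \forall y \near x,
    [/\ U y, `|'D_w ('D_v h) x - 'D_w ('D_v h) y| < e / 2
      & `|'D_v ('D_w h) x - 'D_v ('D_w h) y| < e / 2].
  have c3 := open_nbhs_nbhs (conj oU Ux).
  move: c1 c2 => /(_ (nbhs_filter x)) c1 /(_ (nbhs_filter x)) c2.
  apply: (@filterS _ _ (nbhs_filter x) _ _ _ (filterI c3 (filterI c1 c2))) => y [Uy [A B]].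
  split; [exact: Uy|exact: A|exact: B].
pose s := r / (`|v| + `|w| + 1).
have n0 : 0 < `|v| + `|w| + 1 by rewrite ltr_wpDl// addr_ge0.
have s0 : 0 < s by rewrite divr_gt0.
have inb a b : 0 <= a <= s -> 0 <= b <= s -> ball x r (x + a *: v + b *: w).
  move=> /andP[a0 as_] /andP[b0 bs]; rewrite -ball_normE /=.
  rewrite -addrA opprD addNKr normrN (le_lt_trans (ler_normD _ _))//.
  rewrite !normrZ !ger0_norm//.
  apply: (@le_lt_trans _ _ (s * (`|v| + `|w|))).
    by rewrite mulrDr lerD// ler_wpM2r.
  by rewrite /s -mulrA gtr_pMr// mulrC ltr_pdivrMr// mul1r ltrDl.
have [|a [b [aI bI E1]]] := @second_difference U h v w x s s0 Ch.
  by move=> a b aI bI; have [] := rP _ (inb a b aI bI).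
have [|c [d [cI dI E2]]] := @second_difference U h w v x s s0 Ch.
  by move=> a' b' aI' bI'; rewrite addrAC; have [] := rP _ (inb b' a' bI' aI').
have [_ L1 _] := rP _ (inb a b aI bI).
have [_ _] := rP _ (inb d c dI cI).
rewrite -[_ + _ *: w in X in `|X| < _]addrAC => L2.
have E : 'D_w ('D_v h) (x + a *: v + b *: w) = 'D_v ('D_w h) (x + c *: w + d *: v).
  apply: (mulIf (lt0r_neq0 s0)); apply: (mulIf (lt0r_neq0 s0)).
  apply: etrans (esym E1) _; apply: etrans E2; rewrite [x + s *: w + s *: v]addrAC.
  move: (h _) (h (x + s *: v)) (h (x + s *: w)) (h x) => h1 h2 h3 h4.
  by ring.
set X := 'D_w _ x; set Y := 'D_v _ x.
have -> : X - Y = (X - 'D_w ('D_v h) (x + a *: v + b *: w))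
                - (Y - 'D_v ('D_w h) (x + c *: w + d *: v)).
  by rewrite E opprB addrA subrK.
apply: (le_trans (ler_normB _ _)); rewrite [leRHS]splitr.
by apply: lerD; apply: ltW; [exact: L1|exact: L2].
Qed.

Lemma derive_eq0_cst (h : V -> R) (P : V) (r : R) : 0 < r ->
  (forall x, ball P r x -> differentiable h x) ->
  (forall x v, ball P r x -> 'D_v h x = 0) ->
  forall x, ball P r x -> h x = h P.
Proof.
move=> r0 dh Dh x Px.
have inb t : 0 <= t <= 1 -> ball P r (P + t *: (x - P)).
  move=> /andP[t0 t1]; move: Px; rewrite -!ball_normE /= => Px.
  rewrite opprD addNKr normrN normrZ ger0_norm// distrC.
  by rewrite (le_lt_trans _ Px)// ler_piMl.
have [|c cI] := @MVT0 (fun t => h (P + t *: (x - P)))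
   (fun t => 'D_(x - P) h (P + t *: (x - P))) 1 ltr01.
  by move=> t tI; apply: is_derive_line; apply/dh/inb.
rewrite Dh; last exact: inb.
by rewrite mul0r scale1r scale0r addr0 (addrC P) subrK => /eqP; rewrite subr_eq0 => /eqP.
Qed.

End Schwarz.

(** * Coordinates in R^3 *)
Section Coordinates.
Context {R : realType}.
Implicit Types (u v w x : 'rV[R]_3).

Definition e_ (i : 'I_3) : 'rV[R]_3 := delta_mx 0 i.

Lemma sum3 (W : zmodType) (F : 'I_3 -> W) : \sum_i F i = F 0 + F 1 + F 2%:R.
Proof.
rewrite !big_ord_recr big_ord0 /= add0r.
by congr (F _ + F _ + F _); apply/val_inj.
Qed.

Lemma all3 (P : 'I_3 -> Prop) : P 0 -> P 1 -> P 2%:R -> forall i, P i.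
Proof.
move=> P0 P1 P2 [[|[|[|//]]] i3].
- by rewrite (_ : Ordinal i3 = 0)//; exact: val_inj.
- by rewrite (_ : Ordinal i3 = 1)//; exact: val_inj.
- by rewrite (_ : Ordinal i3 = 2%:R)//; exact: val_inj.
Qed.

Lemma row3P u v : u 0 0 = v 0 0 -> u 0 1 = v 0 1 -> u 0 2%:R = v 0 2%:R -> u = v.
Proof. by move=> h0 h1 h2; apply/rowP; exact: all3. Qed.

Lemma dotE u v : dot u v = u 0 0 * v 0 0 + u 0 1 * v 0 1 + u 0 2%:R * v 0 2%:R.
Proof. exact: sum3. Qed.

Lemma dotC u v : dot u v = dot v u.
Proof. by rewrite !dotE !(mulrC (u _ _)). Qed.

Lemma dotDl u v w : dot (u + v) w = dot u w + dot v w.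
Proof. by rewrite !dotE !mxE; ring. Qed.

Lemma dotDr u v w : dot w (u + v) = dot w u + dot w v.
Proof. by rewrite !dotE !mxE; ring. Qed.

Lemma dotZl (a : R) u w : dot (a *: u) w = a * dot u w.
Proof. by rewrite !dotE !mxE; ring. Qed.

Lemma dotZr (a : R) u w : dot w (a *: u) = a * dot w u.
Proof. by rewrite !dotE !mxE; ring. Qed.

Lemma dotNl u w : dot (- u) w = - dot u w.
Proof. by rewrite -scaleN1r dotZl mulN1r. Qed.

Lemma dotNr u w : dot w (- u) = - dot w u.
Proof. by rewrite -scaleN1r dotZr mulN1r. Qed.

Lemma dot0l u : dot 0 u = 0.
Proof. by rewrite -(scale0r u) dotZl mul0r. Qed.

Lemma dot0r u : dot u 0 = 0.
Proof. by rewrite dotC dot0l. Qed.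

Lemma dotvv_ge0 u : 0 <= dot u u.
Proof. by rewrite dotE; nra. Qed.

Lemma dotvv_eq0 u : (dot u u == 0) = (u == 0).
Proof.
apply/eqP/eqP => [|->]; last exact: dot0l.
by rewrite dotE => u0; apply: row3P; rewrite mxE; nra.
Qed.

Lemma dotvv_gt0 u : u != 0 -> 0 < dot u u.
Proof. by move=> u0; rewrite lt_neqAle dotvv_ge0 eq_sym dotvv_eq0 u0. Qed.

Lemma dot_e u i : dot u (e_ i) = u 0 i.
Proof. by rewrite dotE !mxE; elim/all3: i; rewrite !eqxx /=; ring. Qed.

Lemma row_e u : u = \sum_i u 0 i *: e_ i.
Proof. exact: row_sum_delta. Qed.

Lemma derive_sum_e (W : normedModType R) (h : 'rV[R]_3 -> W) x v :
  differentiable h x -> 'D_v h x = \sum_i v 0 i *: 'D_(e_ i) h x.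
Proof.
move=> dh; rewrite deriveE// {1}(row_e v) linear_sum; apply: eq_bigr => i _.
by rewrite linearZ deriveE.
Qed.

Lemma derive_coord (V : normedModType R) n (f : V -> 'rV[R]_n) (p q : V) j :
  derivable f p q -> 'D_q (fun y => f y 0 j) p = 'D_q f p 0 j.
Proof. by move=> df; rewrite (derive_mx df) mxE. Qed.

Lemma is_derive_row n (V : normedModType R) (f : V -> 'rV[R]_n) (p q : V) d :
  is_derive p q f d <-> forall j, is_derive p q (fun y => f y 0 j) (d 0 j).
Proof.
split=> [[df <-] j|df].
  apply: DeriveDef; last exact: derive_coord.
  by have /derivable_mxP := df; apply.
have df' : derivable f p q.
  by apply/derivable_mxP => i j; rewrite ord1; case: (df j).
apply: DeriveDef => //; apply/rowP => j.
by rewrite -derive_coord//; case: (df j).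
Qed.

Lemma row_funE n (V : normedModType R) (f : V -> 'rV[R]_n) :
  f = \sum_j (fun y => f y 0 j *: delta_mx 0 j).
Proof.
by apply/funext => y; rewrite [LHS]row_sum_delta fct_sumE.
Qed.

Lemma differentiable_row n (V : normedModType R) (f : V -> 'rV[R]_n) (p : V) :
  (forall j, differentiable (fun y => f y 0 j) p) -> differentiable f p.
Proof.
move=> df; rewrite (row_funE f); apply: differentiable_sum => j.
exact: differentiableZl.
Qed.

Lemma differentiable_row_coord n (V : normedModType R) (f : V -> 'rV[R]_n) (p : V) j :
  differentiable f p -> differentiable (fun y => f y 0 j) p.
Proof.
by move=> df; exact: (differentiable_comp df (differentiable_coord (f p) 0 j)).
Qed.

Lemma continuous_row n (V : normedModType R) (f : V -> 'rV[R]_n) (p : V) :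
  (forall j, {for p, continuous (fun y => f y 0 j)}) -> {for p, continuous f}.
Proof.
move=> cf; rewrite (row_funE f).
apply: (@big_ind (V -> 'rV[R]_n) (fun g => {for p, continuous g}) 0 +%R).
- exact: cst_continuous.
- by move=> g h cg ch; apply: continuousD.
- by move=> j _; rewrite /prop_for /continuous_at; apply: cvgZr_tmp; exact: cf.
Qed.

Lemma class_C_coord k U (f : 'rV[R]_3 -> 'rV[R]_3) j : open U ->
  class_C k U f -> Cn k U (fun x => f x 0 j).
Proof.
move=> oU; elim: k f => [|k IH] f /=.
  move=> cf x Ux.
  exact: (continuous_comp (cf x Ux) (@coord_continuous _ _ _ 0 j (f x))).
move=> [df Df]; split=> [x Ux|v]; first exact/differentiable_row_coord/df.
apply: Cn_eq (IH _ (Df v)) => // x Ux.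
by rewrite derive_coord//; exact/diff_derivable/df.
Qed.

Lemma coord_class_C k U (f : 'rV[R]_3 -> 'rV[R]_3) : open U ->
  (forall j, Cn k U (fun x => f x 0 j)) -> class_C k U f.
Proof.
move=> oU; elim: k f => [|k IH] f /= Cf.
  by move=> x Ux; apply: continuous_row => j; exact: Cf.
have df x : U x -> differentiable f x.
  by move=> Ux; apply: differentiable_row => j; exact: (Cf j).1.
split=> // v; apply: IH => j; apply: Cn_eq ((Cf j).2 v) => // x Ux.
by rewrite derive_coord//; exact/diff_derivable/df.
Qed.

Lemma Cn_coord k U i : open U -> Cn k U (fun x : 'rV[R]_3 => x 0 i).
Proof.
move=> oU; case: k => [|k]; first by move=> x _; exact: coord_continuous.
split=> [x _|v]; first exact: differentiable_coord.
apply: Cn_eq (Cn_cst k (v 0 i) oU) => // x _.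
by rewrite derive_coord ?derive_id.
Qed.

Lemma Cn_dotvv k U : open U -> Cn k U (fun x : 'rV[R]_3 => dot x x).
Proof. by move=> oU; apply: Cn_sum => // i _; apply: CnM => //; exact: Cn_coord. Qed.

End Coordinates.

(** * Circles as rational arcs *)
Section Arcs.
Context {R : realType}.
Implicit Types (u v w x Q : 'rV[R]_3) (s t : R).

(** The inversion of a straight line: the denominator comes from the centre
of inversion [Q + (dot v v / dot w w) *: w], the point antipodal to [Q] when
[w] is orthogonal to [v].  Lines are the case [w = 0].  The parameter is chosen
so that the velocity at 0 is [v] and the acceleration [2 *: w]. *)
Definition circ_arc Q v w t : 'rV[R]_3 :=
  Q + (1 + t ^+ 2 * (dot w w / dot v v))^-1 *: (t *: v + t ^+ 2 *: w).
(** Velocity of the arc, and below its acceleration. *)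
Definition circ_arc1 v w t : 'rV[R]_3 :=
  let s := dot w w / dot v v in
  (1 + t ^+ 2 * s) ^- 2 *: ((1 - t ^+ 2 * s) *: v + (2 * t) *: w).
Definition circ_arc2 v w t : 'rV[R]_3 :=
  let s := dot w w / dot v v in
  (1 + t ^+ 2 * s) ^- 3 *: ((2 * s ^+ 2 * t ^+ 3 - 6 * s * t) *: v
                             + (2 - 6 * s * t ^+ 2) *: w).

Lemma arc_denom v w t : 0 < 1 + t ^+ 2 * (dot w w / dot v v).
Proof.
have : 0 <= t ^+ 2 * (dot w w / dot v v).
  by rewrite mulr_ge0 ?sqr_ge0// divr_ge0// dotvv_ge0.
by move: (_ * _) => z; lra.
Qed.

Lemma is_derive_arc Q v w t : is_derive t 1 (circ_arc Q v w) (circ_arc1 v w t).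
Proof.
apply/is_derive_row => j.
have D0 := lt0r_neq0 (arc_denom v w t).
rewrite /circ_arc /circ_arc1; move: (dot w w / dot v v) D0 => s D0.
have -> : (fun t => (Q + (1 + t ^+ 2 * s)^-1 *: (t *: v + t ^+ 2 *: w)) 0 j)
  = (fun t => Q 0 j + (1 + t ^+ 2 * s)^-1 * (t * v 0 j + t ^+ 2 * w 0 j)).
  by apply/funext => r; rewrite !mxE.
apply: is_derive_eq.
by rewrite !mxE /GRing.scale /=; field.
Qed.

Lemma is_derive_arc1 v w t : is_derive t 1 (circ_arc1 v w) (circ_arc2 v w t).
Proof.
apply/is_derive_row => j.
have D0 := lt0r_neq0 (arc_denom v w t).
rewrite /circ_arc1 /circ_arc2; move: (dot w w / dot v v) D0 => s D0.
have -> : (fun t => ((1 + t ^+ 2 * s) ^- 2 *: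
             ((1 - t ^+ 2 * s) *: v + (2 * t) *: w)) 0 j)
  = (fun t => ((1 + t ^+ 2 * s)^-1 * (1 + t ^+ 2 * s)^-1) *
               ((1 - t ^+ 2 * s) * v 0 j + (2 * t) * w 0 j)).
  by apply/funext => r; rewrite !mxE -invfM -expr2.
apply: is_derive_eq.
by rewrite !mxE /GRing.scale /=; field.
Qed.

Lemma is_derive_arc2_0 v w :
  is_derive (0 : R) 1 (circ_arc2 v w) ((- 6 * (dot w w / dot v v)) *: v).
Proof.
apply/is_derive_row => j; rewrite /circ_arc2; move: (dot w w / dot v v) => s.
have -> : (fun t => ((1 + t ^+ 2 * s) ^- 3 *:
    ((2 * s ^+ 2 * t ^+ 3 - 6 * s * t) *: v + (2 - 6 * s * t ^+ 2) *: w)) 0 j)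
  = (fun t => ((1 + t ^+ 2 * s)^-1 * ((1 + t ^+ 2 * s)^-1 * (1 + t ^+ 2 * s)^-1))
     * ((2 * s ^+ 2 * t ^+ 3 - 6 * s * t) * v 0 j + (2 - 6 * s * t ^+ 2) * w 0 j)).
  by apply/funext => r; rewrite !mxE -!invfM -expr2 -exprS.
have D0 : 1 + 0 ^+ 2 * s != 0 by rewrite expr0n mul0r addr0 oner_neq0.
apply: is_derive_eq.
by rewrite !mxE /GRing.scale /=; field.
Qed.

Lemma arc_at0 Q v w : circ_arc Q v w 0 = Q.
Proof. by rewrite /circ_arc expr0n !scale0r addr0 scaler0 addr0. Qed.

Lemma arc1_at0 v w : circ_arc1 v w 0 = v.
Proof.
by rewrite /circ_arc1 expr0n mul0r mulr0 scale0r !addr0 subr0 expr1n invr1 !scale1r.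
Qed.

Lemma arc2_at0 v w : circ_arc2 v w 0 = 2 *: w.
Proof.
rewrite /circ_arc2 !expr0n /= !mul0r !mulr0 subr0 scale0r !addr0 add0r subr0.
by rewrite expr1n invr1 scale1r.
Qed.

Lemma is_derive_dot_cst (c : R -> 'rV[R]_3) (a : 'rV[R]_3) v k :
  is_derive (0 : R) 1 c v -> (forall t, dot a (c t) = k) -> dot a v = 0.
Proof.
move=> /is_derive_row dc ck.
have d1 : is_derive (0 : R) 1 (fun t => dot a (c t)) (dot a v).
  rewrite /dot.
  have -> : (fun t => \sum_(i < 3) a 0 i * c t 0 i)
          = \sum_(i < 3) (fun t => a 0 i * c t 0 i).
    by apply/funext => t; rewrite fct_sumE.
  apply: is_derive_sum => i; have := dc i => dci.
have [_ <-] := d1.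
have -> : (fun t => dot a (c t)) = cst k by apply/funext => t; rewrite ck.
exact: derive_cst.
Qed.

Lemma is_derive_sphere_cst (c : R -> 'rV[R]_3) (a : 'rV[R]_3) v k :
  is_derive (0 : R) 1 c v -> (forall t, dot (c t - a) (c t - a) = k) ->
  dot (c 0 - a) v = 0.
Proof.
move=> /is_derive_row dc ck.
have d1 : is_derive (0 : R) 1 (fun t => dot (c t - a) (c t - a)) (2 * dot (c 0 - a) v).
  rewrite /dot.
  have -> : (fun t => \sum_(i < 3) (c t - a) 0 i * (c t - a) 0 i)
          = \sum_(i < 3) (fun t => (c t 0 i - a 0 i) * (c t 0 i - a 0 i)).
    by apply/funext => t; rewrite fct_sumE; apply: eq_bigr => i _; rewrite !mxE.
  rewrite mulr_sumr; apply: is_derive_sum => i; have := dc i => dci.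
  by apply: is_derive_eq; rewrite subr0 /GRing.scale /= !mxE; ring.
have E : 2 * dot (c 0 - a) v = 0.
  have [_ <-] := d1.
  have -> : (fun t => dot (c t - a) (c t - a)) = cst k by apply/funext => t; rewrite ck.
  exact: derive_cst.
by lra.
Qed.

(** The curvature vector of a circle points to its center, hence the acceleration
of the arc is a multiple of [Q - c] determined by the radius. *)
Lemma proper_circle_arc (c n Q v : 'rV[R]_3) (r : R) : 0 < r ->
  dot (Q - c) (Q - c) = r ^+ 2 -> dot n (Q - c) = 0 -> dot n v = 0 ->
  dot (Q - c) v = 0 -> v != 0 ->
  exists2 w, dot v w = 0 & forall t,
    dot (circ_arc Q v w t - c) (circ_arc Q v w t - c) = r ^+ 2 /\ dot n (circ_arc Q v w t - c) = 0.
Proof.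
move=> r0 Qr nQ nv Qv v0; have vv := dotvv_gt0 v0.
pose k := - (dot v v / (2 * r ^+ 2)).
have r20 : r ^+ 2 != 0 by rewrite lt0r_neq0// exprn_gt0.
exists (k *: (Q - c)); first by rewrite dotZr dotC Qv mulr0.
move=> t; have := arc_denom v (k *: (Q - c)) t.
rewrite /circ_arc dotZl dotZr Qr; move/lt0r_neq0.
set D := 1 + _ => D0; rewrite addrAC.
have -> : Q - c + D^-1 *: (t *: v + t ^+ 2 *: (k *: (Q - c)))
        = (1 + D^-1 * t ^+ 2 * k) *: (Q - c) + (D^-1 * t) *: v.
  by rewrite scalerDr !scalerA scalerDl scale1r [in LHS](addrC (_ *: v)) addrA.
move: (Q - c) Qr nQ Qv => q Qr nQ Qv.
rewrite !(dotDl, dotDr, dotZl, dotZr) nQ nv Qr (dotC v q) Qv; split; last by ring.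
move: D0; rewrite /D /k; move: vv r20; move: (dot v v) (r ^+ 2) => V r2 vv r20.
move/lt0r_neq0 in vv => D0.
field; rewrite vv r20 /=.
set D1 := 1 + _ in D0.
have -> : 2 * r2 * 2 * V + t ^+ 2 * (- V * - V) = 4 * r2 * V * D1.
  by rewrite /D1; field; rewrite vv r20.
by rewrite !mulf_neq0// pnatr_eq0.
Qed.

(** A tangent direction is realized by an arbitrary differentiable curve in the
circle; differentiating the equations of the circle along that curve shows that
it is the geometric tangent, so that the arc with that velocity stays on the
circle. *)
Lemma circle_arc S Q v : is_circle S -> S Q -> tangent_direction S Q v ->
  exists2 w, dot v w = 0 & forall t, S (circ_arc Q v w t).
Proof.
move=> [[p [d [d0 SE]]]|[a [n [r [n0 r0 SE]]]]] SQ [v0 [c [Sc c0 dc]]].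
  exists 0; first exact: dot0r.
  move: SQ; rewrite {1}SE => -[tQ QE].
  have vd u : dot u d = 0 -> dot u v = 0.
    move=> ud; apply: (is_derive_dot_cst dc (k := dot u p)) => t.
    have := Sc t; rewrite SE => -[tc ->].
    by rewrite dotDr dotZr ud mulr0 addr0.
  have [k vE] : exists k, v = k *: d.
    exists (dot d v / dot d d).
    have dd := lt0r_neq0 (dotvv_gt0 d0).
    apply/eqP; rewrite -subr_eq0 -dotvv_eq0 {1}dotDl dotNl.
    have H u : dot u d = 0 -> dot u (v - dot d v / dot d d *: d) = 0.
      by move=> ud; rewrite dotDr dotNr dotZr ud (vd u ud) mulr0 subr0.
    rewrite -dotNl -dotDl H// dotDl dotNl dotZl (dotC v d) divfK ?subrr//.
  move=> t; rewrite /circ_arc dot0l mul0r mulr0 addr0 invr1 scale1r scaler0 addr0 SE.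
  by exists (tQ + t * k); rewrite QE vE scalerDl -scalerA addrA.
move: SQ; rewrite {1}SE => -[Qr nQ].
have nv : dot n v = 0.
  apply: (is_derive_dot_cst dc (k := dot n a)) => t.
  by have := Sc t; rewrite SE => -[_ /eqP]; rewrite dotDr dotNr subr_eq0 => /eqP.
have Qv : dot (Q - a) v = 0.
  rewrite -c0; apply: (is_derive_sphere_cst dc (k := r ^+ 2)) => t.
  by have := Sc t; rewrite SE => -[].
have [w vw H] := proper_circle_arc r0 Qr nQ nv Qv v0.
by exists w => // t; rewrite SE; exact: H.
Qed.

Lemma arc_tangent S Q v w : v != 0 -> (forall t, S (circ_arc Q v w t)) ->
  tangent_direction S Q v.
Proof.
move=> v0 H; split=> //; exists (circ_arc Q v w); split=> //; first exact: arc_at0.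
by rewrite -{2}(arc1_at0 v w); exact: is_derive_arc.
Qed.

Definition cross u v : 'rV[R]_3 := \row_i
  [:: u 0 1 * v 0 2%:R - u 0 2%:R * v 0 1;
      u 0 2%:R * v 0 0 - u 0 0 * v 0 2%:R;
      u 0 0 * v 0 1 - u 0 1 * v 0 0]`_i.

Lemma dot_crossl u v : dot u (cross u v) = 0.
Proof. by rewrite dotE !mxE /=; ring. Qed.

Lemma dot_crossr u v : dot v (cross u v) = 0.
Proof. by rewrite dotE !mxE /=; ring. Qed.

Lemma dot_cross_cross u v :
  dot (cross u v) (cross u v) = dot u u * dot v v - dot u v ^+ 2.
Proof. by rewrite !dotE !mxE /=; ring. Qed.

Lemma circle_tangent S Q : is_circle S -> S Q ->
  exists v, tangent_direction S Q v.
Proof.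
move=> [[p [d [d0 SE]]]|[a [n [r [n0 r0 SE]]]]]; rewrite {1}SE.
  move=> [tQ QE]; exists d; apply: (@arc_tangent _ _ _ 0) => // t.
  rewrite /circ_arc dot0l mul0r mulr0 addr0 invr1 scale1r scaler0 addr0 SE.
  by exists (tQ + t); rewrite QE scalerDl addrA.
move=> [Qr nQ]; exists (cross n (Q - a)).
have c0 : cross n (Q - a) != 0.
  rewrite -dotvv_eq0 dot_cross_cross nQ expr0n subr0 Qr mulf_neq0//.
    by rewrite dotvv_eq0.
  by rewrite lt0r_neq0// exprn_gt0.
have [w vw H] := proper_circle_arc r0 Qr nQ (dot_crossl _ _) (dot_crossr _ _) c0.
by apply: (@arc_tangent _ _ _ w) => // t; rewrite SE; exact: H.
Qed.

End Arcs.

(** * Derivatives of a function along an arc *)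
Section ArcChain.
Context {R : realType}.
Implicit Types (u v w x Q : 'rV[R]_3) (t : R) (O : set 'rV[R]_3) (h g : 'rV[R]_3 -> R).

Lemma Cinf_D O h v : Cinf O h -> Cinf O ('D_v h).
Proof. by move=> Ch k; exact: (Ch k.+1).2. Qed.

Lemma Cinf_diff O h x : Cinf O h -> O x -> differentiable h x.
Proof. by move=> Ch; exact: (Ch 1%N).1. Qed.

Lemma near_derive_eq0 (H H' : R -> R) : (\forall t \near (0 : R), H t = 0) ->
  (\forall t \near (0 : R), is_derive t (1 : R) H (H' t)) -> \forall t \near (0 : R), H' t = 0.
Proof.
move=> H0 dH; have := nbhs_interior H0; apply: filterS2 dH => t [_ <-] nt.
by rewrite (@near_eq_derive _ _ _ H (cst 0)) ?derive_cst.
Qed.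

Variables (Q v w : 'rV[R]_3).
Let y := circ_arc Q v w.
Let y1 := circ_arc1 v w.
Let y2 := circ_arc2 v w.
Let y3 := (- 6 * (dot w w / dot v v)) *: v.

Lemma is_derive_along_arc g t : differentiable g (y t) ->
  is_derive t 1 (fun t => g (y t)) (\sum_i y1 t 0 i * 'D_(e_ i) g (y t)).
Proof.
move=> dg; have dy := is_derive_arc Q v w t.
by rewrite -(derive_sum_e _ dg); exact: is_derive_comp.
Qed.

(** Derivatives of orders 1, 2 and 3 of [h] along the arc, the last one at the
parameter 0 only, expressed by the partial derivatives of [h]. *)
Definition arcH1 h t := \sum_i y1 t 0 i * 'D_(e_ i) h (y t).
Definition arcH2 h t := \sum_i (y2 t 0 i * 'D_(e_ i) h (y t)
     + y1 t 0 i * \sum_j y1 t 0 j * 'D_(e_ j) ('D_(e_ i) h) (y t)).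
Definition arcH3 h := \sum_i (y3 0 i * 'D_(e_ i) h Q
     + \sum_j (4 * w 0 i * v 0 j + 2 * v 0 i * w 0 j) * 'D_(e_ j) ('D_(e_ i) h) Q
     + \sum_j \sum_k v 0 i * v 0 j * v 0 k *
         'D_(e_ k) ('D_(e_ j) ('D_(e_ i) h)) Q).

Lemma is_derive_arcH1 O h t : Cinf O h -> O (y t) ->
  is_derive t 1 (arcH1 h) (arcH2 h t).
Proof.
move=> Ch Oy; rewrite /arcH1 /arcH2.
have -> : (fun t => \sum_i y1 t 0 i * 'D_(e_ i) h (y t))
   = \sum_i (fun t => y1 t 0 i * 'D_(e_ i) h (y t)).
  by apply/funext => s; rewrite fct_sumE.
apply: is_derive_sum => i.
have d1 := (is_derive_row _ _ _ _).1 (is_derive_arc1 v w t) i.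
have d2 := is_derive_along_arc (Cinf_diff (Cinf_D (e_ i) Ch) Oy).
by apply: is_derive_eq; rewrite /GRing.scale /= addrC [X in X + _]mulrC.
Qed.

Lemma is_derive_arcH2 O h : Cinf O h -> O Q ->
  is_derive (0 : R) 1 (arcH2 h) (arcH3 h).
Proof.
move=> Ch OQ; have Oy : O (y 0) by rewrite /y arc_at0.
rewrite /arcH2 /arcH3.
have -> : (fun t => \sum_i (y2 t 0 i * 'D_(e_ i) h (y t)
     + y1 t 0 i * \sum_j y1 t 0 j * 'D_(e_ j) ('D_(e_ i) h) (y t)))
   = \sum_i ((fun t => y2 t 0 i * 'D_(e_ i) h (y t))
     + \sum_j (fun t => y1 t 0 i * y1 t 0 j * 'D_(e_ j) ('D_(e_ i) h) (y t))).
  apply/funext => s; rewrite fct_sumE; apply: eq_bigr => i _.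
  rewrite fctE fct_sumE mulr_sumr; congr (_ + _).
  by apply: eq_bigr => j _; rewrite mulrA.
have y10 k : y1 0 0 k = v 0 k by rewrite /y1 arc1_at0.
have y20 k : y2 0 0 k = 2 * w 0 k by rewrite /y2 arc2_at0 mxE.
have y00 : y 0 = Q by rewrite /y arc_at0.
apply: is_derive_sum => i.
have Di := Cinf_D (e_ i) Ch.
have [g1 g1E] : exists g1 : R, 'D_(e_ i) h Q = g1 by exists ('D_(e_ i) h Q).
have [g2 g2E] : exists g2 : 'I_3 -> R, forall j, 'D_(e_ j) ('D_(e_ i) h) Q = g2 j.
  by exists (fun j => 'D_(e_ j) ('D_(e_ i) h) Q).
have [g3 g3E] : exists g3 : 'I_3 -> 'I_3 -> R,
    forall j k, 'D_(e_ k) ('D_(e_ j) ('D_(e_ i) h)) Q = g3 j k.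
  by exists (fun j k => 'D_(e_ k) ('D_(e_ j) ('D_(e_ i) h)) Q).
have d2 : is_derive (0 : R) 1 (fun t => 'D_(e_ i) h (y t)) (\sum_k v 0 k * g2 k).
  apply: is_derive_eq (is_derive_along_arc (Cinf_diff Di Oy)) _.
  by apply: eq_bigr => k _; rewrite y10 y00 g2E.
have d3 := (is_derive_row _ _ _ _).1 (is_derive_arc2_0 v w) i.
have dj j : is_derive (0 : R) 1
    (fun t => y1 t 0 i * y1 t 0 j * 'D_(e_ j) ('D_(e_ i) h) (y t))
    (v 0 i * v 0 j * (\sum_k v 0 k * g3 j k)
     + g2 j * (v 0 i * (2 * w 0 j) + v 0 j * (2 * w 0 i))).
  have Dj := Cinf_D (e_ j) Di.
  have d4 : is_derive (0 : R) 1 (fun t => 'D_(e_ j) ('D_(e_ i) h) (y t))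
      (\sum_k v 0 k * g3 j k).
    apply: is_derive_eq (is_derive_along_arc (Cinf_diff Dj Oy)) _.
    by apply: eq_bigr => k _; rewrite y10 y00 g3E.
  have d5 := (is_derive_row _ _ _ _).1 (is_derive_arc1 v w 0) i.
  have d6 := (is_derive_row _ _ _ _).1 (is_derive_arc1 v w 0) j.
  by apply: is_derive_eq; rewrite /GRing.scale /= -!/(y2 _) !y20 !y10 y00 g2E.
have dF1 : is_derive (0 : R) 1 (fun t => y2 t 0 i * 'D_(e_ i) h (y t))
   (y2 0 0 i * (\sum_k v 0 k * g2 k) + g1 * y3 0 i).
  by apply: is_derive_eq; rewrite /GRing.scale /= y00 g1E.
have dF := is_deriveD dF1 (is_derive_sum dj).
apply: is_derive_eq dF _.
rewrite g1E y20; transitivity (y3 0 i * g1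
  + \sum_j (4 * w 0 i * v 0 j + 2 * v 0 i * w 0 j) * g2 j
  + \sum_j \sum_k v 0 i * v 0 j * v 0 k * g3 j k).
  by move: (y3 0 i) => y3i; rewrite !sum3; ring.
congr (_ + _ + _).
  by apply: eq_bigr => j _; rewrite g2E.
by apply: eq_bigr => j _; apply: eq_bigr => k _; rewrite g3E.
Qed.

Lemma is_derive_comb n (c : 'I_n -> R) (F : 'I_n -> R -> R) (d : 'I_n -> R) t :
  (forall a, is_derive t 1 (F a) (d a)) ->
  is_derive t 1 (fun s => \sum_a c a * F a s) (\sum_a c a * d a).
Proof.
move=> dF.
have -> : (fun s => \sum_a c a * F a s) = \sum_a (fun s => c a * F a s).
  by apply/funext => s; rewrite fct_sumE.
by apply: is_derive_sum => a; have := dF a => dFa.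
Qed.

(** A linear equation satisfied by the coordinates along the arc is inherited by
the derivatives of the coordinates. *)
Lemma arc_vanish n O (h : 'I_n -> 'rV[R]_3 -> R) (c : 'I_n -> R) :
  (forall a, Cinf O (h a)) -> open O -> O Q ->
  (\forall t \near (0 : R), \sum_a c a * h a (y t) = 0) ->
  [/\ \sum_a c a * arcH1 (h a) 0 = 0, \sum_a c a * arcH2 (h a) 0 = 0 &
      \sum_a c a * arcH3 (h a) = 0].
Proof.
move=> Ch oO OQ h0.
have nO : \forall t \near (0 : R), O (y t).
  have [dy _] := is_derive_arc Q v w 0.
  have cy : {for (0 : R), continuous y}.
    by apply/differentiable_continuous/derivable1_diffP.
  by apply: cy; rewrite /y arc_at0; exact: open_nbhs_nbhs.
have H1 : \forall t \near (0 : R), \sum_a c a * arcH1 (h a) t = 0.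
  apply: (near_derive_eq0 h0); apply: filterS nO => t Oyt.
  by apply: is_derive_comb => a; exact/is_derive_along_arc/(Cinf_diff (Ch a)).
have H2 : \forall t \near (0 : R), \sum_a c a * arcH2 (h a) t = 0.
  apply: (near_derive_eq0 H1); apply: filterS nO => t Oyt.
  by apply: is_derive_comb => a; exact: is_derive_arcH1.
split; [exact: (nbhs_singleton H1)|exact: (nbhs_singleton H2)|].
have [_ <-] := is_derive_comb c (fun a => is_derive_arcH2 (Ch a) OQ).
by rewrite (near_eq_derive _ H2) (derive_cst (0 : R)).
Qed.

Lemma arcH1_0 h : arcH1 h 0 = \sum_i v 0 i * 'D_(e_ i) h Q.
Proof. by rewrite /arcH1 /y1 arc1_at0 /y arc_at0. Qed.

Lemma arcH2_0 h : arcH2 h 0 = \sum_i (2 * w 0 i * 'D_(e_ i) h Q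
     + \sum_j v 0 i * v 0 j * 'D_(e_ j) ('D_(e_ i) h) Q).
Proof.
rewrite /arcH2 /y1 arc1_at0 /y2 arc2_at0 /y arc_at0; apply: eq_bigr => i _.
by rewrite mxE mulr_sumr; congr (_ + _); apply: eq_bigr => j _; rewrite mulrA.
Qed.

End ArcChain.

(** * Third order contact with a projective line *)
Section LineJet.
Context {R : realType}.

(** In the affine chart where the [i]-th coordinate is 1, a projective line is an
affine line, and the vectors with [i]-th coordinate 0 are its directions. *)
Lemma mem_line2 n (L : {vspace 'rV[R]_n}) (p d u : 'rV[R]_n) i :
  \dim L = 2 -> p \in L -> d \in L -> u \in L ->
  p 0 i = 1 -> d 0 i = 0 -> d != 0 -> u 0 i = 0 -> exists b, u = b *: d.
Proof.
move=> dL pL dL' uL pi di d0 ui.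
have pd : (<[p]> :&: <[d]> = 0)%VS.
  apply/eqP; rewrite -subv0; apply/subvP => x /memv_capP[/vlineP[a ->] /vlineP[b E]].
  have : (a *: p) 0 i = (b *: d) 0 i by rewrite E.
  by rewrite !mxE pi di mulr1 mulr0 => ->; rewrite scale0r mem0v.
have p0 : p != 0.
  by apply: contra_eq_neq pi => ->; rewrite mxE eq_sym oner_eq0.
have E : (<[p]> + <[d]> = L)%VS.
  apply/eqP; rewrite eqEdim subv_add -!memvE pL dL' /= dL.
  by rewrite dimv_disjoint_sum// !dim_vline p0 d0.
move: uL; rewrite -E => /memv_addP[x /vlineP[a ->] [z /vlineP[b ->] uE]].
exists b; move: ui; rewrite uE !mxE pi di mulr1 mulr0 addr0 => ->.
by rewrite scale0r add0r.
Qed.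

Lemma Cinf_locally_cst (O : set 'rV[R]_3) (h : 'rV[R]_3 -> R) k v : open O ->
  (forall x, O x -> h x = k) -> forall x, O x -> 'D_v h x = 0.
Proof.
move=> oO hk x Ox; rewrite (@near_eq_derive _ _ _ h (cst k)) ?derive_cst//.
exact: (near_eq_in oO Ox).
Qed.

Lemma arcH_cst (O : set 'rV[R]_3) (h : 'rV[R]_3 -> R) k Q v w : open O -> O Q ->
  (forall x, O x -> h x = k) ->
  [/\ arcH1 Q v w h 0 = 0, arcH2 Q v w h 0 = 0 & arcH3 Q v w h = 0].
Proof.
move=> oO OQ hk; have h1 i := Cinf_locally_cst (e_ i) oO hk.
have h2 i j := Cinf_locally_cst (e_ j) oO (h1 i).
have h3 i j l := Cinf_locally_cst (e_ l) oO (h2 i j).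
rewrite arcH1_0 arcH2_0 /arcH3; split; apply: big1 => i _; rewrite h1// mulr0//.
  by rewrite add0r big1// => j _; rewrite h2// mulr0.
rewrite add0r -[RHS]addr0; congr (_ + _).
  by apply: big1 => j _; rewrite h2// mulr0.
by apply: big1 => j _; apply: big1 => l _; rewrite h3// mulr0.
Qed.

(** Along a curve in an affine line all derivatives are multiples of the first
one as soon as that one does not vanish. *)
Lemma line_jet (O : set 'rV[R]_3) n (X : 'rV[R]_3 -> 'rV[R]_n) i0 Q v w
   (L : {vspace 'rV[R]_n}) :
  open O -> O Q -> (forall a, Cinf O (fun x => X x 0 a)) ->
  (forall x, O x -> X x 0 i0 = 1) -> \dim L = 2 ->
  (\forall t \near (0 : R), X (circ_arc Q v w t) \in L) ->
  \row_a arcH1 Q v w (fun x => X x 0 a) 0 != 0 ->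
  exists b g, forall a,
    arcH2 Q v w (fun x => X x 0 a) 0 = b * arcH1 Q v w (fun x => X x 0 a) 0 /\
    arcH3 Q v w (fun x => X x 0 a) = g * arcH1 Q v w (fun x => X x 0 a) 0.
Proof.
move=> oO OQ CX X1 dL XL D1n0.
set D1 : 'rV[R]_n := \row_a _ in D1n0.
pose D2 : 'rV[R]_n := \row_a arcH2 Q v w (fun x => X x 0 a) 0.
pose D3 : 'rV[R]_n := \row_a arcH3 Q v w (fun x => X x 0 a).
(* the entries of this projector are linear equations of the line *)
pose pi (u : 'rV[R]_n) := u - projv L u.
pose c (b a : 'I_n) : R := pi (delta_mx 0 a) 0 b.
have piE u b : pi u 0 b = \sum_a c b a * u 0 a.
  rewrite {1}(row_sum_delta u) /pi linear_sum -sumrB summxE; apply: eq_bigr => a _.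
  by rewrite linearZ /c /pi !mxE; ring.
have piP u : (u \in L) <-> (forall b, \sum_a c b a * u 0 a = 0).
  split=> [uL b|H]; first by rewrite -piE /pi projv_id// subrr mxE.
  have : pi u = 0 by apply/rowP => b; rewrite piE H mxE.
  by move/eqP; rewrite subr_eq0 => /eqP ->; exact: memv_proj.
have V b : [/\ \sum_a c b a * D1 0 a = 0, \sum_a c b a * D2 0 a = 0 &
      \sum_a c b a * D3 0 a = 0].
  have [|V1 V2 V3] := @arc_vanish R Q v w n O (fun a x => X x 0 a) (c b) CX oO OQ.
    by apply: filterS XL => t /piP.
  by split; [rewrite -[RHS]V1|rewrite -[RHS]V2|rewrite -[RHS]V3];
    apply: eq_bigr => a _; rewrite !mxE.
have D1L : D1 \in L by apply/piP => b; case: (V b).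
have D2L : D2 \in L by apply/piP => b; case: (V b).
have D3L : D3 \in L by apply/piP => b; case: (V b).
have QL : X Q \in L by have := nbhs_singleton XL; rewrite arc_at0.
have [z1 z2 z3] := @arcH_cst O (fun x => X x 0 i0) 1 Q v w oO OQ X1.
have [||b E2] := mem_line2 dL QL D1L D2L (X1 _ OQ) _ D1n0; rewrite ?mxE//.
have [||g E3] := mem_line2 dL QL D1L D3L (X1 _ OQ) _ D1n0; rewrite ?mxE//.
exists b, g => a; split.
  by have /rowP/(_ a) := E2; rewrite !mxE.
by have /rowP/(_ a) := E3; rewrite !mxE.
Qed.

End LineJet.

(** * Polynomial functions *)
Section PolyLines.
Context {R : realType}.
Implicit Types (v x y : 'rV[R]_3) (F G : 'rV[R]_3 -> R).

Lemma poly_near0_eq0 (p : {poly R}) : (\forall t \near (0 : R), p.[t] = 0) -> p = 0.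
Proof.
move=> /nbhs_ballP[d /= d0 pd].
pose rs := [seq d / (k.+2)%:R | k <- iota 0 (size p)].
apply: (@roots_geq_poly_eq0 _ p rs); last by rewrite size_map size_iota.
  apply/allP => _ /mapP[k _ ->]; apply/eqP/pd; rewrite -ball_normE /= sub0r normrN.
  rewrite ger0_norm ?divr_ge0 ?ler0n// ?ltW//.
  by rewrite ltr_pdivrMr ?ltr0n// ltr_pMr// ltr1n.
rewrite map_inj_uniq ?iota_uniq// => k l /(mulfI (lt0r_neq0 d0)) /invr_inj /eqP.
by rewrite eqr_nat => /eqP[].
Qed.

Lemma poly_ext (p q : {poly R}) : (forall t, p.[t] = q.[t]) -> p = q.
Proof.
move=> pq; apply/eqP; rewrite -subr_eq0; apply/eqP/poly_near0_eq0.
by apply: filterE => t; rewrite hornerD hornerN pq subrr.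
Qed.

(** Being polynomial on every straight line is all that is used: it gives the
identity principle, and the restriction to a line on which [dot v v] equals
[1 + t ^+ 2] replaces evaluation at complex isotropic vectors. *)
Definition polyfun F := forall x y, exists p : {poly R}, forall t, F (x + t *: y) = p.[t].

Lemma polyfun_cst a : polyfun (fun=> a).
Proof. by move=> x y; exists a%:P => t; rewrite hornerC. Qed.

Lemma polyfun_coord i : polyfun (fun v => v 0 i).
Proof.
move=> x y; exists ((x 0 i)%:P + (y 0 i)%:P * 'X) => t.
by rewrite !mxE !hornerE mulrC.
Qed.

Lemma polyfunD F G : polyfun F -> polyfun G -> polyfun (fun v => F v + G v).
Proof.
move=> pF pG x y; have [p Fp] := pF x y; have [q Gq] := pG x y.
by exists (p + q) => t; rewrite hornerD Fp Gq.
Qed.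

Lemma polyfunM F G : polyfun F -> polyfun G -> polyfun (fun v => F v * G v).
Proof.
move=> pF pG x y; have [p Fp] := pF x y; have [q Gq] := pG x y.
by exists (p * q) => t; rewrite hornerM Fp Gq.
Qed.

Lemma polyfunN F : polyfun F -> polyfun (fun v => - F v).
Proof.
move=> pF x y; have [p Fp] := pF x y.
by exists (- p) => t; rewrite hornerN Fp.
Qed.

Lemma polyfunB F G : polyfun F -> polyfun G -> polyfun (fun v => F v - G v).
Proof. by move=> pF pG; apply: polyfunD => //; exact: polyfunN. Qed.

Lemma polyfunX F n : polyfun F -> polyfun (fun v => F v ^+ n).
Proof.
move=> pF x y; have [p Fp] := pF x y.
by exists (p ^+ n) => t; rewrite horner_exp Fp.
Qed.

Lemma polyfun_sum n (F : 'I_n -> 'rV[R]_3 -> R) : (forall i, polyfun (F i)) ->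
  polyfun (fun v => \sum_i F i v).
Proof.
move=> pF x y; have [p Fp] := choice (fun i => pF i x y).
by exists (\sum_i p i) => t; rewrite horner_sum; apply: eq_bigr => i _.
Qed.

Lemma polyfun_open_eq0 F (K : set 'rV[R]_3) : polyfun F -> open K -> K !=set0 ->
  (forall v, K v -> F v = 0) -> forall v, F v = 0.
Proof.
move=> pF oK [u Ku] KF v; have [p Fp] := pF u (v - u).
suff p0 : p = 0 by have := Fp 1; rewrite p0 horner0 scale1r addrC subrK.
apply: poly_near0_eq0.
have : \forall t \near (0 : R), K (u + t *: (v - u)).
  have c : {for (0 : R), continuous (fun t : R => u + t *: (v - u))}.
    apply: continuousD; first exact: cst_continuous.
    by rewrite /prop_for /continuous_at; apply: cvgZr_tmp; exact: cvg_id.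
  by apply: c; rewrite scale0r addr0; exact: open_nbhs_nbhs.
by apply: filterS => t /KF; rewrite Fp.
Qed.

(** Since [1 + 'X^2] is square-free, it divides the cubic itself, whose remainder
is [(p0 - p2) + (p1 - p3) * 'X].  This is the real form of the statement that
a quantity whose square vanishes on isotropic vectors vanishes there. *)
Lemma sqr_dvd_1DX2 (p0 p1 p2 p3 : R) (E : {poly R}) :
  (forall t, (p0 + p1 * t + p2 * t ^+ 2 + p3 * t ^+ 3) ^+ 2 = (1 + t ^+ 2) * E.[t]) ->
  p0 = p2 /\ p1 = p3.
Proof.
move=> H; pose r0 := p0 - p2; pose r1 := p1 - p3.
pose M : {poly R} := 'X^2 + 1%:P.
have mM : M \is monic.
  by rewrite /M monicE lead_coefDl ?lead_coefXn// size_polyXn size_polyC oner_neq0.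
have sM : size M = 3%N by rewrite /M size_polyDl size_polyXn// size_polyC oner_neq0.
pose Q : {poly R} := p2%:P + p3%:P * 'X.
pose r : {poly R} := r0%:P + r1%:P * 'X.
pose E' := E - Q * (Q * M + 2%:P * r).
have EE : M * E' = r ^+ 2.
  apply: poly_ext => t; have := H t; rewrite /E' /M /Q /r /r0 /r1 !hornerE /=.
  by move: E.[t] => e He; lra.
have r2 : (size (r ^+ 2)%R <= 3)%N.
  have sr : (size r <= 2)%N.
    rewrite /r (leq_trans (size_polyD _ _))// geq_max (leq_trans (size_polyC_leq1 _))//=.
    by rewrite (leq_trans (size_polyMleq _ _))// size_polyX addn2 ltnS size_polyC_leq1.
  rewrite expr2 (leq_trans (size_polyMleq _ _))//.
  by case: (size r) sr => [|[|[|]]].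
have sE : (size E' <= 1)%N.
  have [->|E0] := eqVneq E' 0; first by rewrite size_poly0.
  by move: r2; rewrite -EE mulrC size_Mmonic// sM addn3.
have eE : forall t, (1 + t ^+ 2) * E'`_0 = (r0 + r1 * t) ^+ 2.
  move=> t; have := congr1 (horner^~ t) EE.
  by rewrite [E']size1_polyC// /M /r !hornerE /= coefC eqxx => <-; rewrite addrC.
have := eE 0; have := eE 1; have := eE (-1); move: (E'`_0) => e h1 h2 h3.
have /eqP : r0 * r1 = 0 by lra.
have r01 : r0 ^+ 2 = r1 ^+ 2 by lra.
rewrite mulf_eq0 => r0r1.
have {r0r1} [r00 r10] : r0 = 0 /\ r1 = 0.
  case/orP: r0r1 => /eqP z; move: r01; rewrite z expr0n /=.
    by move=> /esym/eqP; rewrite expf_eq0 /= => /eqP.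
  by move=> /eqP; rewrite expf_eq0 /= => /eqP.
by split; apply/eqP; rewrite -subr_eq0; apply/eqP.
Qed.

End PolyLines.

(** * The shape of the acceleration form *)
Section Tensor.
Context {R : realType}.
Implicit Types (u v w x y z : 'rV[R]_3).

Definition bil (a : 'I_3 -> 'I_3 -> 'I_3 -> R) u v : 'rV[R]_3 :=
  \row_k \sum_i \sum_j u 0 i * v 0 j * a i j k.
Definition cub (b : 'I_3 -> 'I_3 -> 'I_3 -> 'I_3 -> R) v : 'rV[R]_3 :=
  \row_m \sum_i \sum_j \sum_k v 0 i * v 0 j * v 0 k * b i j k m.

Variables (a : 'I_3 -> 'I_3 -> 'I_3 -> R) (b : 'I_3 -> 'I_3 -> 'I_3 -> 'I_3 -> R).
Hypothesis a_sym : forall i j k, a i j k = a j i k.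

Lemma bilDl u v w : bil a (u + v) w = bil a u w + bil a v w.
Proof.
apply/rowP => k; rewrite !mxE -big_split; apply: eq_bigr => i _.
by rewrite -big_split; apply: eq_bigr => j _; rewrite !mxE /=; ring.
Qed.

Lemma bilZl (s : R) v w : bil a (s *: v) w = s *: bil a v w.
Proof.
apply/rowP => k; rewrite !mxE mulr_sumr; apply: eq_bigr => i _.
by rewrite mulr_sumr; apply: eq_bigr => j _; rewrite !mxE /=; ring.
Qed.

Lemma bilC u v : bil a u v = bil a v u.
Proof.
apply/rowP => k; rewrite !mxE exchange_big; apply: eq_bigr => i _.
by apply: eq_bigr => j _; rewrite a_sym [u _ _ * _]mulrC.
Qed.

Lemma bilDr u v w : bil a w (u + v) = bil a w u + bil a w v.
Proof. by rewrite bilC bilDl !(bilC w). Qed.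

Lemma bilZr (s : R) v w : bil a w (s *: v) = s *: bil a w v.
Proof. by rewrite bilC bilZl !(bilC w). Qed.

Lemma polyfun_bil (F G : 'rV[R]_3 -> 'rV[R]_3) k :
  (forall i, polyfun (fun v => F v 0 i)) -> (forall i, polyfun (fun v => G v 0 i)) ->
  polyfun (fun v => bil a (F v) (G v) 0 k).
Proof.
move=> pF pG.
have -> : (fun v => bil a (F v) (G v) 0 k)
  = (fun v => \sum_i \sum_j F v 0 i * G v 0 j * a i j k).
  by apply/funext => v; rewrite mxE.
apply: polyfun_sum => i; apply: polyfun_sum => j.
by apply: polyfunM; [exact: polyfunM|exact: polyfun_cst].
Qed.

Lemma polyfun_cub k : polyfun (fun v => cub b v 0 k).
Proof.
have -> : (fun v => cub b v 0 k)
  = (fun v => \sum_i \sum_j \sum_l v 0 i * v 0 j * v 0 l * b i j l k).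
  by apply/funext => v; rewrite mxE.
apply: polyfun_sum => i; apply: polyfun_sum => j; apply: polyfun_sum => l.
by do !apply: polyfunM; do ?[exact: polyfun_coord|exact: polyfun_cst].
Qed.

Lemma polyfun_dot (F G : 'rV[R]_3 -> 'rV[R]_3) :
  (forall i, polyfun (fun v => F v 0 i)) -> (forall i, polyfun (fun v => G v 0 i)) ->
  polyfun (fun v => dot (F v) (G v)).
Proof. by move=> pF pG; apply: polyfun_sum => i; exact: polyfunM. Qed.

Let A v := bil a v v.
Let p v := dot (A v) v.
Let C v := cub b v - 3%:R *: bil a v (A v).

Let polA i : polyfun (fun v => A v 0 i).
Proof. by apply: polyfun_bil => j; exact: polyfun_coord. Qed.

Let polp : polyfun p.
Proof. by apply: polyfun_dot => // j; exact: polyfun_coord. Qed.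

Let polC i : polyfun (fun v => C v 0 i).
Proof.
have -> : (fun v => C v 0 i) = (fun v => cub b v 0 i - 3%:R * bil a v (A v) 0 i).
  by apply/funext => v; rewrite /C !mxE.
apply: polyfunB; first exact: polyfun_cub.
apply: polyfunM; first exact: polyfun_cst.
by apply: polyfun_bil => // j; exact: polyfun_coord.
Qed.

Let polCv : polyfun (fun v => dot (C v) v).
Proof. by apply: polyfun_dot => // j; exact: polyfun_coord. Qed.

Let polvv : polyfun (fun v => dot v v).
Proof. by apply: polyfun_dot => j; exact: polyfun_coord. Qed.

(** The conditions on the velocity [v] and the half acceleration [w] for an arc to
have third order contact with a line of the image, [a] and [b] being the
coefficients of the second and third derivatives of the map. *)
Definition circle_direction v := v != 0 /\ exists w be ga,
  [/\ dot v w = 0, 2%:R *: w = A v + be *: v & cub b v - 6%:R *: bil a v w = ga *: v].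

(** The first condition determines [be = - p v / dot v v] by orthogonality, and
then [w]; after substitution the second one says that [C v - 3 be A v] is a
multiple of [v]. *)
Lemma circle_direction_poly v : circle_direction v ->
  dot v v *: (dot v v *: C v + (3 * p v) *: A v)
  = (dot (C v) v * dot v v + 3 * p v ^+ 2) *: v.
Proof.
move=> [v0 [w [be [ga [vw E2 E3]]]]].
have vv := lt0r_neq0 (dotvv_gt0 v0).
have beE : be * dot v v = - p v.
  have : dot v (2%:R *: w) = 0 by rewrite dotZr vw mulr0.
  by rewrite E2 dotDr dotZr /p dotC => /eqP; rewrite addrC addr_eq0 => /eqP.
have E4 : C v - (3 * be) *: A v = ga *: v.
  rewrite -E3 /C; have -> : 6%:R *: bil a v w = 3%:R *: bil a v (2%:R *: w).
    by rewrite bilZr scalerA; congr (_ *: _); ring.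
  by rewrite E2 bilDr bilZr scalerDr scalerA opprD addrA.
have {}E4 : C v = ga *: v + (3 * be) *: A v by rewrite -E4 subrK.
have -> : p v = - (be * dot v v) by rewrite beE opprK.
have -> : dot (C v) v = ga * dot v v - 3 * be * (be * dot v v).
  by rewrite E4 dotDl !dotZl -/(p v) beE; ring.
rewrite E4; move: (A v) (dot v v) => Av V; apply/rowP => k; rewrite !mxE; ring.
Qed.

Hypothesis open_circle_directions :
  exists K : set 'rV[R]_3, [/\ open K, K !=set0 & forall v, K v -> circle_direction v].

(** The polynomial identity extends from an open set of directions to all
vectors.  In this form it shows that [p v ^+ 2] vanishes together with
[dot v v] on complex vectors. *)
Lemma circle_identity v k :
  3 * p v ^+ 2 * v 0 k =
  dot v v * (dot v v * C v 0 k + 3 * p v * A v 0 k - dot (C v) v * v 0 k).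
Proof.
pose F v := 3 * p v ^+ 2 * v 0 k -
  dot v v * (dot v v * C v 0 k + 3 * p v * A v 0 k - dot (C v) v * v 0 k).
suff : F v = 0 by move=> /eqP; rewrite subr_eq0 => /eqP.
have [K [oK K0 KC]] := open_circle_directions.
apply: (polyfun_open_eq0 _ oK K0) => {v}[|v /KC/circle_direction_poly].
  have pk := polyfun_coord k; have p3 := polyfun_cst 3.
  apply: polyfunB; first by apply: polyfunM => //; apply: polyfunM => //; exact: polyfunX.
  apply: polyfunM => //; apply: polyfunB; last exact: polyfunM.
  by apply: polyfunD; [exact: polyfunM|apply: polyfunM => //; exact: polyfunM].
rewrite /F; move: (dot (C v) v) (p v) (C v) (A v) (dot v v) => cv pv Cv Av V.
by move=> /rowP/(_ k); rewrite !mxE => E; lra.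
Qed.

(** On the line [x + t y] the form [dot v v] is a multiple of [1 + t ^+ 2], with
root the isotropic vector [x + i y].  There the cubic [p] has a square
divisible by [1 + t ^+ 2], so it vanishes at [t = i]. *)
Lemma null_line_cubic x y k (p0 p1 p2 p3 : R) :
  dot x y = 0 -> dot x x = dot y y -> x 0 k != 0 -> y 0 k = 0 ->
  (forall t, p (x + t *: y) = p0 + p1 * t + p2 * t ^+ 2 + p3 * t ^+ 3) ->
  p0 = p2 /\ p1 = p3.
Proof.
move=> xy xxyy xk yk pE.
have vv t : dot (x + t *: y) (x + t *: y) = dot x x * (1 + t ^+ 2).
  by rewrite !(dotDl, dotDr, dotZl, dotZr) (dotC y) xy -xxyy; ring.
pose G v := dot v v * C v 0 k + 3 * p v * A v 0 k - dot (C v) v * v 0 k.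
have pG : polyfun G.
  have pk := polyfun_coord k; have pc := polyfun_cst 3.
  apply: polyfunB; last exact: polyfunM.
  by apply: polyfunD; [exact: polyfunM|apply: polyfunM => //; exact: polyfunM].
have [q qE] := pG x y.
apply: (@sqr_dvd_1DX2 R p0 p1 p2 p3 ((dot x x / (3 * x 0 k))%:P * q)) => t.
rewrite hornerM hornerC -qE -pE.
have := circle_identity (x + t *: y) k; rewrite -/(G _) vv.
have -> : (x + t *: y) 0 k = x 0 k by rewrite !mxE yk mulr0 addr0.
move: (p _) (G _) => pv g E; have x3 : 3 * x 0 k != 0 by rewrite mulf_neq0 ?pnatr_eq0.
by apply: (mulfI x3); rewrite mulrAC E; field.
Qed.

Lemma null_line_trace x y k :
  dot x y = 0 -> dot x x = dot y y -> x 0 k != 0 -> y 0 k = 0 ->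
  dot (bil a x x) x = 2 * dot (bil a x y) y + dot (bil a y y) x /\
  dot (bil a x x) y + 2 * dot (bil a x y) x = dot (bil a y y) y.
Proof.
move=> xy xxyy xk yk; apply: (null_line_cubic xy xxyy xk yk) => t.
rewrite /p /A !(bilDl, bilDr, bilZl, bilZr) !(dotDl, dotDr, dotZl, dotZr) (bilC y x).
ring.
Qed.

Lemma bil_e i j : bil a (e_ i) (e_ j) = \row_k a i j k.
Proof.
apply/rowP => k; rewrite !mxE (bigD1 i)//= [X in _ + X]big1 ?addr0 => [|l li].
  rewrite (bigD1 j)//= [X in _ + X]big1 ?addr0 => [|l lj]; last first.
    by rewrite !mxE (negbTE lj) andbF mulr0 mul0r.
  by rewrite !mxE !eqxx !mul1r.
by apply: big1 => m _; rewrite !mxE (negbTE li) andbF !mul0r.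
Qed.

Lemma dot_bil_e i j k : dot (bil a (e_ i) (e_ j)) (e_ k) = a i j k.
Proof. by rewrite dot_e bil_e mxE. Qed.

Lemma e_dot i j : dot (e_ i) (e_ j) = (i == j)%:R :> R.
Proof. by rewrite dot_e mxE eqxx eq_sym. Qed.

Lemma trace_diag i j : i != j -> a i i i = 2 * a i j j + a j j i.
Proof.
move=> ij; rewrite -!dot_bil_e; apply: (null_line_trace (k := i) _ _ _ _).1.
- by rewrite e_dot (negbTE ij).
- by rewrite !e_dot !eqxx.
- by rewrite mxE !eqxx oner_neq0.
- by rewrite mxE (negbTE ij) andbF.
Qed.

(** The isotropic vector is [3 e_0 + 4 e_1 + 5 i e_2]: real multiples of
Pythagorean triples mix the three coordinates without square roots. *)
Lemma trace_mixed : a 0 1 2%:R + a 0 2%:R 1 + a 1 2%:R 0 = 0.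
Proof.
have [||||_] := @null_line_trace (3 *: e_ 0 + 4 *: e_ 1) (5 *: e_ 2%:R) 0.
- by rewrite !(dotDl, dotDr, dotZl, dotZr) !e_dot /=; ring.
- by rewrite !(dotDl, dotDr, dotZl, dotZr) !e_dot /=; ring.
- by rewrite !mxE /= mulr1 mulr0 addr0 pnatr_eq0.
- by rewrite !mxE /= mulr0.
rewrite !(bilDl, bilDr, bilZl, bilZr) !(dotDl, dotDr, dotZl, dotZr) !dot_bil_e.
have h1 := @trace_diag 2%:R 0 isT; have h2 := @trace_diag 2%:R 1 isT.
rewrite !(a_sym 1 0) in h1 h2 *; rewrite (a_sym 2%:R 0) in h1; rewrite (a_sym 2%:R 1) in h2.
lra.
Qed.

(** A cubic form vanishing on the isotropic cone is divisible by [dot v v].  The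
quotient [l] is read off on the coordinate vectors. *)
Lemma trace_part v : p v = dot (\row_i a i i i) v * dot v v.
Proof.
have h1 := @trace_diag 0 1 isT; have h2 := @trace_diag 0 2%:R isT.
have h3 := @trace_diag 1 0 isT; have h4 := @trace_diag 1 2%:R isT.
have h5 := @trace_diag 2%:R 0 isT; have h6 := @trace_diag 2%:R 1 isT.
have h7 := trace_mixed.
rewrite /p /A /bil !dotE !mxE !sum3.
rewrite !(a_sym 1 0) !(a_sym 2%:R 0) !(a_sym 2%:R 1) in h1 h2 h3 h4 h5 h6 h7 *.
have {}h1 : a 1 1 0 = a 0 0 0 - 2 * a 0 1 1 by lra.
have {}h2 : a 2%:R 2%:R 0 = a 0 0 0 - 2 * a 0 2%:R 2%:R by lra.
have {}h3 : a 0 0 1 = a 1 1 1 - 2 * a 0 1 0 by lra.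
have {}h4 : a 2%:R 2%:R 1 = a 1 1 1 - 2 * a 1 2%:R 2%:R by lra.
have {}h5 : a 0 0 2%:R = a 2%:R 2%:R 2%:R - 2 * a 0 2%:R 0 by lra.
have {}h6 : a 1 1 2%:R = a 2%:R 2%:R 2%:R - 2 * a 1 2%:R 1 by lra.
have {}h7 : a 1 2%:R 0 = - a 0 1 2%:R - a 0 2%:R 1 by lra.
rewrite h1 h2 h3 h4 h5 h6 h7; ring.
Qed.

Let l v := dot (\row_i a i i i) v.

Lemma trace_polarized v u :
  2 * dot (bil a v u) v + dot (A v) u = l u * dot v v + 2 * l v * dot v u.
Proof.
have h1 := trace_part (v + u); have h2 := trace_part (v - u).
have h3 := trace_part u; move: h1 h2 h3.
rewrite -scaleN1r /p /A -/(l _) !(bilDl, bilDr, bilZl, bilZr) !(dotDl, dotDr, dotZl, dotZr).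
rewrite -!/(l _) (bilC u v) (dotC u v) /l !(dotDr, dotZr).
by move=> h1 h2 h3; lra.
Qed.

Hypothesis trace_derivative :
  exists2 lam, polyfun lam & forall v, dot (bil a v (A v) - cub b v) v = lam v * dot v v.

(** Insert [p v = l v * dot v v] into [circle_identity], simplify by [dot v v], and
eliminate [dot (bil a v (A v)) v] by polarization and by the derivative of the
trace identity: every remaining term but [dot (A v) (A v)] has the factor
[dot v v].  Thus [A v] is isotropic when [v] is. *)
Lemma norm_null i j : i != j ->
  exists q : {poly R}, forall t, let v := e_ i + t *: e_ j in
    dot (A v) (A v) = (1 + t ^+ 2) * q.[t].
Proof.
move=> ij; have [lam plam lamE] := trace_derivative.
pose G v := lam v + C v 0 i + 3 * l v * A v 0 i - 3 * l v ^+ 2 * v 0 i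
    + l (A v) + 2 * l v ^+ 2.
have pl (F : 'rV[R]_3 -> 'rV[R]_3) : (forall k, polyfun (fun v => F v 0 k)) ->
    polyfun (fun v => l (F v)).
  by move=> pF; apply: polyfun_dot => // k; exact: polyfun_cst.
have plv : polyfun l by apply: (pl id) => k; exact: polyfun_coord.
have pG : polyfun G.
  have pk := polyfun_coord i; have p3 := polyfun_cst 3; have p2 := polyfun_cst 2.
  have q1 : polyfun (fun v => 3 * l v * A v 0 i).
    by apply: polyfunM => //; exact: polyfunM.
  have q2 : polyfun (fun v => 3 * l v ^+ 2 * v 0 i).
    by apply: polyfunM => //; apply: polyfunM => //; exact: polyfunX.
  have q3 : polyfun (fun v => 2 * l v ^+ 2) by apply: polyfunM => //; exact: polyfunX.
  have q4 := pl A polA.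
  exact: (polyfunD (polyfunD (polyfunB (polyfunD (polyfunD plam (polC i)) q1) q2) q4) q3).
have [q qE] := pG (e_ i) (e_ j); exists q => t v.
rewrite -qE -/v.
have vv : dot v v = 1 + t ^+ 2.
  rewrite /v !(dotDl, dotDr, dotZl, dotZr) !e_dot !eqxx [j == i]eq_sym (negbTE ij) /=; ring.
have vv0 : dot v v != 0 by rewrite vv lt0r_neq0// ltr_pwDl// sqr_ge0.
have vi : v 0 i = 1 by rewrite !mxE !eqxx (negbTE ij) /=; ring.
have h1 := circle_identity v i; have h2 := trace_part v; have h3 := trace_polarized v (A v).
have h4 : dot (C v) v = dot (cub b v) v - 3 * dot (bil a v (A v)) v.
  by rewrite /C dotDl dotNl dotZl.
have h5 := lamE v; rewrite dotDl dotNl in h5.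
have h6 : dot (C v) v = dot v v * (C v 0 i + 3 * l v * A v 0 i - 3 * l v ^+ 2).
  apply: (mulfI vv0); move: h1; rewrite h2 vi -/(l v) => h1; lra.
rewrite /G -vv vi; rewrite (dotC v) -/(p v) h2 -/(l v) in h3.
move: h3 h4 h5 h6; move: (dot (bil a v (A v)) v) (dot (cub b v) v) (dot (C v) v) => x y z.
move: (dot v v) (l v) (l (A v)) (C v 0 i) (A v 0 i) (lam v) (dot (A v) (A v)) => V lv lA Ci Ai L N.
by move=> h3 h4 h5 h6; lra.
Qed.

(** On [v = e_i + t e_j] the trace identity makes the part of [A v] in the plane of
[e_i] and [e_j] isotropic modulo [1 + t ^+ 2].  As [A v] is isotropic too, its
third coordinate vanishes at [t = i]. *)
Lemma umbilic i j k : i != j -> i != k -> j != k -> a i i k = a j j k /\ a i j k = 0.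
Proof.
move=> ij ik jk; have [q qE] := norm_null ij.
(* E is the quotient of A_k^2 = |A|^2 - A_i^2 - A_j^2 by 1 + t^2 *)
pose r (t : R) := a i i j + 2 * a i j j * t + a j j j * t ^+ 2.
pose lv (t : R) := a i i i + a j j j * t.
pose E : {poly R} := q
  - (((a i i j)%:P + (2 * a i j j)%:P * 'X + (a j j j)%:P * 'X^2) ^+ 2)
  + 2%:P * 'X * ((a i i j)%:P + (2 * a i j j)%:P * 'X + (a j j j)%:P * 'X^2)
     * ((a i i i)%:P + (a j j j)%:P * 'X)
  - (1 + 'X^2) * ((a i i i)%:P + (a j j j)%:P * 'X) ^+ 2.
have [|h1 h2] := @sqr_dvd_1DX2 R (a i i k) (2 * a i j k) (a j j k) 0 E.
  move=> t; have := qE t; cbn zeta.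
  have EE : E.[t] = q.[t] - r t ^+ 2 + 2 * t * r t * lv t - (1 + t ^+ 2) * lv t ^+ 2.
    by rewrite /E /r /lv !hornerE /=; ring.
  have h := trace_part (e_ i + t *: e_ j).
  have ca m : A (e_ i + t *: e_ j) 0 m = a i i m + 2 * a i j m * t + a j j m * t ^+ 2.
    rewrite /A !(bilDl, bilDr, bilZl, bilZr) !bil_e !mxE (a_sym j i); ring.
  have A2 : dot (A (e_ i + t *: e_ j)) (A (e_ i + t *: e_ j)) =
      A (e_ i + t *: e_ j) 0 i ^+ 2 + A (e_ i + t *: e_ j) 0 j ^+ 2
      + A (e_ i + t *: e_ j) 0 k ^+ 2.
    rewrite /dot (bigD1 i)//= (bigD1 j) 1?eq_sym//= (bigD1 k) ?(eq_sym k) ?ik//=.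
    rewrite big1 ?addr0 ?addrA// => m.
    by move: i j k m ij ik jk {E ca h EE r lv qE}; do 4![elim/all3=> //].
  have pv : p (e_ i + t *: e_ j) = A (e_ i + t *: e_ j) 0 i + t * A (e_ i + t *: e_ j) 0 j.
    by rewrite /p dotDr dotZr !dot_e.
  have ll : dot (\row_m a m m m) (e_ i + t *: e_ j) = lv t.
    by rewrite dotDr dotZr !dot_e !mxE /lv mulrC.
  have vv : dot (e_ i + t *: e_ j) (e_ i + t *: e_ j) = 1 + t ^+ 2 :> R.
    rewrite !(dotDl, dotDr, dotZl, dotZr) !e_dot !eqxx [j == i]eq_sym (negbTE ij) /=; ring.
  rewrite A2 EE; move: h; rewrite pv ll vv (ca k) (ca j) -/(r t) => h.
  have -> : A (e_ i + t *: e_ j) 0 i = lv t * (1 + t ^+ 2) - t * r t by rewrite -h; ring.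
  by move: (lv t) (r t) q.[t] => L r' q'; rewrite mul0r addr0 => h'; lra.
by split=> //; lra.
Qed.

Definition sphere_tensor (c th : 'I_3 -> R) :=
  forall i j k, a i j k = (i == j)%:R * c k - (i == k)%:R * th j - (j == k)%:R * th i.

(** An arbitrary index different from [k]: the coefficient [a i i k] does not depend
on the choice of [i != k]. *)
Definition other (k : 'I_3) : 'I_3 := if k == 0 then 1 else 0.

(** In vector notation, [A v = (dot v v) c - 2 (dot th v) v]: the second
derivatives of a Moebius map followed by a projective one. *)
Lemma tensor_form : sphere_tensor (fun k => a (other k) (other k) k)
  (fun k => (a (other k) (other k) k - a k k k) / 2%:R).
Proof.
have u (i j k : 'I_3) : i != j -> i != k -> j != k -> a i i k = a j j k.
  by move=> ij ik jk; have [] := umbilic ij ik jk.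
have o i k : i != k -> a i i k = a (other k) (other k) k.
  move=> ik; have [->//|io] := eqVneq i (other k); apply: u => //.
  by rewrite /other; case: ifP => [/eqP->//|/negbT]; rewrite eq_sym.
have d i j : i != j -> 2 * a i j j = a i i i - a (other i) (other i) i.
  move=> ij; have := trace_diag ij; have ji : j != i by rewrite eq_sym.
  by rewrite (o j i ji) => ->; ring.
move=> i j k; have [<-|ij] := eqVneq i j; last first.
  rewrite mul0r; have [<-|ik] := eqVneq i k.
    rewrite (eq_sym j i) (negbTE ij) a_sym mul0r mul1r; have := d j i; rewrite eq_sym ij => /(_ isT).
    by move: (a (other j) (other j) j) => z; lra.
  have [<-|jk] := eqVneq j k; last by rewrite (umbilic ij ik jk).2 !mul0r !subr0.
  by rewrite mul0r mul1r; have := d i j ij; move: (a (other i) (other i) i) => z; lra.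
have [<-|ik] := eqVneq i k; last by rewrite (o i k ik) mul1r !mul0r !subr0.
by rewrite !mul1r; move: (a (other i) (other i) i) => z; field.
Qed.

End Tensor.
Local Opaque derive.

(** * Smooth matrices *)
Section SmoothMatrix.
Context {R : realType} {V : normedModType R}.
Implicit Types (U : set V).

Lemma Cn_det k U n (M : V -> 'M[R]_n) : open U ->
  (forall i j, Cn k U (fun x => M x i j)) -> Cn k U (fun x => \det (M x)).
Proof.
move=> oU CM; apply: Cn_sum => // s _; apply: CnM => //; first exact: Cn_cst.
by apply: Cn_prod.
Qed.

Lemma Cn_invmx k U n (M : V -> 'M[R]_n) i j : open U ->
  (forall x, U x -> M x \in unitmx) ->
  (forall i j, Cn k U (fun x => M x i j)) -> Cn k U (fun x => invmx (M x) i j).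
Proof.
move=> oU uM CM.
have H x : U x -> (\det (M x))^-1 * cofactor (M x) j i = invmx (M x) i j.
  by move=> Ux; rewrite /invmx uM// !mxE.
have d0 x : U x -> \det (M x) != 0 by move=> Ux; move: (uM x Ux); rewrite unitmxE unitfE.
have C1 := CnV oU d0 (Cn_det oU CM).
have C2 : Cn k U (fun x => cofactor (M x) j i).
  apply: CnM => //; first exact: Cn_cst.
  apply: Cn_det => // i' j'.
  have -> : (fun x => row' j (col' i (M x)) i' j') = (fun x => M x (lift j i') (lift i j')).
    by apply/funext => x; rewrite !mxE.
  exact: CM.
exact: Cn_eq oU H (CnM oU C1 C2).
Qed.

Lemma derive_sumM n (F G : 'I_n -> V -> R) x v :
  (forall k, differentiable (F k) x) -> (forall k, differentiable (G k) x) ->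
  'D_v (fun y => \sum_k F k y * G k y) x =
  \sum_k (F k x * 'D_v (G k) x + 'D_v (F k) x * G k x).
Proof.
move=> dF dG.
have -> : (fun y => \sum_k F k y * G k y) = \sum_k (F k * G k).
  by apply/funext => y; rewrite fct_sumE.
rewrite derive_sum => [|k]; last by apply: derivableM; exact: diff_derivable.
apply: eq_bigr => k _; rewrite deriveM; [|exact: diff_derivable|exact: diff_derivable].
by rewrite /GRing.scale /= [G k x * _]mulrC.
Qed.

End SmoothMatrix.

(** * Accelerations and their compatibility *)
Section Connection.
Context {R : realType}.
Variables (O : set 'rV[R]_3) (f : 'rV[R]_3 -> 'rV[R]_3).
Hypotheses (oO : open O) (Cf : forall l, Cinf O (fun y => f y 0 l)).
Local Notation f_ l := (fun y : 'rV[R]_3 => f y 0 l).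
Definition J_ x : 'M[R]_3 := \matrix_(i, l) 'D_(e_ i) (f_ l) x.
Hypothesis uJ : forall x, O x -> J_ x \in unitmx.

(** The Christoffel symbols, up to sign, of the flat connection pulled back by [f];
its geodesics are the curves going into affine lines. *)
Definition accel i j k x : R :=
  - \sum_l 'D_(e_ j) ('D_(e_ i) (f_ l)) x * invmx (J_ x) l k.
(** The coefficients of the third derivatives of [f], obtained by differentiating
[accelE] once more. *)
Definition jerk i j z m x : R :=
  \sum_k accel i j k x * accel k z m x - 'D_(e_ z) (accel i j m) x.

Lemma Cinf_accel i j k : Cinf O (accel i j k).
Proof.
move=> n; apply: CnN => //; apply: Cn_sum => // l _; apply: CnM => //.
  exact: (Cinf_D _ (Cinf_D _ (Cf l))).
apply: Cn_invmx => // i' j'.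
have -> : (fun x => J_ x i' j') = 'D_(e_ i') (f_ j') by apply/funext => x; rewrite mxE.
exact: (Cinf_D _ (Cf j')).
Qed.

Lemma J_inj x (u u' : 'rV[R]_3) : O x ->
  (forall l, \sum_k u 0 k * 'D_(e_ k) (f_ l) x = \sum_k u' 0 k * 'D_(e_ k) (f_ l) x) ->
  u = u'.
Proof.
move=> Ox H; suff : u *m J_ x = u' *m J_ x.
  by move/(congr1 (mulmx^~ (invmx (J_ x)))); rewrite !mulmxK// uJ.
apply/rowP => l; rewrite !mxE.
transitivity (\sum_k u 0 k * 'D_(e_ k) (f_ l) x).
  by apply: eq_bigr => k _; rewrite mxE.
by rewrite H; apply: eq_bigr => k _; rewrite mxE.
Qed.

Lemma J_injf x (u u' : 'I_3 -> R) : O x ->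
  (forall l, \sum_k u k * 'D_(e_ k) (f_ l) x = \sum_k u' k * 'D_(e_ k) (f_ l) x) ->
  forall k, u k = u' k.
Proof.
move=> Ox H k; suff /rowP/(_ k) : \row_k u k = \row_k u' k by rewrite !mxE.
apply: (J_inj Ox) => l; have := H l.
have e w : \sum_k (\row_k w k) 0 k * 'D_(e_ k) (f_ l) x = \sum_k w k * 'D_(e_ k) (f_ l) x.
  by apply: eq_bigr => m _; rewrite mxE.
by rewrite !e.
Qed.

Lemma accelE i j l x : O x ->
  'D_(e_ j) ('D_(e_ i) (f_ l)) x = - \sum_k accel i j k x * 'D_(e_ k) (f_ l) x.
Proof.
move=> Ox; pose r : 'rV[R]_3 := \row_m 'D_(e_ j) ('D_(e_ i) (f_ m)) x.
have : r = r *m invmx (J_ x) *m J_ x by rewrite mulmxKV// uJ.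
move/rowP/(_ l); rewrite !mxE => ->; rewrite -sumrN; apply: eq_bigr => k _.
rewrite !mxE /accel mulNr opprK; congr (_ * _).
by apply: eq_bigr => m _; rewrite mxE.
Qed.

Lemma accel_sym i j k x : O x -> accel i j k x = accel j i k x.
Proof.
move=> Ox.
rewrite /accel.
apply: congr1.
apply: eq_bigr => l _.
by rewrite (derive_sym (e_ i) (e_ j) oO Ox (Cf l 2)).
Qed.

Local Opaque accel.

Lemma jerkE i j z l x : O x ->
  'D_(e_ z) ('D_(e_ j) ('D_(e_ i) (f_ l))) x =
  \sum_m jerk i j z m x * 'D_(e_ m) (f_ l) x.
Proof.
move=> Ox.
have -> : 'D_(e_ z) ('D_(e_ j) ('D_(e_ i) (f_ l))) x =
   'D_(e_ z) (fun y => \sum_k (- accel i j k y) * 'D_(e_ k) (f_ l) y) x.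
  apply: near_eq_derive; apply: (near_eq_in oO Ox) => y Oy.
  by rewrite accelE// -sumrN; apply: eq_bigr => k _; exact/esym/mulNr.
rewrite (@derive_sumM R _ 3 (fun k y => - accel i j k y) (fun k => 'D_(e_ k) (f_ l))); last 2 first.
- by move=> k; apply: differentiableN; exact: (Cinf_diff (Cinf_accel i j k) Ox).
- by move=> k; exact: (Cinf_diff (Cinf_D _ (Cf l)) Ox).
rewrite big_split /=.
transitivity (\sum_k accel i j k x * \sum_m accel k z m x * 'D_(e_ m) (f_ l) x
   - \sum_m 'D_(e_ z) (accel i j m) x * 'D_(e_ m) (f_ l) x).
  rewrite -sumrN; congr (_ + _); apply: eq_bigr => k _.
    by rewrite accelE// mulrNN.
  rewrite -mulNr; congr (_ * _).
  by apply: deriveN; apply/diff_derivable; exact: (Cinf_diff (Cinf_accel i j k) Ox).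
transitivity (\sum_m ((\sum_k accel i j k x * accel k z m x) * 'D_(e_ m) (f_ l) x
   - 'D_(e_ z) (accel i j m) x * 'D_(e_ m) (f_ l) x)); last first.
  by apply: eq_bigr => m _; rewrite -mulrBl.
rewrite big_split sumrN; congr (_ - _).
transitivity (\sum_k \sum_m accel i j k x * accel k z m x * 'D_(e_ m) (f_ l) x).
  by apply: eq_bigr => k _; rewrite mulr_sumr; apply: eq_bigr => m _; rewrite mulrA.
by rewrite exchange_big; apply: eq_bigr => m _; rewrite mulr_suml.
Qed.

Local Opaque jerk.

(** The symmetry of the third derivatives; this is the vanishing of the curvature
of the pulled back connection. *)
Lemma jerk_sym i j z m x : O x -> jerk i j z m x = jerk i z j m x.
Proof.
move=> Ox.
apply: (J_injf (u := fun m => jerk i j z m x) (u' := fun m => jerk i z j m x) Ox _ m) => l.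
apply: etrans (esym (jerkE i j z l Ox)) _; apply: etrans (jerkE i z j l Ox).
exact: (derive_sym _ _ oO Ox (Cinf_D (e_ i) (Cf l) 2)).
Qed.

(** The differential of [f] is injective, so that the relations between derivatives
along the arc can be read in the source.  The third derivative of the arc at 0
is a multiple of the velocity and is absorbed by the second factor. *)
Lemma circle_direction_accel Q v w : O Q -> v != 0 -> dot v w = 0 ->
  (exists be ga, forall l,
     arcH2 Q v w (f_ l) 0 = be * arcH1 Q v w (f_ l) 0 /\
     arcH3 Q v w (f_ l) = ga * arcH1 Q v w (f_ l) 0) ->
  circle_direction (fun i j k => accel i j k Q) (fun i j z m => jerk i j z m Q) v.
Proof.
move=> OQ v0 vw [be [ga H]]; split=> //.
have [g gE] : exists g : 'I_3 -> 'I_3 -> R, forall k l, 'D_(e_ k) (f_ l) Q = g k l.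
  by exists (fun k l => 'D_(e_ k) (f_ l) Q).
have [c cE] : exists c, forall i j k, accel i j k Q = c i j k.
  by exists (fun i j k => accel i j k Q).
have [d dE] : exists d, forall i j z m, jerk i j z m Q = d i j z m.
  by exists (fun i j z m => jerk i j z m Q).
have -> : (fun i j k => accel i j k Q) = c by do 3![apply/funext => ?].
have -> : (fun i j z m => jerk i j z m Q) = d by do 4![apply/funext => ?].
have csym i j k : c i j k = c j i k by rewrite -!cE accel_sym.
have gen (u u' : 'rV[R]_3) : (forall l, \sum_k u 0 k * g k l = \sum_k u' 0 k * g k l) -> u = u'.
  move=> E; apply: (J_inj OQ) => l; have := E l.
  have e (w' : 'rV[R]_3) : \sum_k w' 0 k * 'D_(e_ k) (f_ l) Q = \sum_k w' 0 k * g k l.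
    by apply: eq_bigr => k _; rewrite gE.
  by rewrite !e.
have H1 l : arcH1 Q v w (f_ l) 0 = \sum_i v 0 i * g i l.
  by rewrite arcH1_0; apply: eq_bigr => i _; rewrite gE.
have H2 l : arcH2 Q v w (f_ l) 0 = \sum_i (2 * w 0 i * g i l
    + \sum_j v 0 i * v 0 j * - \sum_k c i j k * g k l).
  rewrite arcH2_0; apply: eq_bigr => i _; rewrite gE; congr (_ + _).
  apply: eq_bigr => j _; rewrite accelE//; congr (_ * - _).
  by apply: eq_bigr => k _; rewrite gE cE.
pose s := dot w w / dot v v.
have H3 l : arcH3 Q v w (f_ l) = \sum_i (- 6 * s * v 0 i * g i l
    + \sum_j (4 * w 0 i * v 0 j + 2 * v 0 i * w 0 j) * - (\sum_k c i j k * g k l)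
    + \sum_j \sum_k v 0 i * v 0 j * v 0 k * \sum_m d i j k m * g m l).
  apply: eq_bigr => i _; congr (_ + _ + _); first by rewrite gE mxE.
    apply: eq_bigr => j _; rewrite accelE//; congr (_ * - _).
    by apply: eq_bigr => k _; rewrite gE cE.
  apply: eq_bigr => j _; apply: eq_bigr => k _; rewrite jerkE//; congr (_ * _).
  by apply: eq_bigr => m _; rewrite gE dE.
have E2 : 2%:R *: w - bil c v v = be *: v.
  apply: gen => l; transitivity (be * \sum_i v 0 i * g i l); last first.
    by rewrite mulr_sumr; apply: eq_bigr => i _; rewrite mxE mulrA.
  rewrite -H1 -(H l).1 H2; move: v w g c {v0 vw H H1 H2 H3 gE cE csym s} => v w g c.
  by rewrite !sum3 !mxE !sum3; ring.
exists w, be, (ga + 6 * s); split=> //; first by rewrite -E2 addrC subrK.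
apply: gen => l.
transitivity (ga * (\sum_i v 0 i * g i l) + 6 * s * \sum_i v 0 i * g i l); last first.
  by rewrite -mulrDl mulr_sumr; apply: eq_bigr => i _; rewrite mxE mulrA.
rewrite -H1 -(H l).2 H3 H1.
have cs1 k : c 1 0 k = c 0 1 k by exact: csym.
have cs2 k : c 2%:R 0 k = c 0 2%:R k by exact: csym.
have cs3 k : c 2%:R 1 k = c 1 2%:R k by exact: csym.
move: v w g c d s cs1 cs2 cs3 {v0 vw H H1 H2 H3 gE cE csym E2 dE} => v w g c d s cs1 cs2 cs3.
by rewrite !sum3 !mxE !sum3 !cs1 !cs2 !cs3; ring.
Qed.

End Connection.
Local Opaque derive accel jerk.

(** * The differential system *)
Section FlatAlgebra.
Context {R : realType}.
Variables (c th : 'I_3 -> R) (dc dth : 'I_3 -> 'I_3 -> R).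
Let T (i j k : 'I_3) : R := (i == j)%:R * c k - (i == k)%:R * th j - (j == k)%:R * th i.
Let dT (z i j m : 'I_3) : R :=
  (i == j)%:R * dc z m - (i == m)%:R * dth z j - (j == m)%:R * dth z i.
Hypothesis flat : forall i j z m,
  \sum_k T i j k * T k z m - dT z i j m = \sum_k T i z k * T k j m - dT j i z m.

Let ct := \sum_k c k * th k.

(** The equations with [i = j] and [i != z] suffice to determine all first
derivatives. *)
Lemma flat_eq i z m : i != z ->
  c z * c m - (z == m)%:R * (ct - th i ^+ 2) - (i == m)%:R * (th i * th z) - dc z m
  + (i == m)%:R * (2 * dth z i) - (i == m)%:R * dth i z - (z == m)%:R * dth i i = 0.
Proof.
move=> iz; have := flat i i z m; move: iz; rewrite /ct /dT /T !sum3.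
by move: i z m; do 3![elim/all3 => //]; rewrite /= => _; lra.
Qed.

(** The symmetry condition determines all derivatives of [c] and [th] except one
trace of each, [m] and [n], which satisfy one relation. *)
Lemma flat_solve : exists n m,
  [/\ forall z j, dth z j = th z * th j + (z == j)%:R * n,
      forall z j, dc z j = c z * c j + (z == j)%:R * m & n + m + ct = 0].
Proof.
have third (z m : 'I_3) : z != m -> exists2 i, i != z & i != m.
  by move: z m; do 2![elim/all3 => //] => _; by [exists 0|exists 1|exists 2%:R].
have dcE z m : z != m -> dc z m = c z * c m.
  move=> zm; have [i iz im] := third z m zm; have := flat_eq m iz.
  by rewrite (negbTE zm) (negbTE im) !mul0r !subr0 addr0 => /eqP; rewrite subr_eq0 => /eqP.
have e i z : i != z -> 2 * dth z i - dth i z = th i * th z.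
  move=> iz; have := flat_eq i iz; rewrite eqxx eq_sym (negbTE iz) dcE 1?eq_sym//.
  by rewrite !mul0r !mul1r => h; lra.
have dthE i z : i != z -> dth i z = th i * th z.
  move=> iz; have h1 := e i z iz; have := e z i; rewrite eq_sym iz => /(_ isT) h2; lra.
have d i z : i != z -> dc z z - c z ^+ 2 = - ct - (dth i i - th i ^+ 2).
  move=> iz; have := flat_eq z iz; rewrite eqxx (negbTE iz) !mul0r !mul1r => h; lra.
have d01 := d 0 1 isT; have d02 := d 0 2%:R isT; have d10 := d 1 0 isT.
have d12 := d 1 2%:R isT; have d20 := d 2%:R 0 isT.
exists (dth 0 0 - th 0 ^+ 2), (dc 0 0 - c 0 ^+ 2); split.
- move=> z j; have [<-|zj] := eqVneq z j; last by rewrite dthE// mul0r addr0.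
  rewrite mul1r -expr2; move: z {j}; apply: all3; first by ring.
    by move: d02 d12 => -> h; lra.
  by move: d10 d20 => -> h; lra.
- move=> z j; have [<-|zj] := eqVneq z j; last by rewrite dcE// mul0r addr0.
  rewrite mul1r -expr2; move: z {j}; apply: all3; first by ring.
    by clear - d01 d02 d10 d12 d20; lra.
  by clear - d02 d10 d12 d20; lra.
- by clear - d10 d20 d02 d12; lra.
Qed.

End FlatAlgebra.

Section LinComb.
Context {R : realType} {V : normedModType R}.
Implicit Types (x v : V).

Lemma is_derive_sumf n (F : 'I_n -> V -> R) (d : 'I_n -> R) x v :
  (forall k, is_derive x v (F k) (d k)) ->
  is_derive x v (fun y => \sum_k F k y) (\sum_k d k).
Proof.
move=> dF.
have -> : (fun y => \sum_k F k y) = \sum_k F k by apply/funext => y; rewrite fct_sumE.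
exact: is_derive_sum.
Qed.

Lemma is_derive_scale (F : V -> R) (d a : R) x v :
  is_derive x v F d -> is_derive x v (fun y => a * F y) (a * d).
Proof. exact: is_deriveZ. Qed.

Lemma is_derive_eq0 (U : set V) (F : V -> R) d x v : open U -> U x ->
  (forall y, U y -> F y = 0) -> is_derive x v F d -> d = 0.
Proof.
move=> oU Ux F0 [_ <-].
rewrite (near_eq_derive _ (near_eq_in oU Ux F0 : \near x, F x = (cst 0) x)).
exact: derive_cst.
Qed.

Lemma Cinf_is_derive (U : set V) (F : V -> R) x v : Cinf U F -> U x ->
  is_derive x v F ('D_v F x).
Proof.
by move=> CF Ux; apply/derivableP/diff_derivable; exact: (CF 1%N).1.
Qed.

End LinComb.

Section Rectified.
Context {R : realType}.
Variables (O : set 'rV[R]_3) (f : 'rV[R]_3 -> 'rV[R]_3).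
Hypotheses (oO : open O) (Cf : forall l, Cinf O (fun y => f y 0 l)).
Hypothesis uJ : forall x, O x -> J_ f x \in unitmx.
Local Notation a i j k x := (accel f i j k x).
Local Notation b i j z m x := (jerk f i j z m x).
Hypothesis circ : forall x, O x -> exists K : set 'rV[R]_3,
  [/\ open K, K !=set0 & forall v, K v ->
      circle_direction (fun i j k => a i j k x) (fun i j z m => b i j z m x) v].

Let Ca i j k : Cinf O (fun x => a i j k x) := Cinf_accel oO Cf uJ i j k.
Let a_sym x : O x -> forall i j k, a i j k x = a j i k x.
Proof. by move=> Ox i j k; exact: (accel_sym oO Cf). Qed.

(** The identity of [trace_part] holds at every point of [O], hence can be
differentiated in the direction [e_ z]. *)
Lemma derivative_trace x (v : 'rV[R]_3) z : O x ->
  \sum_m v 0 m * (\sum_i \sum_j v 0 i * v 0 j * 'D_(e_ z) (fun y => a i j m y) x)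
  = dot v v * (\sum_i v 0 i * 'D_(e_ z) (fun y => a i i i y) x).
Proof.
move=> Ox.
pose F y := \sum_m v 0 m * (\sum_i \sum_j v 0 i * v 0 j * a i j m y)
  + (- dot v v) * (\sum_i v 0 i * a i i i y).
have F0 y : O y -> F y = 0.
  move=> Oy; have := trace_part (a_sym Oy) (circ Oy) v.
  rewrite /F mulNr mulrC => h; apply/eqP; rewrite subr_eq0 mulrC; apply/eqP.
  apply: etrans (etrans _ h) _; last first.
    rewrite mulrC; congr (_ * _); apply: eq_bigr => i _; by rewrite mxE mulrC.
  by apply: eq_bigr => m _; rewrite mxE mulrC.
have dF : is_derive x (e_ z) F
  (\sum_m v 0 m * (\sum_i \sum_j v 0 i * v 0 j * 'D_(e_ z) (fun y => a i j m y) x)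
  + (- dot v v) * (\sum_i v 0 i * 'D_(e_ z) (fun y => a i i i y) x)).
  apply: is_deriveD.
    apply: is_derive_sumf => m; apply: is_derive_scale.
    apply: is_derive_sumf => i; apply: is_derive_sumf => j; apply: is_derive_scale.
    exact: Cinf_is_derive (Ca i j m) Ox.
  apply: is_derive_scale; apply: is_derive_sumf => i; apply: is_derive_scale.
  exact: Cinf_is_derive (Ca i i i) Ox.
have := is_derive_eq0 oO Ox F0 dF.
by rewrite mulNr => /eqP; rewrite subr_eq0 => /eqP.
Qed.

(** Contracting the differentiated trace identity with [v] in place of [e_ z] turns
the derivatives of [accel] into third derivatives of [f]; this provides the
hypothesis of [tensor_form]. *)
Lemma trace_derivative_accel x : O x -> exists2 lam, polyfun lam & forall v,
  dot (bil (fun i j k => a i j k x) v (bil (fun i j k => a i j k x) v v)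
       - cub (fun i j z m => b i j z m x) v) v = lam v * dot v v.
Proof.
move=> Ox.
exists (fun v => \sum_z v 0 z * \sum_i v 0 i * 'D_(e_ z) (fun y => a i i i y) x).
  apply: polyfun_sum => z; apply: polyfunM; first exact: polyfun_coord.
  apply: polyfun_sum => i; apply: polyfunM; first exact: polyfun_coord.
  exact: polyfun_cst.
move=> v.
have T z := derivative_trace v z Ox.
have bE i j z m : b i j z m x = \sum_k a i j k x * a k z m x - 'D_(e_ z) (fun y => a i j m y) x by [].
have sy := a_sym Ox.
have [d dE] : exists d, forall z i j m, 'D_(e_ z) (fun y => a i j m y) x = d z i j m.
  by exists (fun z i j m => 'D_(e_ z) (fun y => a i j m y) x) => z i j m; exact: erefl.
have {}T z : \sum_m v 0 m * (\sum_i \sum_j v 0 i * v 0 j * d z i j m)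
    = dot v v * (\sum_i v 0 i * d z i i i).
  have := T z; have -> : \sum_i v 0 i * 'D_(e_ z) (fun y => a i i i y) x = \sum_i v 0 i * d z i i i.
    by apply: eq_bigr => i _; rewrite dE.
  move=> <-; apply: eq_bigr => m _; congr (_ * _).
  by apply: eq_bigr => i _; apply: eq_bigr => j _; rewrite dE.
have [A AE] : exists A, forall i j k, a i j k x = A i j k.
  by exists (fun i j k => a i j k x) => i j k; exact: erefl.
have [B BE] : exists B, forall i j k m, b i j k m x = B i j k m.
  by exists (fun i j k m => b i j k m x) => i j k m; exact: erefl.
have -> : (fun i j k => a i j k x) = A.
  by apply/funext => i; apply/funext => j; apply/funext => k; exact: AE.
have -> : (fun i j z m => b i j z m x) = B.
  by apply/funext => i; apply/funext => j; apply/funext => z; apply/funext => m; exact: BE.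
transitivity (\sum_z v 0 z * \sum_m v 0 m * \sum_i \sum_j v 0 i * v 0 j * d z i j m); last first.
  rewrite mulr_suml; apply: eq_bigr => z _; rewrite T -mulrA; congr (_ * _).
  by rewrite mulrC; congr (_ * _); apply: eq_bigr => i _; rewrite dE.
have {}sy i j k : A i j k = A j i k by rewrite -!AE.
have {}bE i j z m : B i j z m = \sum_k A i j k * A k z m - d z i j m.
  apply: etrans (esym (BE i j z m)) _; apply: etrans (bE i j z m) _.
  rewrite dE; congr (_ - _).
  by apply: eq_bigr => k _; rewrite !AE.
have E m : (bil A v (bil A v v) - cub B v) 0 m
    = \sum_z v 0 z * \sum_i \sum_j v 0 i * v 0 j * d z i j m.
  have s1 k : A 1 0 k = A 0 1 k by exact: sy.
  have s2 k : A 2%:R 0 k = A 0 2%:R k by exact: sy.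
  have s3 k : A 2%:R 1 k = A 1 2%:R k by exact: sy.
  clear - bE s1 s2 s3; rewrite !mxE.
  transitivity (\sum_i \sum_j v 0 i * (\sum_p \sum_q v 0 p * v 0 q * A p q j) * A i j m
     - \sum_i \sum_j \sum_z v 0 i * v 0 j * v 0 z * (\sum_k A i j k * A k z m - d z i j m)).
    congr (_ - _); apply: eq_bigr => i _; apply: eq_bigr => j _; first by rewrite mxE.
    by apply: eq_bigr => z _; rewrite bE.
  by rewrite !sum3 !s1 !s2 !s3; ring.
rewrite /dot; under eq_bigr do rewrite E mulr_suml.
rewrite exchange_big; apply: eq_bigr => z _ /=; rewrite mulr_sumr.
by apply: eq_bigr => m _; rewrite -mulrA [_ * v 0 m]mulrC.
Qed.

(** The vectors [c] and [th] of [tensor_form] as functions of the point.  The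
circles through [x] meet again at [x + d] with [c = 2 d / dot d d], and [c]
vanishes for projective maps. *)
Definition conf_part k x : R := a (other k) (other k) k x.
Definition proj_part k x : R := (conf_part k x - a k k k x) / 2%:R.

Lemma accel_form x i j k : O x ->
  a i j k x = (i == j)%:R * conf_part k x - (i == k)%:R * proj_part j x - (j == k)%:R * proj_part i x.
Proof.
by move=> Ox; apply: (tensor_form (a_sym Ox) (circ Ox) (trace_derivative_accel Ox)).
Qed.

Lemma Cinf_conf_part k : Cinf O (conf_part k).
Proof. exact: Ca. Qed.

Lemma Cinf_proj_part k : Cinf O (proj_part k).
Proof.
move=> n; apply: CnM => //; last exact: Cn_cst.
by apply: CnB => //; [exact: Cinf_conf_part|exact: Ca].
Qed.

Local Opaque conf_part proj_part.

Lemma derive_accel_form x i j m z : O x -> 'D_(e_ z) (fun y => a i j m y) x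
  = (i == j)%:R * 'D_(e_ z) (conf_part m) x - (i == m)%:R * 'D_(e_ z) (proj_part j) x
    - (j == m)%:R * 'D_(e_ z) (proj_part i) x.
Proof.
move=> Ox.
pose F y := (i == j)%:R * conf_part m y - (i == m)%:R * proj_part j y - (j == m)%:R * proj_part i y.
have E y : O y -> a i j m y = F y by move=> Oy; exact: accel_form.
apply: etrans (near_eq_derive (e_ z) (near_eq_in oO Ox E)) _.
have dc k := Cinf_is_derive (e_ z) (Cinf_conf_part k) Ox.
have dt k := Cinf_is_derive (e_ z) (Cinf_proj_part k) Ox.
have dF : is_derive x (e_ z) F
  ((i == j)%:R * 'D_(e_ z) (conf_part m) x - (i == m)%:R * 'D_(e_ z) (proj_part j) x
    - (j == m)%:R * 'D_(e_ z) (proj_part i) x).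
  by apply: is_deriveB.
by case: dF.
Qed.

Lemma pde_exists x : O x -> exists n m,
  [/\ forall z j, 'D_(e_ z) (proj_part j) x = proj_part z x * proj_part j x + (z == j)%:R * n,
      forall z j, 'D_(e_ z) (conf_part j) x = conf_part z x * conf_part j x + (z == j)%:R * m &
      n + m + \sum_k conf_part k x * proj_part k x = 0].
Proof.
move=> Ox.
apply: (@flat_solve R (fun k => conf_part k x) (fun k => proj_part k x)
  (fun z j => 'D_(e_ z) (conf_part j) x) (fun z j => 'D_(e_ z) (proj_part j) x)) => i j z m.
have bE j' z' : b i j' z' m x =
  \sum_k ((i == j')%:R * conf_part k x - (i == k)%:R * proj_part j' x - (j' == k)%:R * proj_part i x)
   * ((k == z')%:R * conf_part m x - (k == m)%:R * proj_part z' x - (z' == m)%:R * proj_part k x)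
  - ((i == j')%:R * 'D_(e_ z') (conf_part m) x - (i == m)%:R * 'D_(e_ z') (proj_part j') x
    - (j' == m)%:R * 'D_(e_ z') (proj_part i) x).
  rewrite -(derive_accel_form _ _ _ _ Ox); congr (_ - _); apply: eq_bigr => k _.
  by rewrite !accel_form.
apply: etrans (esym (bE j z)) _; apply: etrans (bE z j).
exact: (jerk_sym oO Cf uJ).
Qed.

(** The coefficient of the identity matrix in the derivative of [proj_part]. *)
Definition proj_const x : R := 'D_(e_ 0) (proj_part 0) x - proj_part 0 x ^+ 2.

Lemma pde_proj_part x z j : O x ->
  'D_(e_ z) (proj_part j) x = proj_part z x * proj_part j x + (z == j)%:R * proj_const x.
Proof.
move=> Ox; have [n [m [h1 h2 h3]]] := pde_exists Ox.
by rewrite h1 /proj_const h1 eqxx mul1r; congr (_ + _ * _); ring.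
Qed.

Lemma pde_conf_part x z j : O x -> 'D_(e_ z) (conf_part j) x =
  conf_part z x * conf_part j x - (z == j)%:R * (proj_const x + \sum_k conf_part k x * proj_part k x).
Proof.
move=> Ox; have [n [m [h1 h2 h3]]] := pde_exists Ox.
rewrite h2 /proj_const h1 eqxx mul1r; congr (_ + _).
by rewrite -mulrN; congr (_ * _); move: h3; move: (\sum_k _) => s h3; lra.
Qed.

Lemma proj_constE x i : O x -> proj_const x = 'D_(e_ i) (proj_part i) x - proj_part i x ^+ 2.
Proof. by move=> Ox; rewrite pde_proj_part// eqxx mul1r; ring. Qed.

(** Cross-differentiating the equation for [proj_part] in two different directions
[i] and [z]: the mixed derivatives of [proj_part] commute, which fixes the
derivative of [proj_const]. *)
Lemma pde_proj_const x z : O x -> 'D_(e_ z) proj_const x = proj_const x * proj_part z x.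
Proof.
move=> Ox; have [i iz] : exists i, i != z.
  by exists (other z); rewrite /other eq_sym; case: ifP => [/eqP->//|/negbT].
have zi : z != i by rewrite eq_sym.
have dt v k := Cinf_is_derive v (Cinf_proj_part k) Ox.
have E1 y : O y -> proj_const y = 'D_(e_ i) (proj_part i) y - proj_part i y * proj_part i y.
  by move=> Oy; rewrite (proj_constE i Oy) expr2.
have dE1 : is_derive x (e_ z) (fun y => 'D_(e_ i) (proj_part i) y - proj_part i y * proj_part i y)
   ('D_(e_ z) ('D_(e_ i) (proj_part i)) x
    - (proj_part i x * 'D_(e_ z) (proj_part i) x + proj_part i x * 'D_(e_ z) (proj_part i) x)).
  have dd := Cinf_is_derive (e_ z) (Cinf_D (e_ i) (Cinf_proj_part i)) Ox.
  exact: (is_deriveB dd (is_deriveM (dt (e_ z) i) (dt (e_ z) i))).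
apply: etrans (near_eq_derive (e_ z) (near_eq_in oO Ox E1)) _; have [_ ->] := dE1.
rewrite (derive_sym (e_ i) (e_ z) oO Ox (Cinf_proj_part i 2)).
have E2 y : O y -> 'D_(e_ z) (proj_part i) y = proj_part z y * proj_part i y.
  by move=> Oy; rewrite pde_proj_part// (negbTE zi) mul0r addr0.
have dE2 : is_derive x (e_ i) (fun y => proj_part z y * proj_part i y)
   (proj_part z x * 'D_(e_ i) (proj_part i) x + proj_part i x * 'D_(e_ i) (proj_part z) x).
  exact: (is_deriveM (dt (e_ i) z) (dt (e_ i) i)).
have -> : 'D_(e_ i) ('D_(e_ z) (proj_part i)) x
    = proj_part z x * 'D_(e_ i) (proj_part i) x + proj_part i x * 'D_(e_ i) (proj_part z) x.
  by apply: etrans (near_eq_derive (e_ i) (near_eq_in oO Ox E2)) _; have [_ ->] := dE2.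
rewrite !pde_proj_part// eqxx (negbTE iz) (negbTE zi).
by move: (proj_part z x) (proj_part i x) (proj_const x) => t u n; rewrite mul1r !mul0r; ring.
Qed.

End Rectified.

(** * Integration of the system *)
Section Integrate.
Context {R : realType}.
Variables (O : set 'rV[R]_3) (c th : 'I_3 -> 'rV[R]_3 -> R) (n : 'rV[R]_3 -> R).
Hypotheses (oO : open O) (Cc : forall k, Cinf O (c k)) (Cth : forall k, Cinf O (th k)).
Hypothesis Cn_ : Cinf O n.
Hypothesis pth : forall x z j, O x -> 'D_(e_ z) (th j) x = th z x * th j x + (z == j)%:R * n x.
Hypothesis pc : forall x z j, O x -> 'D_(e_ z) (c j) x =
  c z x * c j x - (z == j)%:R * (n x + \sum_k c k x * th k x).
Hypothesis pn : forall x z, O x -> 'D_(e_ z) n x = n x * th z x.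

(** The solutions of [dF = th F].  They are the multiples of a single integrating
factor, which is not constructed: quotients of solutions are constant. *)
Definition recurrent (F : 'rV[R]_3 -> R) :=
  Cinf O F /\ forall x z, O x -> 'D_(e_ z) F x = th z x * F x.

Lemma recurrent_ratio F G P : O P -> recurrent F -> recurrent G -> G P != 0 ->
  \forall x \near P, F x = F P / G P * G x.
Proof.
move=> OP [CF dF] [CG dG] GP.
have nG : \forall x \near P, O x /\ G x != 0.
  apply: filterI; first exact: open_nbhs_nbhs.
  exact: (cvgr_neq0 _ (CG 0%N P OP) GP).
have [r /= r0 rP] := (nbhs_ballP _ _).1 nG.
apply/nbhs_ballP; exists r => //= x Px.
pose q y := F y * (G y)^-1.
have dq y v : ball P r y -> is_derive y v q 0.
  move=> /rP[Oy Gy].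
  have CF1 := Cinf_diff CF Oy; have CG1 := Cinf_diff CG Oy.
  have dF' := Cinf_is_derive v CF Oy; have dG' := Cinf_is_derive v CG Oy.
  have dGi : is_derive y v (fun y => (G y)^-1) (- (G y) ^- 2 *: 'D_v G y).
    case: dG' => G1 _.
    by apply: DeriveDef; [exact: derivableV|exact: deriveV].
  apply: is_derive_eq (is_deriveM dF' dGi) _.
  rewrite (derive_sum_e v CF1) (derive_sum_e v CG1).
  have -> : \sum_i v 0 i *: 'D_(e_ i) F y = (\sum_i v 0 i * th i y) * F y.
    by rewrite mulr_suml; apply: eq_bigr => i _; rewrite dF// /GRing.scale /= mulrA.
  have -> : \sum_i v 0 i *: 'D_(e_ i) G y = (\sum_i v 0 i * th i y) * G y.
    by rewrite mulr_suml; apply: eq_bigr => i _; rewrite dG// /GRing.scale /= mulrA.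
  by rewrite /GRing.scale /=; field.
have : q x = q P.
  apply: (derive_eq0_cst r0 _ _ Px).
    move=> y /rP[Oy Gy].
    have -> : q = F * (fun y => (G y)^-1) by [].
    apply: differentiableM; first exact: Cinf_diff CF Oy.
    by apply: differentiableV => //; exact: Cinf_diff CG Oy.
  by move=> y v /(dq _ v)[].
have [_ Gx] := rP x Px.
by rewrite /q => <-; rewrite divfK.
Qed.

Variable h : 'rV[R]_3 -> R.
Hypothesis Ch : Cinf O h.
Hypothesis hess : forall x i j, O x -> 'D_(e_ j) ('D_(e_ i) h) x =
  - (i == j)%:R * (\sum_k c k x * 'D_(e_ k) h x) + th j x * 'D_(e_ i) h x
  + th i x * 'D_(e_ j) h x.

(** The functions below are the coefficients of [h] relative to 1, the coordinates
and [dot x x], once [h] is divided by the integrating factor.  For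
[h = be x * (a0 + \sum_i x 0 i * a1 i + dot x x * a2)] they equal
[be x] times [-2 a2], [a1 i] and [a0] for [Z_], [V1_ i] and [V2_]. *)
Definition Z_ x : R := n x * h x + \sum_k c k x * 'D_(e_ k) h x.
Definition W_ i x : R := 'D_(e_ i) h x - th i x * h x.
Definition V1_ i x : R := W_ i x + x 0 i * Z_ x.
Definition V2_ x : R := h x - \sum_i x 0 i * W_ i x - 2%:R^-1 * dot x x * Z_ x.

Lemma Cinf_Z : Cinf O Z_.
Proof.
move=> k; apply: CnD => //; first exact: CnM.
apply: Cn_sum => // i _; apply: CnM => //; first exact: Cc.
exact: (Cinf_D _ Ch).
Qed.

Lemma Cinf_W i : Cinf O (W_ i).
Proof.
move=> k; apply: CnB => //; first exact: (Cinf_D _ Ch).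
by apply: CnM => //; exact: Cth.
Qed.

Lemma recurrent_Z : recurrent Z_.
Proof.
split; first exact: Cinf_Z.
move=> x z Ox.
have dh v := Cinf_is_derive v Ch Ox.
have dn v := Cinf_is_derive v Cn_ Ox.
have dc v k := Cinf_is_derive v (Cc k) Ox.
have dd v k := Cinf_is_derive v (Cinf_D (e_ k) Ch) Ox.
have := is_deriveD (is_deriveM (dn (e_ z)) (dh (e_ z)))
  (is_derive_sumf (fun k => is_deriveM (dc (e_ z) k) (dd (e_ z) k))).
case=> _ E; apply: etrans E _.
rewrite pn// /Z_ /GRing.scale /=.
have [g gE] : exists g, forall k, 'D_(e_ k) h x = g k by exists (fun k => 'D_(e_ k) h x).
have sE : \sum_k c k x * 'D_(e_ k) h x = \sum_k c k x * g k.
  by apply: eq_bigr => k _; rewrite gE.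
transitivity (n x * g z + h x * (n x * th z x) +
  \sum_k (c k x * (- (k == z)%:R * (\sum_k c k x * g k) + th z x * g k + th k x * g z)
   + g k * (c z x * c k x - (z == k)%:R * (n x + \sum_k c k x * th k x)))).
  rewrite gE; congr (_ + _); apply: eq_bigr => k _.
  by rewrite hess// pc// !gE sE.
rewrite sE; move: (n x) (h x) => n' h'.
have [c' cE] : exists c', forall k, c k x = c' k by exists (fun k => c k x).
have [t' tE] : exists t', forall k, th k x = t' k by exists (fun k => th k x).
rewrite !sum3 !cE !tE.
by move: z; apply: all3; rewrite /=; ring.
Qed.

Lemma derive_W x z i : O x ->
  'D_(e_ z) (W_ i) x = th z x * W_ i x - (i == z)%:R * Z_ x.
Proof.
move=> Ox.
have dh := Cinf_is_derive (e_ z) Ch Ox.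
have dt := Cinf_is_derive (e_ z) (Cth i) Ox.
have dd := Cinf_is_derive (e_ z) (Cinf_D (e_ i) Ch) Ox.
have [_ E] := is_deriveB dd (is_deriveM dt dh).
apply: etrans E _; rewrite hess// pth// /W_ /Z_ /GRing.scale /= (eq_sym z).
by move: (\sum_k _) ('D_(e_ i) h x) ('D_(e_ z) h x) (i == z)%:R => S hi hz d; ring.
Qed.

Lemma is_derive_coord0 (x v : 'rV[R]_3) i : is_derive x v (fun y => y 0 i) (v 0 i).
Proof. exact: (is_derive_row _ _ _ _).1 (is_derive_id x v) i. Qed.

Lemma e_coord (z i : 'I_3) : (e_ z : 'rV[R]_3) 0 i = (i == z)%:R.
Proof. by rewrite mxE eqxx. Qed.

Lemma recurrent_V1 i : recurrent (V1_ i).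
Proof.
split.
  move=> k; apply: CnD => //; first exact: Cinf_W.
  by apply: CnM => //; [exact: Cn_coord|exact: Cinf_Z].
move=> x z Ox.
have dW := Cinf_is_derive (e_ z) (Cinf_W i) Ox.
have dZ := Cinf_is_derive (e_ z) Cinf_Z Ox.
have [_ E] := is_deriveD dW (is_deriveM (is_derive_coord0 x (e_ z) i) dZ).
apply: etrans E _; rewrite derive_W// recurrent_Z.2// e_coord /V1_ /GRing.scale /=.
by move: (Z_ x) (W_ i x) (i == z)%:R => Z W d; ring.
Qed.

Lemma recurrent_V2 : recurrent V2_.
Proof.
split.
  move=> k; apply: CnB => //.
    apply: CnB => //; apply: Cn_sum => // i _; apply: CnM => //; first exact: Cn_coord.
    exact: Cinf_W.
  apply: CnM => //; last exact: Cinf_Z.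
  by apply: CnM => //; [exact: Cn_cst|exact: Cn_dotvv].
move=> x z Ox.
have dh := Cinf_is_derive (e_ z) Ch Ox.
have dW i := Cinf_is_derive (e_ z) (Cinf_W i) Ox.
have dZ := Cinf_is_derive (e_ z) Cinf_Z Ox.
have dx := is_derive_coord0 x (e_ z).
have d1 := is_derive_sumf (fun i => is_deriveM (dx i) (dW i)).
have d2 := is_derive_scale 2%:R^-1 (is_derive_sumf (fun i => is_deriveM (dx i) (dx i))).
have [_ E] := is_deriveB (is_deriveB dh d1) (is_deriveM d2 dZ).
apply: etrans E _; rewrite /GRing.scale /= recurrent_Z.2//.
have hz : 'D_(e_ z) h x = W_ z x + th z x * h x by rewrite /W_; ring.
have [w wE] : exists w, forall k, W_ k x = w k by exists (fun k => W_ k x).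
rewrite /V2_ -/(dot x x) hz.
transitivity (w z + th z x * h x -
   \sum_i (x 0 i * (th z x * w i - (i == z)%:R * Z_ x) + w i * (i == z)%:R) -
   (2^-1 * (\sum_i x 0 i * x 0 i) * (th z x * Z_ x) +
    Z_ x * (2^-1 * \sum_i (x 0 i * (i == z)%:R + x 0 i * (i == z)%:R)))).
  rewrite wE; congr (_ - _ - (_ + _ * (_ * _))).
    by apply: eq_bigr => i _; rewrite derive_W// e_coord wE.
  by apply: eq_bigr => i _; rewrite e_coord.
have -> : \sum_i x 0 i * W_ i x = \sum_i x 0 i * w i by apply: eq_bigr => i _; rewrite wE.
rewrite /dot; move: (Z_ x) (h x) (th z x) => Z h' t; rewrite !sum3 {dh dW dZ dx d1 d2 hz}.
by move: z; apply: all3; rewrite /=; field.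
Qed.

Lemma V_expand x : h x = V2_ x + \sum_i x 0 i * V1_ i x + dot x x * (- 2%:R^-1 * Z_ x).
Proof.
have [w wE] : exists w, forall k, W_ k x = w k by exists (fun k => W_ k x).
by rewrite /V2_ /V1_ dotE !sum3 !wE; field.
Qed.

End Integrate.

(** * Homogeneous coordinates are quadratic up to a common factor *)
Section Quadric.
Context {R : realType}.
Variables (O : set 'rV[R]_3) (f : 'rV[R]_3 -> 'rV[R]_3).
Hypotheses (oO : open O) (Cf : forall l, Cinf O (fun y => f y 0 l)).
Hypothesis uJ : forall x, O x -> J_ f x \in unitmx.
Hypothesis circ : forall x, O x -> exists K : set 'rV[R]_3,
  [/\ open K, K !=set0 & forall v, K v ->
      circle_direction (fun i j k => accel f i j k x) (fun i j z m => jerk f i j z m x) v].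
Local Notation c k := (conf_part f k).
Local Notation t k := (proj_part f k).
Local Notation n := (proj_const f).
Let Cc k : Cinf O (c k) := Cinf_conf_part oO Cf uJ k.
Let Ct k : Cinf O (t k) := Cinf_proj_part oO Cf uJ k.

Let Cinf_proj_const : Cinf O n.
Proof.
by move=> k; apply: CnB => //; [exact: (Cinf_D _ (Ct 0))|apply: CnM => //; exact: Ct].
Qed.
Local Opaque conf_part proj_part proj_const.

(** The functions that become affine in the chart of the image: besides constants,
the coordinates of [f]. *)
Definition adapted (h : 'rV[R]_3 -> R) := Cinf O h /\
  forall x i j, O x -> 'D_(e_ j) ('D_(e_ i) h) x = - \sum_k accel f i j k x * 'D_(e_ k) h x.

Let hess h x i j : adapted h -> O x -> 'D_(e_ j) ('D_(e_ i) h) x =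
  - (i == j)%:R * (\sum_k c k x * 'D_(e_ k) h x) + t j x * 'D_(e_ i) h x
  + t i x * 'D_(e_ j) h x.
Proof.
move=> [_ H] Ox; rewrite H//.
have [g gE] : exists g, forall k, 'D_(e_ k) h x = g k by exists (fun k => 'D_(e_ k) h x).
transitivity (- \sum_k ((i == j)%:R * c k x - (i == k)%:R * t j x - (j == k)%:R * t i x) * g k).
  congr (- _); apply: eq_bigr => k _; rewrite gE; congr (_ * _).
  exact: (accel_form oO Cf uJ circ i j k Ox).
transitivity (- (i == j)%:R * (\sum_k c k x * g k) + t j x * g i + t i x * g j).
  have [c' cE] : exists c', forall k, c k x = c' k by exists (fun k => c k x).
  have [t' tE] : exists t', forall k, t k x = t' k by exists (fun k => t k x).
  rewrite !sum3 !cE !tE; move: g c' t' {H gE cE tE} => g c' t'.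
  by move: i j; do 2![apply: all3]; rewrite /=; ring.
rewrite !gE; congr (_ * _ + _ + _); apply: eq_bigr => k _; by rewrite gE.
Qed.

(** The coefficients [Z_], [V1_] and [V2_] of all coordinates are multiples of one
of them that does not vanish at [P]; such a one exists because the coordinates
do not all vanish. *)
Lemma adapted_quadric N (X : 'rV[R]_3 -> 'rV[R]_N) P : O P ->
  (forall a, adapted (fun x => X x 0 a)) -> X P != 0 ->
  exists (be : 'rV[R]_3 -> R) (a0 : 'rV[R]_N) (a1 : 'I_3 -> 'rV[R]_N) (a2 : 'rV[R]_N),
  \forall x \near P, be x != 0 /\
    X x = be x *: (a0 + \sum_i x 0 i *: a1 i + dot x x *: a2).
Proof.
move=> OP adX X0.
pose h a := fun x : 'rV[R]_3 => X x 0 a.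
have C a : Cinf O (h a) by case: (adX a).
have H a x i j Ox := @hess (h a) x i j (adX a) Ox.
have pt := pde_proj_part oO Cf uJ circ; have pc := pde_conf_part oO Cf uJ circ.
have pn := pde_proj_const oO Cf uJ circ.
pose Z a := Z_ (fun k => c k) n (h a).
pose V1 a i := V1_ (fun k => c k) (fun k => t k) n (h a) i.
pose V2 a := V2_ (fun k => c k) (fun k => t k) n (h a).
have rZ a : recurrent O (fun k => t k) (Z a).
  exact: (recurrent_Z oO Cc Cinf_proj_const pc pn (C a) (H a)).
have r1 a i : recurrent O (fun k => t k) (V1 a i).
  exact: (recurrent_V1 oO Cc Ct Cinf_proj_const pt pc pn (C a) (H a) i).
have r2 a : recurrent O (fun k => t k) (V2 a).
  exact: (recurrent_V2 oO Cc Ct Cinf_proj_const pt pc pn (C a) (H a)).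
have VE a x : X x 0 a = V2 a x + \sum_i x 0 i * V1 a i x + dot x x * (- 2%:R^-1 * Z a x).
  exact: V_expand.
have [be rbe beP] : exists2 be, recurrent O (fun k => t k) be & be P != 0.
  apply: contrapT => nob.
  have z F : recurrent O (fun k => t k) F -> F P = 0.
    move=> rF; apply: contrapT => /eqP FP; apply: nob; by exists F.
  move/eqP: X0; apply; apply/rowP => a; rewrite [LHS]VE mxE.
  rewrite (z _ (r2 a)) (z _ (rZ a)) mulr0 mulr0 addr0 add0r; apply: big1 => i _.
  by rewrite (z _ (r1 a i)) mulr0.
have be0 : \forall x \near P, be x != 0 by exact: (cvgr_neq0 _ (rbe.1 0%N P OP) beP).
have nF I (F : 'I_I -> 'rV[R]_3 -> R) : (forall a, recurrent O (fun k => t k) (F a)) ->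
    \forall x \near P, forall a, F a x = F a P / be P * be x.
  move=> rF.
  have := @filter_forall _ 'I_I (fun a x => F a x = F a P / be P * be x) (nbhs P) _.
  by apply=> a; have E := recurrent_ratio oO OP (rF a) rbe beP; exact: E.
have nZ := nF _ Z rZ; have n2 := nF _ V2 r2.
have n10 := nF _ (fun a => V1 a 0) (fun a => r1 a 0).
have n11 := nF _ (fun a => V1 a 1) (fun a => r1 a 1).
have n12 := nF _ (fun a => V1 a 2%:R) (fun a => r1 a 2%:R).
have n1 : \forall x \near P, forall i a, V1 a i x = V1 a i P / be P * be x.
  by apply: filterS (filterI n10 (filterI n11 n12)) => x [? [? ?]]; exact: all3.
exists be, (\row_a (V2 a P / be P)), (fun i => \row_a (V1 a i P / be P)),
  (\row_a (- 2%:R^-1 * (Z a P / be P))).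
apply: filterS (filterI be0 (filterI nZ (filterI n1 n2))) => x [b0 [EZ [E1 E2]]].
split=> //; apply/rowP => a; rewrite [LHS]VE EZ E2 !mxE summxE.
transitivity (V2 a P / be P * be x + (\sum_i x 0 i * (V1 a i P / be P)) * be x
    + dot x x * (- 2^-1 * (Z a P / be P * be x))).
  congr (_ + _ + _); rewrite mulr_suml; apply: eq_bigr => i _.
  by rewrite (E1 i a) mulrA.
transitivity (be x * (V2 a P / be P + (\sum_i x 0 i * (V1 a i P / be P))
  + dot x x * (- 2^-1 * (Z a P / be P)))).
  by move: (_ / _) (\sum_i _) (dot x x) (Z a P / be P) => v s d z; ring.
by congr (_ * (_ + _ + _)); apply: eq_bigr => i _; rewrite !mxE.
Qed.

End Quadric.

(** * From the rectified family to the quadratic form of the map *)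
Section ChartLift.
Context {R : realType}.
Implicit Types (Phi : 'rV[R]_3 -> RP3 R) (P Q x v w : 'rV[R]_3).

Definition lift_chart (i : 'I_4) (y : 'rV[R]_3) : 'rV[R]_4 :=
  \row_a (if unlift i a is Some l then y 0 l else 1).

Lemma lift_chart_i i y : lift_chart i y 0 i = 1.
Proof. by rewrite mxE unlift_none. Qed.

Lemma lift_chart_lift i y l : lift_chart i y 0 (lift i l) = y 0 l.
Proof. by rewrite mxE liftK. Qed.

Lemma vpick_line (p : RP3 R) : val p = <[vpick (val p)]>%VS.
Proof.
case: p => V /= dV; apply/eqP; rewrite eq_sym eqEdim -memvE memv_pick.
by rewrite (eqP dV) dim_vline vpick0 -dimv_eq0 (eqP dV).
Qed.

Lemma in_chart_line i (p : RP3 R) : in_chart i p ->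
  val p = <[lift_chart i (chart i p)]>%VS.
Proof.
move=> pi; rewrite {1}vpick_line.
have -> : lift_chart i (chart i p) = (vpick (val p) 0 i)^-1 *: vpick (val p).
  apply/rowP => a; rewrite !mxE; case: unliftP => [l ->|->]; last by rewrite mulVf.
  by rewrite mxE mulrC.
apply/eqP; rewrite eqEsubv -!memvE memvZ ?memv_line// andbT.
by rewrite -[X in X \in _](scalerKV pi) memvZ ?memv_line.
Qed.

Lemma J_row (f : 'rV[R]_3 -> 'rV[R]_3) x v : differentiable f x ->
  v *m J_ f x = 'D_v f x.
Proof.
move=> df; apply/rowP => l; rewrite -derive_coord; last exact: diff_derivable.
rewrite (derive_sum_e v (differentiable_row_coord l df)) !mxE.
by apply: eq_bigr => k _; rewrite mxE.
Qed.

(** If [v] is in the kernel of the differential of [f], differentiating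
[g (f x) = x] in the direction [v] gives [v = 0]. *)
Lemma diffeo_J_unit U (f : 'rV[R]_3 -> 'rV[R]_3) x : diffeo_on U f -> U x ->
  J_ f x \in unitmx.
Proof.
move=> [oU sf ofU [g sg gf]] Ux.
have df : differentiable f x := (sf 1%N).1 x Ux.
have dg : differentiable g (f x) by apply: (sg 1%N).1; exists x.
rewrite -row_free_unit -kermx_eq0; apply/rowV0P => v /sub_kermxP.
rewrite (J_row _ df) => Dv0.
have [_ <-] := is_derive_id x v.
have near_gf : \forall y \near x, (g \o f) y = id y.
  by apply: filterS (open_nbhs_nbhs (conj oU Ux)) => y /gf.
rewrite -(near_eq_derive v near_gf) (deriveE _ (differentiable_comp df dg)).
rewrite (diff_comp df dg) /=.
have E : 'd f x v = 0 := etrans (esym (deriveE v df)) Dv0.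
exact: etrans (congr1 ('d g (f x)) E) (linear0 _).
Qed.

Lemma lift_chart_funl i l (f : 'rV[R]_3 -> 'rV[R]_3) :
  (fun x => lift_chart i (f x) 0 (lift i l)) = (fun x => f x 0 l).
Proof. by apply/funext => x; rewrite lift_chart_lift. Qed.

Lemma lift_chart_funi i (f : 'rV[R]_3 -> 'rV[R]_3) :
  (fun x => lift_chart i (f x) 0 i) = (fun=> 1).
Proof. by apply/funext => x; rewrite lift_chart_i. Qed.

Lemma Cinf_lift_chart i O (f : 'rV[R]_3 -> 'rV[R]_3) a : open O ->
  (forall l, Cinf O (fun x => f x 0 l)) -> Cinf O (fun x => lift_chart i (f x) 0 a).
Proof.
move=> oO Cf; case: (unliftP i a) => [l ->|->].
  by rewrite lift_chart_funl.
by rewrite lift_chart_funi => k; exact: Cn_cst.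
Qed.

Lemma arc_near (V : set 'rV[R]_3) Q v w : nbhs Q V ->
  \forall t \near (0 : R), V (circ_arc Q v w t).
Proof.
move=> VQ; have [dy _] := is_derive_arc Q v w 0.
have cy : {for (0 : R), continuous (circ_arc Q v w)}.
  by apply/differentiable_continuous/derivable1_diffP.
by apply: cy; rewrite arc_at0.
Qed.

Lemma rectified_circle_direction Phi i O Q v (gamma : set 'rV[R]_3) L :
  let f := fun x => chart i (Phi x) in
  open O -> (forall x, O x -> in_chart i (Phi x)) ->
  forall (Cf : forall l, Cinf O (fun x => f x 0 l)), (forall x, O x -> J_ f x \in unitmx) ->
  O Q -> is_circle gamma -> gamma Q -> tangent_direction gamma Q v ->
  (forall x, (gamma `&` O) x -> on_line L (Phi x)) ->
  circle_direction (fun i j k => accel f i j k Q) (fun i j z m => jerk f i j z m Q) v.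
Proof.
move=> f oO chO Cf uJ OQ cg gQ tv gL.
have [w vw gw] := circle_arc cg gQ tv; have [v0 _] := tv.
apply: (circle_direction_accel oO Cf uJ OQ v0 vw).
have dL : \dim L = 2 by have [] := gL Q (conj gQ OQ).
pose X x := lift_chart i (f x).
have XL : \forall t \near (0 : R), X (circ_arc Q v w t) \in L.
  apply: filterS (arc_near v w (open_nbhs_nbhs (conj oO OQ))) => t Ot.
  have [_] := gL _ (conj (gw t) Ot).
  by rewrite (in_chart_line (chO _ Ot)) -memvE.
have D1 : \row_a arcH1 Q v w (fun x => X x 0 a) 0 != 0.
  apply/eqP => /rowP D0; move/eqP: v0; apply.
  have vJ : v *m J_ f Q = 0.
    apply/rowP => l; have := D0 (lift i l); rewrite !mxE /X lift_chart_funl arcH1_0 => E.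
    by rewrite -[RHS]E; apply: eq_bigr => k _; rewrite mxE.
  by rewrite -(mulmxK (uJ _ OQ) v) vJ mul0mx.
have X1 x : O x -> X x 0 i = 1 by move=> _; exact: lift_chart_i.
have CX a := Cinf_lift_chart i a oO Cf.
have [b [g H]] := line_jet oO OQ CX X1 dL XL D1.
by exists b, g => l; have := H (lift i l); rewrite /X lift_chart_funl.
Qed.

(** The last clause, which says that the image of the germ spans the whole of R^4,
follows from the invertibility of the jacobian matrix. *)
Lemma rectified_quadric Phi P : rectifies_rich Phi P ->
  exists (X : 'rV[R]_3 -> 'rV[R]_4) be a0 (a1 : 'I_3 -> 'rV[R]_4) a2,
  [/\ \forall x \near P, val (Phi x) = <[X x]>%VS,
      \forall x \near P, be x != 0 /\
        X x = be x *: (a0 + \sum_i x 0 i *: a1 i + dot x x *: a2) &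
      forall w : 'cV[R]_4, (\forall x \near P, X x *m w = 0) -> w = 0].
Proof.
move=> [[i [U [UP chU dU]]] [U' [Delta [[oU' _ _] U'P [Dc [Gam GD [cov cone]]] [V VP rect]]]]].
pose f x := chart i (Phi x).
pose O := U `&` (V^° `&` U').
have [oU sf _ _] := dU.
have oO : open O by do 2![apply: openI => //]; exact: open_interior.
have OP : O P by split=> //; split=> //; exact: VP.
have OU x : O x -> U x by case.
have uJ x : O x -> J_ f x \in unitmx by move=> [Ux _]; exact: diffeo_J_unit dU Ux.
have Cf l : Cinf O (fun x => f x 0 l).
  by move=> k; apply: Cn_sub (class_C_coord l oU (sf k)).
have chO x : O x -> in_chart i (Phi x) by move=> /OU /chU.
have circ x : O x -> exists K : set 'rV[R]_3,
  [/\ open K, K !=set0 & forall v, K v ->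
      circle_direction (fun i j k => accel f i j k x) (fun i j z m => jerk f i j z m x) v].
  move=> Ox; have [_ [_ U'x]] := Ox.
  have [gam Ggam gx] := cov x U'x.
  have [K _ /(_ x (conj gx U'x))[[oK _ _] tK Kc]] := cone gam Ggam.
  exists (K x); split=> //.
    have [v tv] := circle_tangent (Dc _ (GD _ Ggam)) gx.
    by exists v; exact: tK.
  move=> v /Kc[g' [Gg' g'x tv]].
  have [L [dL gL]] := rect _ (GD _ Gg').
  apply: (rectified_circle_direction oO chO Cf uJ Ox (Dc _ (GD _ Gg')) g'x tv (L := L)).
  by move=> y [g'y [_ [Vy _]]]; apply: gL; split=> //; exact: interior_subset.
pose X x := lift_chart i (f x).
have adX a : adapted O f (fun x => X x 0 a).
  split; first exact: Cinf_lift_chart.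
  move=> x j k Ox; rewrite /X; case: (unliftP i a) => [l ->|->].
    by rewrite lift_chart_funl; exact: (accelE uJ).
  pose one : 'rV[R]_3 -> R := fun=> 1.
  have -> : (fun x => lift_chart i (f x) 0 i) = one by exact: lift_chart_funi.
  have z m y : O y -> 'D_(e_ m) one y = 0.
    exact: (@Cinf_locally_cst R O one 1 (e_ m) oO (fun _ _ => erefl)).
  rewrite (Cinf_locally_cst (e_ k) oO (z j) Ox).
  apply/esym/eqP; rewrite oppr_eq0; apply/eqP.
  by apply: big1 => m _; rewrite z// mulr0.
have X0 : X P != 0.
  by apply/eqP => /rowP/(_ i)/eqP; rewrite lift_chart_i mxE oner_eq0.
have [be [a0 [a1 [a2 H]]]] := adapted_quadric oO Cf uJ circ OP adX X0.
exists X, be, a0, a1, a2; split=> //.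
  by apply: filterS (open_nbhs_nbhs (conj oO OP)) => x /chO; exact: in_chart_line.
move=> w Xw.
have df x : O x -> differentiable f x by move=> /OU; exact: (sf 1%N).1.
have Jw : J_ f P *m (\col_l w (lift i l) 0) = 0.
  apply/colP => k; rewrite !mxE.
  have dF : is_derive P (e_ k) (fun x => \sum_l f x 0 l * w (lift i l) 0)
      (\sum_l 'D_(e_ k) (fun y => f y 0 l) P * w (lift i l) 0).
    apply: is_derive_sumf => l; have := Cinf_is_derive (e_ k) (Cf l) OP => dfl.
    by apply: is_derive_eq; rewrite scaler0 add0r /GRing.scale /= mulrC.
  transitivity (\sum_l 'D_(e_ k) (fun y => f y 0 l) P * w (lift i l) 0).
    by apply: eq_bigr => l _; rewrite !mxE.
  have [_ <-] := dF.
  rewrite (@near_eq_derive _ _ _ _ (cst (- w i 0))) ?derive_cst//.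
  apply: filterS Xw => x /rowP/(_ 0); rewrite !mxE (bigD1_ord i)//= /X lift_chart_i mul1r.
  move=> /eqP; rewrite addr_eq0 => /eqP ->; rewrite opprK.
  by apply: eq_bigr => l _; rewrite lift_chart_lift.
have wl l : w (lift i l) 0 = 0.
  have : \col_l w (lift i l) 0 = 0 :> 'cV_3.
    by rewrite -(mulKmx (uJ _ OP) (\col_l w (lift i l) 0)) Jw mulmx0.
  by move/colP/(_ l); rewrite !mxE.
apply/colP => a; rewrite mxE; case: (unliftP i a) => [l ->//|->].
have := nbhs_singleton Xw; move/rowP/(_ 0); rewrite !mxE (bigD1_ord i)//= /X lift_chart_i mul1r.
by rewrite big1 ?addr0// => l _; rewrite wl mulr0.
Qed.

End ChartLift.

(** * Moebius similarities *)
Section Moebius.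
Context {R : realType}.
Implicit Types (x y b v : 'rV[R]_3).

Lemma moebius_comp (M N : option 'rV[R]_3 -> option 'rV[R]_3) :
  moebius M -> moebius N -> moebius (M \o N).
Proof.
elim=> [//|c r M' r0 _ IH|n a M' n0 _ IH] mN.
  by rewrite -compA; apply: moebius_inversion => //; exact: IH.
by rewrite -compA; apply: moebius_reflection => //; exact: IH.
Qed.

(** The product of the reflections in two parallel planes. *)
Lemma moebius_translation v :
  exists2 M, @moebius R M & forall x, M (Some x) = Some (x + v).
Proof.
have [->|v0] := eqVneq v 0; first by exists id; [exact: moebius_id|move=> x; rewrite addr0].
exists (reflection v (dot v v / 2%:R) \o (reflection v 0 \o id)).
  by do 2![apply: moebius_reflection => //]; exact: moebius_id.
move=> x /=; congr Some; have vv := lt0r_neq0 (dotvv_gt0 v0).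
rewrite -addrA; congr (_ + _); rewrite dotDr dotNr dotZr -opprD -scalerDl -scaleNr.
by rewrite -[RHS]scale1r; congr (_ *: _); field.
Qed.

(** The product of the inversions in two concentric spheres. *)
Lemma moebius_scaling (k : R) : 0 < k ->
  exists2 M, @moebius R M & forall x, M (Some x) = Some (k *: x).
Proof.
move=> k0; exists (inversion 0 (Num.sqrt k) \o (inversion 0 1 \o id)).
  by do 2![apply: moebius_inversion; rewrite ?sqrtr_gt0//]; exact: moebius_id.
move=> x /=; have [->|x0] := eqVneq x 0; first by rewrite scaler0.
have xx := lt0r_neq0 (dotvv_gt0 x0).
rewrite /= subr0 add0r expr1n div1r scaler_eq0 invr_eq0 (negbTE xx) (negbTE x0) /=.
congr Some; rewrite subr0 add0r scalerA sqr_sqrtr ?ltW// dotZl dotZr.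
by congr (_ *: _); field.
Qed.

Lemma moebius_similarity b (h : R) : 0 < h ->
  exists2 M, @moebius R M & forall x, M (Some x) = Some (h^-1 *: (x - b)).
Proof.
move=> h0; have [M1 m1 E1] := moebius_translation (- b).
have hi0 : 0 < h^-1 by rewrite invr_gt0.
have [M2 m2 E2] := moebius_scaling hi0.
by exists (M2 \o M1); [exact: moebius_comp|move=> x /=; rewrite E1 E2].
Qed.

End Moebius.

(** * Normal forms of the quadratic maps *)
Section QuadricNormalForm.
Context {R : realType}.
Implicit Types (x y b p : 'rV[R]_3) (a c : 'rV[R]_4) (A : 'M[R]_(3, 4)).

Definition quad a A c x : 'rV[R]_4 := a + x *m A + dot x x *: c.

Lemma hom_mul x (w : R) (A : 'M[R]_(3, 4)) c :
  Defs.hom x w *m (col_mx A c : 'M[R]_(3 + 1, 4)) = x *m A + w *: c.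
Proof. by rewrite /Defs.hom (@mul_row_col R 1 3 1 4 x w%:M A c) mul_scalar_mx. Qed.

Lemma quad_shift a A c b y : quad a A c (b + y) =
  quad (quad a A c b) (A + 2%:R *: b^T *m c) c y.
Proof.
rewrite /quad !mulmxDl mulmxDr !mulmxA.
have -> : y *m (2%:R *: b^T) *m c = (2 * dot b y) *: c.
  have -> : y *m (2%:R *: b^T) = (2 * dot b y)%:M.
    apply/matrixP => i j; rewrite !ord1 !mxE eqxx mulr1n mulr_sumr.
    by apply: eq_bigr => k _; rewrite !mxE mulrCA [y _ _ * _]mulrC.
  by rewrite mul_scalar_mx.
rewrite !(dotDl, dotDr) (dotC y b).
apply/rowP => k; rewrite !mxE; move: (\sum_j _) (\sum_j _) => s t; ring.
Qed.

Lemma quad_scale a A c (h : R) y : quad a A c (h *: y) = quad a (h *: A) (h ^+ 2 *: c) y.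
Proof.
rewrite /quad dotZl dotZr -scalemxAl -scalemxAr scalerA; congr (_ + _ *: _); ring.
Qed.

Lemma quad_inverse a A c u : u != 0 ->
  quad a A c ((dot u u)^-1 *: u) = (dot u u)^-1 *: quad c A a u.
Proof.
move=> /dotvv_gt0/lt0r_neq0 uu; rewrite /quad dotZl dotZr -scalemxAl !scalerDr !scalerA.
by rewrite !mulVf// mulr1 scale1r [LHS]addrC [a + _]addrC addrA.
Qed.

(** If the center of projection is [(1, b, d)] and [dot b b - d] is not 0, then
[b] becomes the origin of the model and the sign [ep] of [dot b b - d] its type. *)
Lemma quad_center a A c b (d h ep : R) y : a + b *m A + d *: c = 0 ->
  ep ^+ 2 = 1 -> h ^+ 2 * ep = dot b b - d ->
  quad a A c (b + h *: y) =
  Defs.hom y (1 + ep * dot y y) *m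
    (col_mx (h *: (A + 2%:R *: b^T *m c)) ((dot b b - d) *: c) : 'M[R]_(3 + 1, 4)).
Proof.
move=> k0 e2 h2; rewrite quad_shift quad_scale hom_mul.
have -> : quad a A c b = (dot b b - d) *: c.
  by rewrite /quad scalerBl -[LHS]subr0 -k0 opprD addrACA subrr add0r.
rewrite {1}/quad addrAC addrC; congr (_ + _); rewrite !scalerA -scalerDl; congr (_ *: _).
rewrite -h2; have E : h ^+ 2 * dot y y * ep ^+ 2 = h ^+ 2 * dot y y by rewrite e2 mulr1.
by move: (dot y y) E => Y E; lra.
Qed.

(** Five vectors in a space of dimension 4. *)
Lemma quad_kernel a A c : exists k0 k1 k2, (k0 != 0 \/ k1 != 0 \/ k2 != 0) /\
  k0 *: a + k1 *m A + k2 *: c = 0 :> 'rV[R]_4.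
Proof.
pose B : 'M[R]_(1 + (3 + 1), 4) := col_mx a (col_mx A c).
have : kermx B != 0.
  by rewrite kermx_eq0 /row_free neq_ltn (leq_ltn_trans (rank_leq_col B)).
move=> /rowV0Pn[u /sub_kermxP uB u0].
have E : u = row_mx (lsubmx u) (row_mx (lsubmx (rsubmx u)) (rsubmx (rsubmx u))).
  by rewrite !hsubmxK.
exists (lsubmx u 0 0), (lsubmx (rsubmx u)), (rsubmx (rsubmx u) 0 0).
split; last first.
  move: uB; rewrite {1}E !mul_row_col addrA.
  by rewrite -!mul_scalar_mx -!mx11_scalar.
apply: contrapT => H; move/eqP: u0; apply; rewrite E.
have z0 : lsubmx u 0 0 = 0 by apply: contrapT => /eqP z; apply: H; left.
have e1 : lsubmx (rsubmx u) = 0 by apply: contrapT => /eqP z; apply: H; right; left.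
have z2 : rsubmx (rsubmx u) 0 0 = 0 by apply: contrapT => /eqP z; apply: H; right; right.
have e0 : lsubmx u = 0 by rewrite (mx11_scalar (lsubmx u)) z0 raddf0.
have e2 : rsubmx (rsubmx u) = 0 by rewrite (mx11_scalar (rsubmx (rsubmx u))) z2 raddf0.
by rewrite e0 e1 e2 !row_mx0.
Qed.

End QuadricNormalForm.

Section NormalForm.
Context {R : realType}.
Implicit Types (x y b p : 'rV[R]_3) (a c : 'rV[R]_4) (A : 'M[R]_(3, 4)).

(** The models are [x |-> (x, 1 + eps j * dot x x)]. *)
Definition eps (j : 'I_3) : R := tnth [tuple -1; 0; 1] j.

Lemma val_Phi j x : val (Phi_ j x) = <[Defs.hom x (1 + eps j * dot x x)]>%VS.
Proof.
move: j; apply: all3; rewrite /Phi_ /eps /tnth /= ?mulN1r ?mul0r ?addr0 ?mul1r//.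
Qed.

Lemma unit_inverse_invol (v : 'rV[R]_3) : v != 0 ->
  let u := (dot v v)^-1 *: v in u != 0 /\ v = (dot u u)^-1 *: u.
Proof.
move=> v0 u; have vv := lt0r_neq0 (dotvv_gt0 v0).
split; first by rewrite scaler_eq0 invr_eq0 (negbTE vv).
rewrite /u dotZl dotZr scalerA mulrA -[LHS]scale1r; congr (_ *: _); by field.
Qed.

Lemma inversion1E p x : x != p ->
  inversion p 1 (Some x) = Some (p + (dot (x - p) (x - p))^-1 *: (x - p)).
Proof. by move=> xp; rewrite /= (negbTE xp) expr1n div1r. Qed.

Lemma near_neq p x : x != p -> \forall z \near x, z != p.
Proof.
move=> xp; have cont : {for x, continuous (fun z : 'rV[R]_3 => z - p)}.
  by apply: continuousB; [exact: cvg_id|exact: cst_continuous].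
have xp0 : x - p != 0 by rewrite subr_eq0.
have H : \forall z \near x, z - p != 0 by exact: (cvgr_neq0 _ cont xp0).
by apply: filterS H => z; rewrite subr_eq0.
Qed.

Definition normalizes a A c (P : 'rV[R]_3) j := exists (T : 'M[R]_(3 + 1, 4)) M,
  moebius M /\ \forall x \near P, exists y s,
    [/\ M (Some x) = Some y, s != 0 &
        quad a A c x = s *: (Defs.hom y (1 + eps j * dot y y) *m T)].

Lemma normalizes_plane a A P : normalizes a A 0 P 1.
Proof.
exists (col_mx A a), id; split; first exact: moebius_id.
apply: filterE => x; exists x, 1; split; [by []|exact: oner_neq0|].
by rewrite scale1r hom_mul /quad scaler0 addr0 /eps /= mul0r addr0 scale1r addrC.
Qed.

(** The center of projection is the point [b] of the sphere: an inversion centered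
at [b] sends it to infinity, and the map becomes affine. *)
Lemma normalizes_point a A c b P : P != b -> quad a A c b = 0 -> normalizes a A c P 1.
Proof.
move=> Pb qb; pose A' := A + 2%:R *: b^T *m c.
exists (col_mx A' (c - b *m A')), (inversion b 1); split.
  by apply: (@moebius_inversion R b 1 id) => //; exact: moebius_id.
apply: filterS (near_neq Pb) => x xb.
have v0 : x - b != 0 by rewrite subr_eq0.
have [] := unit_inverse_invol v0; set u := _ *: _ => u0 vE.
have uu := lt0r_neq0 (dotvv_gt0 u0).
exists (b + u), (dot u u)^-1; split; [exact: inversion1E|by rewrite invr_eq0|].
rewrite hom_mul /eps /= mul0r addr0 scale1r mulmxDl.
have -> : x = b + (x - b) by rewrite addrC subrK.
rewrite quad_shift qb {1}vE quad_inverse// -/A'; congr (_ *: _).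
rewrite /quad scaler0 addr0; move: (u *m A') (b *m A') => s t.
by apply/rowP => k; rewrite !mxE; ring.
Qed.

Lemma eps_sign (d : R) : d != 0 ->
  exists j (h : R), [/\ 0 < h, eps j ^+ 2 = 1 & h ^+ 2 * eps j = d].
Proof.
move=> d0; exists (if 0 < d then 2%:R else 0), (Num.sqrt `|d|).
rewrite sqrtr_gt0 normr_gt0 d0 sqr_sqrtr//; split=> //; case: ltP => dP;
  rewrite /eps /tnth /= ?sqrrN ?expr1n// ?mulr1 ?mulrN1; first by rewrite gtr0_norm.
by rewrite ler0_norm// opprK.
Qed.

Lemma normalizes_center a A c b (d : R) : a + b *m A + d *: c = 0 ->
  dot b b != d -> exists j (T : 'M[R]_(3 + 1, 4)) M, moebius M /\ forall x, exists2 y,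
    M (Some x) = Some y & quad a A c x = Defs.hom y (1 + eps j * dot y y) *m T.
Proof.
move=> k0; rewrite -subr_eq0 => /eps_sign[j [h [h0 e2 h2]]]; exists j.
have [M mM ME] := moebius_similarity b h0.
exists (col_mx (h *: (A + 2%:R *: b^T *m c)) ((dot b b - d) *: c)), M; split=> //.
move=> x; exists (h^-1 *: (x - b)); first exact: ME.
rewrite -(quad_center _ k0 e2 h2) scalerA divff ?lt0r_neq0// scale1r.
by rewrite addrC subrK.
Qed.

(** The center of projection is at infinity, off the sphere: the relation has no
term in [a].  An inversion whose center [p] is not in the plane
[2 dot x n = k] brings it to a finite place. *)
Lemma normalizes_mirror a A c (n : 'rV[R]_3) (k : R) P : n *m A + k *: c = 0 -> n != 0 ->
  exists j, normalizes a A c P j.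
Proof.
move=> nk n0; have nn := dotvv_gt0 n0.
(* the center of inversion must avoid both the point P and this plane *)
have [t [t0 tk]] : exists t : R, t != 0 /\ k - 2 * dot (P + t *: n) n != 0.
  have [e|ne] := eqVneq (k - 2 * dot (P + 1 *: n) n) 0; last first.
    by exists 1; split=> //; exact: oner_neq0.
  exists (- 1); split; first by rewrite oppr_eq0 oner_neq0.
  apply/eqP => e'; move: nn e e'; rewrite !(dotDl, dotZl) => nn e e'.
  have : dot n n = 0 by lra.
  by move=> nn0; rewrite nn0 ltxx in nn.
set p := P + t *: n in tk; set s := k - _ in tk.
have Pp : P != p.
  by rewrite /p -subr_eq0 opprD addNKr oppr_eq0 scaler_eq0 negb_or t0.
pose A' := A + 2%:R *: p^T *m c; pose g := quad a A c p; pose b := s^-1 *: n.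
have k0 : c + b *m A' + 0 *: g = 0.
  rewrite scale0r addr0 /b -scalemxAl mulmxDr mulmxA.
  have -> : n *m (2%:R *: p^T) *m c = (2 * dot p n) *: c.
    have -> : n *m (2%:R *: p^T) = (2 * dot p n)%:M.
      apply/matrixP => i j; rewrite !ord1 !mxE eqxx mulr1n mulr_sumr.
      by apply: eq_bigr => l _; rewrite !mxE mulrCA [n _ _ * _]mulrC.
    by rewrite mul_scalar_mx.
  have -> : n *m A = - k *: c by apply/eqP; rewrite scaleNr -addr_eq0 nk.
  rewrite -scalerDl; have -> : - k + 2 * dot p n = - s by rewrite /s; ring.
  by rewrite scalerA mulrN mulVf// scaleN1r subrr.
have bb : dot b b != 0 by rewrite dotvv_eq0 scaler_eq0 invr_eq0 negb_or tk.
have [j [T [M [mM nM]]]] := normalizes_center k0 bb.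
have [Tr mTr TrE] := moebius_translation (- p).
exists j, T, (M \o (Tr \o (inversion p 1 \o id))); split.
  do 2![apply: moebius_comp => //]; apply: moebius_inversion => //; exact: moebius_id.
apply: filterS (near_neq Pp) => x xp.
have v0 : x - p != 0 by rewrite subr_eq0.
have [] := unit_inverse_invol v0; set u := _ *: _ => u0 vE.
have uu := lt0r_neq0 (dotvv_gt0 u0); have [y My yE] := nM u.
exists y, (dot u u)^-1; split; last 2 first.
- by rewrite invr_eq0.
- rewrite -yE -quad_inverse// -vE -[in LHS](subrK p x) [_ + p]addrC.
  exact: quad_shift.
- have -> : (M \o (Tr \o (inversion p 1 \o id))) (Some x)
    = M (Tr (inversion p 1 (Some x))) by [].
  by rewrite inversion1E// TrE addrAC subrr add0r.
Qed.

(** The cases are: center of projection at infinity on the sphere, at infinity off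
the sphere, finite off the sphere, finite on the sphere. *)
Lemma quad_normal a A c P : quad a A c P != 0 -> exists j, normalizes a A c P j.
Proof.
move=> qP; have [k0 [k1 [k2 [kn0 kE]]]] := quad_kernel a A c.
have [z0|n0] := eqVneq k0 0.
  move: kE; rewrite z0 scale0r add0r => kE.
  have [z1|n1] := eqVneq k1 0; last exact: normalizes_mirror kE n1.
  have c0 : c = 0.
    move: kE; rewrite z1 mul0mx add0r => /eqP.
    rewrite scaler_eq0 => /orP[/eqP k20|/eqP//].
    by move: kn0; rewrite z0 z1 k20 !eqxx; case=> [|[|]].
  by exists 1; rewrite c0; exact: normalizes_plane.
have bE : a + (k0^-1 *: k1) *m A + (k0^-1 * k2) *: c = 0.
  have : k0^-1 *: (k0 *: a + k1 *m A + k2 *: c) = 0 by rewrite kE scaler0.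
  by rewrite !scalerDr !scalerA mulVf// scale1r -scalemxAl.
move: bE; set b := _ *: k1; set d := _ * k2 => bE.
have [bd|bd] := eqVneq (dot b b) d; last first.
  have [j [T [M [mM nM]]]] := normalizes_center bE bd.
  exists j, T, M; split=> //; apply: filterE => x; have [y My yE] := nM x.
  by exists y, 1; split; [|exact: oner_neq0|rewrite scale1r].
have qb : quad a A c b = 0 by rewrite /quad bd.
exists 1; apply: (normalizes_point (b := b)) => //.
by apply: contraNneq qP => ->; rewrite qb.
Qed.

(** The normal form of [quad] makes the coordinates of [X] linear functions [T] of
those of a model; [T] is invertible because [X] spans R^4. *)
Lemma rectified_equivalent (Phi : 'rV[R]_3 -> RP3 R) P : rectifies_rich Phi P ->
  exists j, equivalent_at P Phi (Phi_ j).
Proof.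
move=> /rectified_quadric[X [be [a0 [a1 [a2 [XP XE Xn]]]]]].
pose A : 'M[R]_(3, 4) := \matrix_i a1 i.
have XE' : \forall x \near P, be x != 0 /\ X x = be x *: quad a0 A a2 x.
  apply: filterS XE => x [b0 ->]; split=> //; congr (_ *: (_ + _ + _)).
  by rewrite mulmx_sum_row; apply: eq_bigr => i _; rewrite rowK.
have qP : quad a0 A a2 P != 0.
  have [_ XPE] := nbhs_singleton XE'.
  have : X P != 0.
    apply/eqP => X0; have := nbhs_singleton XP; rewrite X0 => E.
    by have := valP (Phi P); rewrite /= E (_ : <[0]>%VS = 0%VS) ?dimv0//;
      apply/eqP; rewrite -dimv_eq0 dim_vline eqxx.
  by rewrite XPE; apply: contraNneq => ->; rewrite scaler0.
have [j [T [M [mM nM]]]] := quad_normal qP.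
have near_all : \forall x \near P, exists y s,
    [/\ M (Some x) = Some y, s != 0, val (Phi x) = <[X x]>%VS &
        X x = s *: (Defs.hom y (1 + eps j * dot y y) *m T)].
  apply: filterS (filterI XP (filterI XE' nM)) => x [VX [[b0 Xx] [y [s [My s0 qx]]]]].
  exists y, (be x * s); split; [exact: My|exact: mulf_neq0|exact: VX|].
  by rewrite Xx qx scalerA.
(* a linear form killed by T would vanish on the image of the germ *)
have uT : T \in unitmx.
  rewrite -unitmx_tr -row_free_unit -kermx_eq0; apply/rowV0P => v /sub_kermxP vT.
  have Tv : T *m v^T = 0 by rewrite -[T]trmxK -trmx_mul vT trmx0.
  suff : v^T = 0 by move=> v0; rewrite -[v]trmxK v0 trmx0.
  apply: Xn; apply: filterS near_all => x [y [s [_ _ _ ->]]].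
  by rewrite -scalemxAl -mulmxA Tv mulmx0 scaler0.
pose T4 : 'M[R]_4 := T.
have injT : lker (linfun (mulmxr T4) : 'Hom('rV[R]_4, 'rV[R]_4)) == 0%VS.
  apply/lker0P => u v; rewrite !lfunE /= => /(congr1 (mulmx^~ (invmx T4))).
  by rewrite !mulmxK.
have dimT (p : RP3 R) : \dim (linfun (mulmxr T4) @: val p)%VS == 1%N.
  by rewrite limg_dim_eq ?(eqP injT) ?capv0 ?(eqP (valP p)).
exists j, (fun q : RP3 R => exist (fun l => \dim l == 1%N) _ (dimT q)), M; split=> //.
- by exists T4.
- by have [y [s [-> _ _ _]]] := nbhs_singleton near_all.
apply: filterS near_all => x [y [s [My s0 VX XE2]]]; exists y => //.
apply/val_inj; rewrite /= val_Phi VX XE2 limg_line lfunE /=.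
apply/eqP; rewrite eqEsubv -!memvE memvZ ?memv_line//=.
by rewrite -[X in X \in _](scalerK s0) memvZ ?memv_line.
Qed.

End NormalForm.

(** * Functions vanishing on spheres *)
Section SphereFunctions.
Context {R : realType}.
Implicit Types (x u v : 'rV[R]_3) (X : option 'rV[R]_3).

(** The functions [p + dot q x + w * dot x x]; at infinity only the leading
coefficient counts, up to the factor [t] of [pulls_back]. *)
Definition sphere_ev (p : R) (q : 'rV[R]_3) (w : R) X : R :=
  if X is Some x then p + dot q x + w * dot x x else w.

(** The squared radius of the sphere of equation [sphere_ev p q w = 0], times
[4 w ^+ 2]: an invariant quadratic form of signature (4, 1). *)
Definition sphere_disc (p : R) (q : 'rV[R]_3) (w : R) : R := dot q q - 4%:R * p * w.

(** The positivity of [mu] makes the sign of the discriminant a Moebius invariant. *)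
Definition pulls_back (M : option 'rV[R]_3 -> option 'rV[R]_3) :=
  exists mu t, [/\ 0 < mu, forall X, t X != 0 & forall p q w, exists p' q' w',
    sphere_disc p' q' w' = mu * sphere_disc p q w /\
    forall X, sphere_ev p q w (M X) * t X = sphere_ev p' q' w' X].

Lemma pulls_back_comp M N : pulls_back M -> pulls_back N -> pulls_back (M \o N).
Proof.
move=> [mu [t [mu0 t0 H]]] [mu' [t' [mu'0 t'0 H']]].
exists (mu' * mu), (fun X => t (N X) * t' X); split=> [|X|p q w].
- exact: mulr_gt0.
- exact: mulf_neq0.
have [p1 [q1 [w1 [D1 E1]]]] := H p q w; have [p2 [q2 [w2 [D2 E2]]]] := H' p1 q1 w1.
exists p2, q2, w2; split; first by rewrite D2 D1 mulrA.
by move=> X; rewrite /= mulrA E1 E2.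
Qed.

Lemma pulls_back_id : pulls_back id.
Proof.
exists 1, (fun=> 1); split=> [|X|p q w]; [exact: ltr01|exact: oner_neq0|].
by exists p, q, w; split=> [|X]; rewrite ?mul1r ?mulr1.
Qed.

Lemma pulls_back_inversion (c : 'rV[R]_3) (r : R) : 0 < r -> pulls_back (inversion c r).
Proof.
move=> r0; have r20 : r ^+ 2 != 0 by rewrite expf_neq0// lt0r_neq0.
exists (r ^+ 4), (fun X => if X is Some x then
  if x == c then r ^+ 4 else dot (x - c) (x - c) else 1).
split=> [|[x|]|p q w].
- exact: exprn_gt0.
- have [_|xc] := eqVneq x c; first exact: (lt0r_neq0 (exprn_gt0 4 r0)).
  by rewrite dotvv_eq0 subr_eq0.
- exact: oner_neq0.
pose A := p + dot q c + w * dot c c; pose B := q + (2 * w) *: c.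
exists (A * dot c c - r ^+ 2 * dot B c + w * r ^+ 4), (r ^+ 2 *: B - (2 * A) *: c), A.
split.
  rewrite /sphere_disc /B /A !(dotDl, dotDr, dotZl, dotZr, dotNl, dotNr) ?(dotC c q).
  by move: (dot q q) (dot q c) (dot c c) => qq qc cc; ring.
case=> [x|] /=; last by rewrite mulr1.
have [->|xc] := eqVneq x c; rewrite /=.
  by rewrite /B /A !(dotDl, dotDr, dotZl, dotZr, dotNl, dotNr) ?(dotC c q); ring.
have v0 : dot (x - c) (x - c) != 0 by rewrite dotvv_eq0 subr_eq0.
have xE : x = c + (x - c) by rewrite addrC subrK.
move: (x - c) v0 xE => v v0 ->.
rewrite /B /A !(dotDl, dotDr, dotZl, dotZr, dotNl, dotNr) ?(dotC c q) ?(dotC v c).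
by move: (dot v v) v0 (dot q v) (dot q c) (dot c c) (dot c v) => V V0 a b d e; field.
Qed.

Lemma pulls_back_reflection (n : 'rV[R]_3) (a : R) : n != 0 -> pulls_back (reflection n a).
Proof.
move=> n0; have nn := lt0r_neq0 (dotvv_gt0 n0).
exists 1, (fun=> 1); split=> [|X|p q w]; [exact: ltr01|exact: oner_neq0|].
pose k := 2 * (dot q n + 2 * a * w) / dot n n.
exists (p + k * a), (q - k *: n), w; split.
  rewrite /sphere_disc /k !(dotDl, dotDr, dotZl, dotZr, dotNl, dotNr) ?(dotC n q).
  by move: (dot q q) (dot q n) (dot n n) nn => x y z z0; field.
case=> [x|] /=; last by rewrite mulr1.
rewrite mulr1 /k !(dotDl, dotDr, dotZl, dotZr, dotNl, dotNr) ?(dotC x n).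
by move: (dot q x) (dot q n) (dot n x) (dot x x) (dot n n) nn => b d e f N N0; field.
Qed.

Lemma moebius_pulls_back M : moebius M -> pulls_back M.
Proof.
elim=> [|c r N r0 _ IH|n a N n0 _ IH]; first exact: pulls_back_id.
- by apply: pulls_back_comp => //; exact: pulls_back_inversion.
- by apply: pulls_back_comp => //; exact: pulls_back_reflection.
Qed.

End SphereFunctions.

(** * Inequivalence of the models *)
Section Inequivalence.
Context {R : realType}.
Implicit Types (x u v P : 'rV[R]_3).

(** The linear form [dot u x + z * w] on the vectors [hom x w]. *)
Definition covec (u : 'rV[R]_3) (z : R) : 'cV[R]_4 := (col_mx u^T z%:M : 'cV_(3 + 1)).

Lemma hom_covec x (w : R) u z : (Defs.hom x w *m covec u z) 0 0 = dot u x + z * w.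
Proof.
rewrite /covec /Defs.hom (@mul_row_col R 1 3 1 1 x w%:M u^T z%:M) mul_scalar_mx !mxE eqxx mulr1n.
by rewrite [w * z]mulrC; congr (_ + _); apply: eq_bigr => i _; rewrite mxE mulrC.
Qed.

Lemma covec_surj (xi : 'cV[R]_4) : exists u z, xi = covec u z.
Proof.
exists (usubmx (xi : 'cV_(3 + 1)))^T, (dsubmx (xi : 'cV_(3 + 1)) 0 0).
by rewrite /covec trmxK -mx11_scalar vsubmxK.
Qed.

Lemma covec_eq0 u z : covec u z = 0 -> u = 0 /\ z = 0.
Proof.
move=> E; have := congr1 (fun c : 'cV_(3 + 1) => usubmx c) E.
have := congr1 (fun c : 'cV_(3 + 1) => dsubmx c) E.
rewrite /covec col_mxKu col_mxKd !raddf0 => z0 u0.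
split; first by rewrite -[u]trmxK u0 trmx0.
by have /matrixP/(_ 0 0) := z0; rewrite !mxE eqxx mulr1n.
Qed.

Lemma polyfun_sphere_ev p q w : polyfun (fun x : 'rV[R]_3 => sphere_ev p q w (Some x)).
Proof.
apply: polyfunD; first apply: polyfunD.
- exact: polyfun_cst.
- by apply: polyfun_sum => i; apply: polyfunM; [exact: polyfun_cst|exact: polyfun_coord].
- apply: polyfunM; first exact: polyfun_cst.
  by apply: polyfun_sum => i; apply: polyfunM; exact: polyfun_coord.
Qed.

Lemma polyfun_near_eq0 (F : 'rV[R]_3 -> R) P : polyfun F -> (\forall x \near P, F x = 0) ->
  forall x, F x = 0.
Proof.
move=> pF F0; apply: (polyfun_open_eq0 pF (@open_interior _ [set x | F x = 0])).
  by exists P; exact: F0.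
by move=> x; exact: interior_subset.
Qed.

Lemma sphere_ev_axis p q w (k : 'I_3) :
  (forall t : R, t != 0 -> sphere_ev p q w (Some (t *: e_ k)) = 0) ->
  [/\ p = 0, q 0 k = 0 & w = 0].
Proof.
move=> H; have E t : t != 0 -> p + t * q 0 k + w * t ^+ 2 = 0.
  by move=> /H; rewrite /sphere_ev dotZr dot_e dotZl dotZr dot_e mxE !eqxx mulr1 expr2.
have := E 1 (oner_neq0 _); have := E (-1); rewrite oppr_eq0 oner_neq0 => /(_ isT) h1 h2.
have := E 2; rewrite pnatr_eq0 => /(_ isT) h3.
by split; lra.
Qed.

Lemma sphere_ev_eq0 p q w :
  (forall x, x != 0 -> sphere_ev p q w (Some x) = 0) -> [/\ p = 0, q = 0 & w = 0].
Proof.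
move=> H.
have H' k t : t != 0 -> sphere_ev p q w (Some (t *: e_ k)) = 0.
  move=> t0; apply: H; rewrite scaler_eq0 negb_or t0 /=.
  by apply/eqP => /rowP/(_ k)/eqP; rewrite !mxE !eqxx oner_eq0.
have A k := sphere_ev_axis (H' k).
split; first by have [] := A 0.
  by apply/rowP => k; rewrite mxE; have [] := A k.
by have [] := A 0.
Qed.

(** The unknown factor [g] is eliminated by comparing the forms two by two: the
cross products [x_k ev (e_ i) = x_i ev (e_ k)] are polynomial identities, true
everywhere, so that [g] is a constant [be].  Hence the forms of the model are
pulled back to constant multiples of those of the other model. *)
Lemma sphere_ev_proportional (ep : R) P (r : 'rV[R]_3 -> R -> R * 'rV[R]_3 * R) :
  let ev u z x := sphere_ev (r u z).1.1 (r u z).1.2 (r u z).2 (Some x) in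
  (\forall x \near P, exists2 g, g != 0 &
     forall u z, (dot u x + z * (1 + ep * dot x x)) * g = ev u z x) ->
  exists2 be, be != 0 & forall u z,
    r u z = (be * z, be *: u, be * (ep * z)).
Proof.
move=> ev H.
have pev u z : polyfun (ev u z) by exact: polyfun_sphere_ev.
have cross (i k : 'I_3) x : x 0 k * ev (e_ i) 0 x = x 0 i * ev (e_ k) 0 x.
  apply/eqP; rewrite -subr_eq0; apply/eqP; move: x.
  apply: (@polyfun_near_eq0 _ P).
    by apply: polyfunB; apply: polyfunM => //; exact: polyfun_coord.
  apply: filterS H => x [g g0 E]; rewrite -!E !mul0r !addr0 ![dot (e_ _) x]dotC !dot_e.
  by ring.
have axis i k t : i != k -> t != 0 -> ev (e_ i) 0 (t *: e_ k) = 0.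
  move=> ik t0; have := cross i k (t *: e_ k).
  rewrite !mxE !eqxx (negbTE ik) /= mulr1 mulr0 mul0r => /eqP.
  by rewrite mulf_eq0 (negbTE t0) => /eqP.
have r0 i k : i != k -> [/\ (r (e_ i) 0).1.1 = 0, (r (e_ i) 0).1.2 0 k = 0 & (r (e_ i) 0).2 = 0].
  by move=> ik; apply: sphere_ev_axis => t; exact: axis.
pose b i := (r (e_ i) 0).1.2 0 i.
have evi i x : ev (e_ i) 0 x = b i * x 0 i.
  have [k ik] : exists k, i != k.
    by exists (other i); rewrite /other; case: ifP => [/eqP->//|/negbT].
  have [p0 _ w0] := r0 i k ik; rewrite /ev /sphere_ev p0 w0 mul0r add0r addr0.
  rewrite /dot (bigD1 i)//= big1 ?addr0// => l li.
  have il : i != l by rewrite eq_sym.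
  by have [_ -> _] := r0 i l il; rewrite mul0r.
have bb i k : b i = b k.
  have := cross i k (const_mx 1); rewrite !evi !mxE; lra.
have rE u z : r u z = (b 0 * z, b 0 *: u, b 0 * (ep * z)).
  pose D x := sphere_ev ((r u z).1.1 - b 0 * z) ((r u z).1.2 - b 0 *: u)
    ((r u z).2 - b 0 * (ep * z)) (Some x).
  have DE x : D x = ev u z x - b 0 * (dot u x + z * (1 + ep * dot x x)).
    by rewrite /D /ev /sphere_ev dotDl dotNl dotZl; ring.
  have xD i x : x 0 i * D x = 0.
    move: x; apply: (@polyfun_near_eq0 _ P).
      by apply: polyfunM; [exact: polyfun_coord|exact: polyfun_sphere_ev].
    apply: filterS H => x [g g0 E]; rewrite DE -E.
    have := E (e_ i) 0; rewrite mul0r addr0 dotC dot_e evi (bb i 0) => Ei.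
    move: (dot u x + _) => s.
    transitivity (s * (x 0 i * g - b 0 * x 0 i)); first by ring.
    by rewrite Ei subrr mulr0.
  have : forall x, x != 0 -> D x = 0.
    move=> x x0; apply: contrapT => /eqP Dx; move/eqP: x0; apply.
    by apply/rowP => i; have /eqP := xD i x; rewrite mulf_eq0 (negbTE Dx) orbF mxE => /eqP.
  move=> /sphere_ev_eq0[/eqP + /eqP + /eqP]; rewrite !subr_eq0.
  by case: (r u z) => [[p' q'] w'] /= /eqP -> /eqP -> /eqP ->.
exists (b 0); last exact: rE.
have [g g0 E] := nbhs_singleton H; apply/eqP => b0.
have E0 u z : dot u P + z * (1 + ep * dot P P) = 0.
  have := E u z; rewrite /ev rE b0 !mul0r scale0r /sphere_ev /= dot0l mul0r !addr0.
  by move=> /eqP; rewrite mulf_eq0 (negbTE g0) orbF => /eqP.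
have P0 : P = 0 by apply/rowP => i; have := E0 (e_ i) 0; rewrite mul0r addr0 dotC dot_e mxE.
by have := E0 0 1; rewrite P0 !dot0l mulr0 addr0 add0r mulr1 => /eqP; rewrite oner_eq0.
Qed.

(** The restriction of [sphere_disc] to the linear forms of the model: definite,
degenerate or Lorentzian according to the sign of [ep]. *)
Definition form (ep : R) u z : R := dot u u - 4%:R * ep * z ^+ 2.

(** The value at [(0, 1)] is [- 4 * ep]: a negative vector must go to a negative
one, and an isotropic one to an isotropic one. *)
Lemma form_signature (ep ep' m : R) (f : 'rV[R]_3 -> R -> 'rV[R]_3 * R) : 0 < m ->
  (forall u z, f u z = (0, 0) -> u = 0 /\ z = 0) ->
  (forall u z, form ep' (f u z).1 (f u z).2 = m * form ep u z) ->
  (0 < ep -> 0 < ep') /\ (ep = 0 -> 0 <= ep').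
Proof.
move=> m0 finj fE.
have F : form ep 0 1 = - 4 * ep by rewrite /form dot0l expr1n; ring.
have := fE 0 1; have := finj 0 1; rewrite F; case: (f 0 1) => u z /= inj.
rewrite /form => h; have uu := dotvv_ge0 u; have zz := sqr_ge0 z; split=> e0.
  rewrite ltNge; apply/negP => e'0.
  have h1 : 0 <= (- ep') * z ^+ 2 by rewrite mulr_ge0// oppr_ge0.
  have h2 : 0 < m * ep by rewrite mulr_gt0.
  by lra.
rewrite leNgt; apply/negP => e'0.
have h1 : 0 <= (- ep') * z ^+ 2 by rewrite mulr_ge0// oppr_ge0 ltW.
rewrite e0 mulr0 mulr0 in h.
have u0 : dot u u = 0 by lra.
have z0 : ep' * z ^+ 2 = 0 by lra.
have [_] : 0 = 0 :> 'rV[R]_3 /\ 1 = 0 :> R.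
  apply: inj; congr (_, _); first by apply/eqP; rewrite -dotvv_eq0 u0.
  by move/eqP: z0; rewrite mulf_eq0 (lt_eqF e'0) expf_eq0 /= => /eqP.
by move=> /eqP; rewrite oner_eq0.
Qed.

(** The transpose of the projective map acts on linear forms, and followed by
the pullback of sphere functions by the Moebius map it is a constant multiple of
the identity ([sphere_ev_proportional]); so it scales the discriminant. *)
Lemma equivalent_form (j k : 'I_3) P : equivalent_at P (Phi_ j) (Phi_ k) ->
  exists2 A : 'M[R]_4, A \in unitmx & exists2 m, 0 < m &
  forall u z u' z', A *m covec u z = covec u' z' ->
    form (eps k) u' z' = m * form (eps j) u z.
Proof.
move=> [T [M [[A uA TA] mM _ H]]]; exists A => //.
have [mu [t [mu0 t0 pull]]] := moebius_pulls_back mM.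
have vec u z : exists uz : 'rV[R]_3 * R, A *m covec u z = covec uz.1 uz.2.
  by have [u' [z' E]] := covec_surj (A *m covec u z); exists (u', z').
have [f fE] := choice (fun uz : 'rV[R]_3 * R => vec uz.1 uz.2).
have res u z : exists r : R * 'rV[R]_3 * R,
   sphere_disc r.1.1 r.1.2 r.2 = mu * form (eps k) (f (u, z)).1 (f (u, z)).2 /\
   forall X, sphere_ev (f (u, z)).2 (f (u, z)).1 (eps k * (f (u, z)).2) (M X) * t X =
             sphere_ev r.1.1 r.1.2 r.2 X.
  have [p [q [w [D E]]]] := pull (f (u, z)).2 (f (u, z)).1 (eps k * (f (u, z)).2).
  exists (p, q, w); split=> //=; rewrite D /sphere_disc /form; congr (_ * _); ring.
have [r rE] := choice (fun uz : 'rV[R]_3 * R => res uz.1 uz.2).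
have [|be be0 rbe] := @sphere_ev_proportional (eps j) P (fun u z => r (u, z)).
  apply: filterS H => x [y My PE].
  have [s s0 sE] : exists2 s, s != 0 & Defs.hom x (1 + eps j * dot x x)
      = s *: (Defs.hom y (1 + eps k * dot y y) *m A).
    have := congr1 val PE; rewrite TA !val_Phi limg_line lfunE /= => VE.
    have : Defs.hom x (1 + eps j * dot x x) \in <[Defs.hom y (1 + eps k * dot y y) *m A]>%VS.
      by rewrite -VE memv_line.
    move=> /vlineP[s sE]; exists s => //; apply/eqP => s0.
    move: sE; rewrite s0 scale0r => /eqP; rewrite hom_eq0 => /andP[/eqP ->].
    by rewrite dot0l mulr0 addr0 oner_eq0.
  exists (t (Some x) / s); first by rewrite mulf_neq0// invr_eq0.
  move=> u z; have [_ /(_ (Some x))] := rE (u, z); rewrite My => E.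
  apply: etrans _ E; rewrite /=.
  rewrite -(hom_covec x _ u z) sE -scalemxAl -mulmxA (fE (u, z)) /= mxE hom_covec.
  move: (f (u, z)).1 (f (u, z)).2 (t _) => u' z' tx; rewrite /=.
  by field.
exists (be ^+ 2 / mu); first by rewrite divr_gt0// exprn_even_gt0.
move=> u z u' z' E; have [D _] := rE (u, z).
have [eu ez] : (f (u, z)).1 = u' /\ (f (u, z)).2 = z'.
  have : covec ((f (u, z)).1 - u') ((f (u, z)).2 - z') = 0.
    have -> : covec ((f (u, z)).1 - u') ((f (u, z)).2 - z')
       = covec (f (u, z)).1 (f (u, z)).2 - covec u' z'.
      rewrite /covec; apply/matrixP => i l; rewrite !mxE.
      by case: (splitP _) => ? _; rewrite !mxE ?mulrnBl.
    by rewrite -(fE (u, z)) /= -E subrr.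
  by move=> /covec_eq0[/eqP + /eqP]; rewrite !subr_eq0 => /eqP -> /eqP ->.
move: D; rewrite /= rbe /= eu ez => D; apply: (mulfI (lt0r_neq0 mu0)); rewrite -D.
rewrite /sphere_disc /form dotZl dotZr; field; exact: lt0r_neq0.
Qed.

Lemma eps_inj (j k : 'I_3) : (0 < @eps R j <-> 0 < @eps R k) ->
  (@eps R j = 0 <-> @eps R k = 0) -> j = k.
Proof.
have n1 : (-1 == 0 :> R) = false by rewrite oppr_eq0 oner_eq0.
move: j k; do 2![apply: all3]; rewrite /eps /tnth //= => -[h1 h2] [h3 h4]; exfalso.
- by have /eqP := h4 erefl; rewrite n1.
- by have := h2 ltr01; rewrite ltr0N1.
- by have /eqP := h3 erefl; rewrite n1.
- by have := h2 ltr01; rewrite ltxx.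
- by have := h1 ltr01; rewrite ltr0N1.
- by have := h1 ltr01; rewrite ltxx.
Qed.

(** The comparison of signatures applies to the linear map and to its inverse. *)
Lemma models_inequivalent (j k : 'I_3) P : j <> k -> ~ equivalent_at P (Phi_ j) (Phi_ k).
Proof.
move=> jk /equivalent_form[A uA [m m0 H]]; apply: jk.
have vec (B : 'M[R]_4) u z : exists uz : 'rV[R]_3 * R, B *m covec u z = covec uz.1 uz.2.
  by have [u' [z' E]] := covec_surj (B *m covec u z); exists (u', z').
have [f fE] := choice (fun uz : 'rV[R]_3 * R => vec A uz.1 uz.2).
have [g gE] := choice (fun uz : 'rV[R]_3 * R => vec (invmx A) uz.1 uz.2).
have c0 : covec 0 0 = 0.
  by rewrite /covec trmx0 raddf0 col_mx0.
have fA uz : (f uz).1 = 0 /\ (f uz).2 = 0 -> uz.1 = 0 /\ uz.2 = 0.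
  move=> [f1 f2]; have := fE uz; rewrite f1 f2 c0 => E.
  by apply: covec_eq0; rewrite -(mulKmx uA (covec _ _)) E mulmx0.
have gA uz : (g uz).1 = 0 /\ (g uz).2 = 0 -> uz.1 = 0 /\ uz.2 = 0.
  move=> [f1 f2]; have := gE uz; rewrite f1 f2 c0 => E.
  by apply: covec_eq0; rewrite -(mulKVmx uA (covec _ _)) E mulmx0.
have [|u z|s1 s2] := @form_signature (eps j) (eps k) m (fun u z => f (u, z)) m0.
- by move=> u z fuz; apply: (fA (u, z)); rewrite fuz.
- exact: H (fE (u, z)).
have mi0 : 0 < m^-1 by rewrite invr_gt0.
have [|u z|s3 s4] := @form_signature (eps k) (eps j) m^-1 (fun u z => g (u, z)) mi0.
- by move=> u z fuz; apply: (gA (u, z)); rewrite fuz.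
- have E : A *m covec (g (u, z)).1 (g (u, z)).2 = covec u z.
    by rewrite -(gE (u, z)) mulKVmx.
  by rewrite (H _ _ _ _ E) mulKf// lt0r_neq0.
apply: eps_inj; first by split.
split=> e0; apply/eqP; rewrite eq_le; apply/andP; split.
- by rewrite leNgt; apply/negP => /s3; rewrite e0 ltxx.
- exact: s2.
- by rewrite leNgt; apply/negP => /s1; rewrite e0 ltxx.
- exact: s4.
Qed.

End Inequivalence.

(** * Circles mapped into lines by the models *)
Section GeodesicCircles.
Context {R : realType}.
Implicit Types (x v Q : 'rV[R]_3).

Lemma dim_two_lines n (u1 u2 : 'rV[R]_n) : (forall a b, a *: u1 + b *: u2 = 0 -> a = 0 /\ b = 0) ->
  \dim (<[u1]> + <[u2]>) = 2.
Proof.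
move=> ind.
have u10 : u1 != 0.
  apply/eqP => z; have := ind 1 0; rewrite z scaler0 scale0r addr0 => /(_ erefl)[/eqP].
  by rewrite oner_eq0.
have u20 : u2 != 0.
  apply/eqP => z; have := ind 0 1; rewrite z scaler0 scale0r addr0 => /(_ erefl)[_ /eqP].
  by rewrite oner_eq0.
rewrite dimv_disjoint_sum ?dim_vline ?u10 ?u20//.
apply/eqP; rewrite -subv0; apply/subvP => x /memv_capP[/vlineP[a ->] /vlineP[b E]].
have [|-> _] := ind a (- b); first by rewrite E scaleNr subrr.
by rewrite scale0r mem0v.
Qed.

Lemma mem_two_lines n (u1 u2 : 'rV[R]_n) a b : a *: u1 + b *: u2 \in (<[u1]> + <[u2]>)%VS.
Proof. by apply: memv_add; apply: memvZ; exact: memv_line. Qed.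

Lemma homD x y (w z : R) : Defs.hom (x + y) (w + z) = Defs.hom x w + Defs.hom y z.
Proof. by rewrite /Defs.hom raddfD /= (@add_row_mx R 1 3 1 x w%:M y z%:M). Qed.

Lemma homZ (a : R) x (w : R) : Defs.hom (a *: x) (a * w) = a *: Defs.hom x w.
Proof. by rewrite /Defs.hom (@scale_row_mx R 1 3 1) scale_scalar_mx. Qed.

(** Cramer's rule for [x] in the plane of [Q] and [v], whose Gram determinant is
[G]. *)
Lemma plane_span Q v x : let G := dot Q Q * dot v v - dot Q v ^+ 2 in
  dot (cross Q v) x = 0 ->
  G *: x = (dot v v * dot x Q - dot Q v * dot x v) *: Q
         + (dot Q Q * dot x v - dot Q v * dot x Q) *: v.
Proof.
move=> G nx.
suff -> : G *: x = (dot v v * dot x Q - dot Q v * dot x v) *: Q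
         + (dot Q Q * dot x v - dot Q v * dot x Q) *: v + dot (cross Q v) x *: cross Q v.
  by rewrite nx scale0r addr0.
by rewrite /G; apply: row3P; rewrite !dotE !mxE /=; ring.
Qed.

Definition rectified_by (j : 'I_3) (S : set 'rV[R]_3) :=
  is_circle S /\ exists L, \dim L = 2 /\ forall x, S x -> on_line L (Phi_ j x).

Lemma on_line_Phi j (L : {vspace 'rV[R]_4}) x : \dim L = 2 ->
  Defs.hom x (1 + eps j * dot x x) \in L -> on_line L (Phi_ j x).
Proof. by move=> dL xL; split=> //; rewrite val_Phi -memvE. Qed.

Lemma line_tangent Q v : v != 0 ->
  tangent_direction [set x | exists t : R, x = Q + t *: v] Q v.
Proof.
move=> v0; apply: (@arc_tangent _ _ _ _ 0) => // t.
rewrite /circ_arc dot0l mul0r mulr0 addr0 invr1 scale1r scaler0 addr0.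
by exists t.
Qed.

Lemma geodesic_line j Q v (u1 u2 : 'rV[R]_4) : v != 0 ->
  (forall a b, a *: u1 + b *: u2 = 0 -> a = 0 /\ b = 0) ->
  (forall t, exists a b, Defs.hom (Q + t *: v)
      (1 + eps j * dot (Q + t *: v) (Q + t *: v)) = a *: u1 + b *: u2) ->
  exists2 S, rectified_by j S & S Q /\ tangent_direction S Q v.
Proof.
move=> v0 ind H; have dL := dim_two_lines ind.
exists [set x | exists t : R, x = Q + t *: v]; last first.
  by split; [exists 0; rewrite scale0r addr0|exact: line_tangent].
split; first by left; exists Q, v.
exists (<[u1]> + <[u2]>)%VS; split=> // _ [t ->]; apply: on_line_Phi => //.
by have [a [b ->]] := H t; exact: mem_two_lines.
Qed.

(** The image line must join the image of [Q] to the direction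
[(v, 2 eps (dot Q v))] of the derivative.  If [Q] and [v] are independent, its
points are the [(x, dot e x)] with [x] in the plane of [Q] and [v], where [e] is
determined by the values [p] and [q].  The circle is therefore the section of
that plane by the sphere [1 + eps (dot x x) = dot e x], of center [eps e / 2].
If [eps = 0], or if [v] is parallel to [Q], it is the line itself. *)
Lemma geodesic_circle j Q v : 1 - eps j * dot Q Q != 0 -> v != 0 ->
  exists2 S, rectified_by j S & S Q /\ tangent_direction S Q v.
Proof.
move=> rho v0; have vv := dotvv_gt0 v0.
have hom0 x (w : R) : Defs.hom x w = 0 -> x = 0 /\ w = 0.
  by move/eqP; rewrite hom_eq0 => /andP[/eqP ? /eqP ?].
have [e0|en0] := eqVneq (@eps R j) 0.
  apply: (@geodesic_line j Q v (Defs.hom Q 1) (Defs.hom v 0)) => // [a b|t].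
    rewrite -!homZ -homD mulr0 addr0 mulr1 => /hom0[+ a0]; rewrite a0 scale0r add0r => /eqP.
    by rewrite scaler_eq0 (negbTE v0) orbF => /eqP.
  by exists 1, t; rewrite e0 mul0r scale1r -homZ -homD mulr0.
have e2 : @eps R j ^+ 2 = 1.
  by move: en0; move: j {rho}; apply: all3; rewrite /eps /tnth /= ?eqxx// ?sqrrN expr1n.
pose G := dot Q Q * dot v v - dot Q v ^+ 2.
have nG : dot (cross Q v) (cross Q v) = G by exact: dot_cross_cross.
have [G0|Gn0] := eqVneq G 0.
  have n0 : cross Q v = 0 by apply/eqP; rewrite -dotvv_eq0 nG G0.
  have [mu QE] : exists mu, Q = mu *: v.
    exists (dot Q v / dot v v); apply/eqP; rewrite -subr_eq0 -dotvv_eq0.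
    rewrite !(dotDl, dotDr, dotNl, dotNr, dotZl, dotZr) (dotC v Q).
    move: G0; rewrite /G; move: (dot v v) (lt0r_neq0 vv) => V V0 E.
    apply/eqP; apply: (mulIf V0); rewrite mul0r -[RHS]E; by field.
  apply: (@geodesic_line j Q v (Defs.hom v 0) (Defs.hom 0 1)) => // [a b|t].
    rewrite -!homZ -homD scaler0 addr0 mulr0 add0r mulr1 => /hom0[/eqP + ->].
    by rewrite scaler_eq0 (negbTE v0) orbF => /eqP ->.
  exists (mu + t), (1 + eps j * dot (Q + t *: v) (Q + t *: v)).
  by rewrite -!homZ -homD scaler0 addr0 mulr0 add0r mulr1 {1}QE -scalerDl.
pose p := 1 + eps j * dot Q Q; pose q := 2 * eps j * dot Q v.
pose e := ((dot v v * p - dot Q v * q) / G) *: Q + ((dot Q Q * q - dot Q v * p) / G) *: v.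
have eQ : dot e Q = p.
  rewrite /e dotDl !dotZl (dotC v Q); move: Gn0; rewrite /G; move: (dot Q Q) (dot v v) (dot Q v) (p) (q).
  by move=> a b c p' q' g; field.
have ev : dot e v = q.
  rewrite /e dotDl !dotZl; move: Gn0; rewrite /G; move: (dot Q Q) (dot v v) (dot Q v) (p) (q).
  by move=> a b c p' q' g; field.
pose m := (eps j / 2) *: e; pose n := cross Q v.
have nQ : dot n Q = 0 by rewrite dotC dot_crossl.
have nv : dot n v = 0 by rewrite dotC dot_crossr.
have nm : dot n m = 0 by rewrite /m dotZr /e dotDr !dotZr nQ nv; ring.
have n0 : n != 0 by rewrite -dotvv_eq0 nG.
clearbody e.
have mQ : dot (Q - m) v = 0.
  rewrite dotDl dotNl /m dotZl ev /q.
  transitivity (dot Q v * (1 - eps j ^+ 2)); [by field|by rewrite e2 subrr mulr0].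
have r0 : 0 < dot (Q - m) (Q - m).
  apply: dotvv_gt0; apply/eqP => /eqP; rewrite subr_eq0 => /eqP Qm.
  have : dot Q Q = dot m Q by rewrite -Qm.
  rewrite /m dotZl eQ /p => E; move/eqP: rho; apply.
  have E2 : eps j * dot Q Q = (1 + eps j * dot Q Q) / 2.
    transitivity (eps j ^+ 2 * ((1 + eps j * dot Q Q) / 2)); last by rewrite e2 mul1r.
    by rewrite {1}E; field.
  lra.
set r := Num.sqrt (dot (Q - m) (Q - m)).
have r2 : r ^+ 2 = dot (Q - m) (Q - m) by rewrite sqr_sqrtr// ltW.
have rp : 0 < r by rewrite sqrtr_gt0.
have nQm : dot n (Q - m) = 0 by rewrite dotDr dotNr nQ nm subrr.
exists [set x | dot (x - m) (x - m) = r ^+ 2 /\ dot n (x - m) = 0]; last first.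
  split; first by [].
  have [w _ H] := proper_circle_arc rp (esym r2) nQm nv mQ v0.
  exact: arc_tangent v0 H.
split; first by right; exists m, n, r.
exists (<[Defs.hom Q p]> + <[Defs.hom v q]>)%VS.
have dL : \dim (<[Defs.hom Q p]> + <[Defs.hom v q]>) = 2.
  apply: dim_two_lines => a b; rewrite -!homZ -homD => /hom0[E _].
  have := congr1 (fun z => dot z Q) E; have := congr1 (fun z => dot z v) E.
  rewrite !dot0l !dotDl !dotZl (dotC v Q) => E1 E2.
  have aG : a * G = dot v v * (a * dot Q Q + b * dot Q v) - dot Q v * (a * dot Q v + b * dot v v).
    by rewrite /G; ring.
  have bG : b * G = dot Q Q * (a * dot Q v + b * dot v v) - dot Q v * (a * dot Q Q + b * dot Q v).
    by rewrite /G; ring.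
  by split; apply: (mulIf Gn0); rewrite ?aG ?bG E1 E2; ring.
split=> // x [Sx nx]; apply: on_line_Phi => //.
have nx0 : dot n x = 0 by move: nx; rewrite dotDr dotNr nm subr0.
have ex : dot e x = 1 + eps j * dot x x.
  have : dot x x - eps j * dot e x = dot Q Q - eps j * dot e Q.
    move: Sx; rewrite r2 /m !(dotDl, dotDr, dotNl, dotNr, dotZl, dotZr) (dotC x e) (dotC Q e).
    by move=> h; lra.
  rewrite eQ /p => h.
  have : eps j * (dot x x - eps j * dot e x) = eps j * (dot Q Q - eps j * (1 + eps j * dot Q Q)).
    by rewrite h.
  rewrite !mulrBr !mulrA -expr2 e2 !mul1r => h'; lra.
have xE : x = ((dot v v * dot x Q - dot Q v * dot x v) / G) *: Q
         + ((dot Q Q * dot x v - dot Q v * dot x Q) / G) *: v.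
  apply: (scalerI Gn0); rewrite plane_span// scalerDr !scalerA.
  by congr (_ *: _ + _ *: _); field.
rewrite -ex {2}xE dotDr !dotZr eQ ev {1}xE homD !homZ.
exact: mem_two_lines.
Qed.

End GeodesicCircles.

(** * The models are local diffeomorphisms that rectify rich families *)
Section ModelCharts.
Context {R : realType}.
Implicit Types (x v P : 'rV[R]_3).
Variable j : 'I_3.
Local Notation ep := (@eps R j).

Definition hvec x : 'rV[R]_4 := Defs.hom x (1 + ep * dot x x).
Definition rho x : R := 1 - ep * dot x x.

Lemma vpick_proportional (p : RP3 R) (v : 'rV[R]_4) : val p = <[v]>%VS ->
  exists2 k, k != 0 & vpick (val p) = k *: v.
Proof.
move=> pv; have := memv_pick (val p); rewrite {2}pv => /vlineP[k kE].
exists k => //; apply/eqP => k0; have := valP p; rewrite /= vpick_line kE k0 scale0r.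
by rewrite dim_vline eqxx.
Qed.

Lemma in_chart_Phi i x : in_chart i (Phi_ j x) = (hvec x 0 i != 0).
Proof.
have [k k0 E] := vpick_proportional (val_Phi j x).
by rewrite /in_chart E mxE mulf_eq0 (negbTE k0).
Qed.

Lemma chart_Phi i x l : chart i (Phi_ j x) 0 l = hvec x 0 (lift i l) / hvec x 0 i.
Proof.
have [k k0 E] := vpick_proportional (val_Phi j x).
by rewrite /chart mxE E !mxE -mulf_div divff// mul1r.
Qed.

Lemma Cinf_hvec (i : 'I_4) U : open U -> Cinf U (fun x => hvec x 0 i).
Proof.
move=> oU k; have [l ->|l ->] := @split_ordP 3 1 i.
  have -> : (fun x => hvec x 0 (lshift 1 l)) = (fun x => x 0 l).
    by apply/funext => x; rewrite /hvec /Defs.hom (@row_mxEl R 1 3 1).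
  exact: Cn_coord.
have -> : (fun x => hvec x 0 (rshift 3 l)) = (fun x => 1 + ep * dot x x).
  by apply/funext => x; rewrite /hvec /Defs.hom (@row_mxEr R 1 3 1) ord1 mxE eqxx.
apply: CnD => //; first exact: Cn_cst.
by apply: CnM => //; [exact: Cn_cst|exact: Cn_dotvv].
Qed.

(** For [eps = 1] and [P] on the unit sphere: the model takes the same value at
[t P] and [P / t]. *)
Lemma hvec_inverse P (t : R) : t != 0 -> ep * dot P P = 1 ->
  hvec (t^-1 *: P) = t ^- 2 *: hvec (t *: P).
Proof.
move=> t0 e; rewrite /hvec -homZ scalerA; congr Defs.hom.
  by congr (_ *: _); field.
rewrite !(dotZl, dotZr); transitivity (1 + t^-1 * t^-1 * (ep * dot P P)); first by ring.
by transitivity (t ^- 2 * (1 + t * t * (ep * dot P P))); [rewrite e; field|ring].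
Qed.

(** At a point with [rho P = 0] the curves [t P] and [P / t] have opposite velocities
at [t = 1] and the same image, so the derivative in the direction [P] vanishes. *)
Lemma jacobian_rho P : nonzero_jacobian (Phi_ j) P -> rho P != 0.
Proof.
move=> [i iP [df dJ]]; apply/eqP => r0.
have e : ep * dot P P = 1 by move: r0; rewrite /rho; lra.
have P0 : P != 0.
  by apply/eqP => z; move: e; rewrite z dot0l mulr0 => /esym/eqP; rewrite oner_eq0.
have D0 : 'D_P (fun x => chart i (Phi_ j x)) P = 0.
  apply/rowP => l; rewrite -derive_coord; last exact: diff_derivable.
  pose h x := chart i (Phi_ j x) 0 l.
  have dh : differentiable h P by exact: differentiable_row_coord.
  have d1 : is_derive (1 : R) (1 : R) (fun t : R => h (t *: P)) ('D_P h P).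
    have ds := is_diff_scalel (1 : R) P.
    have dy : is_derive (1 : R) (1 : R) (fun t : R => t *: P) P.
      case: ds => ds Ds; apply: DeriveDef; first exact: diff_derivable.
      by rewrite (deriveE _ ds) Ds /= scale1r.
    have := @is_derive_comp _ _ h (fun t : R => t *: P) 1 P; rewrite scale1r => H.
    exact: H.
  have d2 : is_derive (1 : R) (1 : R) (fun t : R => h (t^-1 *: P)) ('D_(- P) h P).
    have dy : is_derive (1 : R) (1 : R) (fun t : R => t^-1 *: P) (- P).
      apply/is_derive_row => k.
      have -> : (fun t : R => (t^-1 *: P) 0 k) = (fun t : R => t^-1 * P 0 k).
        by apply/funext => t; rewrite mxE.
      have n1 : (1 : R) != 0 by exact: oner_neq0.
      have -> : (- P) 0 k = - P 0 k by rewrite mxE.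
      have dV : is_derive (1 : R) (1 : R) (fun t : R => t^-1) (- 1).
        apply: is_derive_eq (is_deriveV n1 (is_derive_id (1 : R) (1 : R))) _.
        by rewrite expr1n invr1 /GRing.scale /= mulr1.
      by apply: is_derive_eq; rewrite /GRing.scale /=; ring.
    have := @is_derive_comp _ _ h (fun t : R => t^-1 *: P) 1 (- P); rewrite invr1 scale1r => H.
    exact: H.
  have hh : \forall t \near (1 : R), h (t *: P) = h (t^-1 *: P).
    have n1 : \forall t \near (1 : R), t != 0.
      have c : {for (1 : R), continuous (fun t : R => t)} by exact: cvg_id.
      by exact: (cvgr_neq0 _ c (oner_neq0 R)).
    apply: filterS n1 => t t0; rewrite /h !chart_Phi hvec_inverse// !mxE.
    by rewrite -mulf_div divff ?mul1r// invr_eq0 expf_neq0.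
  have E : 'D_P h P = 'D_(- P) h P.
    have [_ <-] := d1; have [_ <-] := d2; exact: near_eq_derive.
  have N : 'D_(- P) h P = - 'D_P h P.
    by rewrite !(derive_sum_e _ dh) -sumrN; apply: eq_bigr => k _; rewrite mxE scaleNr.
  have EN : 'D_P h P = - 'D_P h P := etrans E N.
  by rewrite mxE; apply/eqP; rewrite -eqNr; apply/eqP/esym.
move/eqP: P0; apply.
have uJ : jacobian (fun x => chart i (Phi_ j x)) P \in unitmx by rewrite unitmxE unitfE.
by rewrite -(mulmxK uJ P) -deriveEjacobian// D0 mul0mx.
Qed.

Lemma open_positive (U : set 'rV[R]_3) (h : 'rV[R]_3 -> R) : open U ->
  (forall x, U x -> {for x, continuous h}) -> open (U `&` [set x | 0 < h x]).
Proof.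
move=> oU ch; rewrite openE => x [Ux hx]; apply: filterI; first exact: open_nbhs_nbhs.
exact: (cvgr_gt (h x) (ch x Ux) _ hx).
Qed.

(** The homogeneous coordinates of the point with chart coordinates [u], split as
[hom (proj_u i u) (proj_w i u)]. *)
Definition proj_u i u : 'rV[R]_3 := lsubmx (lift_chart i u : 'rV[R]_(3 + 1)).
Definition proj_w i u : R := rsubmx (lift_chart i u : 'rV[R]_(3 + 1)) 0 0.

Lemma lift_chart_hom i u : lift_chart i u = Defs.hom (proj_u i u) (proj_w i u).
Proof. by rewrite /Defs.hom -mx11_scalar hsubmxK. Qed.

Lemma Cinf_lift_chart_id i (a : 'I_4) U : open U -> Cinf U (fun u : 'rV[R]_3 => lift_chart i u 0 a).
Proof. by move=> oU; apply: (@Cinf_lift_chart R i U id a oU) => l k; exact: Cn_coord. Qed.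

Lemma Cinf_proj_u i l U : open U -> Cinf U (fun u => proj_u i u 0 l).
Proof.
move=> oU; have -> : (fun u => proj_u i u 0 l) = (fun u => lift_chart i u 0 (lshift 1 l)).
  by apply/funext => u; rewrite mxE.
exact: Cinf_lift_chart_id.
Qed.

Lemma Cinf_proj_w i U : open U -> Cinf U (proj_w i).
Proof.
move=> oU; have -> : proj_w i = (fun u => lift_chart i u 0 (rshift 3 0)).
  by apply/funext => u; rewrite /proj_w mxE.
exact: Cinf_lift_chart_id.
Qed.

(** To invert the model one looks for [la] such that [x = la y] satisfies
[1 + eps (dot x x) = la w], where [(y, w)] are the homogeneous coordinates.  The
roots of this quadratic equation are [la = 2 / den], one for each sign [sg]. *)
Definition discr i u : R := proj_w i u ^+ 2 - 4 * ep * dot (proj_u i u) (proj_u i u).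
Definition den i (sg : R) u : R := proj_w i u + sg * Num.sqrt (discr i u).
Definition inv_chart i sg u : 'rV[R]_3 := (2 / den i sg u) *: proj_u i u.

Lemma Cinf_discr i U : open U -> Cinf U (discr i).
Proof.
move=> oU k; apply: CnB => //.
  by apply: CnM => //; exact: Cinf_proj_w.
apply: CnM => //; first exact: Cn_cst.
by apply: Cn_sum => // l _; apply: CnM => //; exact: Cinf_proj_u.
Qed.

Lemma Cinf_den i sg U : open U -> (forall u, U u -> 0 < discr i u) -> Cinf U (den i sg).
Proof.
move=> oU dU k; apply: CnD => //; first exact: Cinf_proj_w.
apply: CnM => //; first exact: Cn_cst.
by apply: Cn_sqrt => //; exact: Cinf_discr.
Qed.

Lemma Cinf_inv_chart i sg U l : open U -> (forall u, U u -> 0 < discr i u) ->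
  (forall u, U u -> den i sg u != 0) -> Cinf U (fun u => inv_chart i sg u 0 l).
Proof.
move=> oU dU nU k.
have -> : (fun u => inv_chart i sg u 0 l) = (fun u => 2 * (den i sg u)^-1 * proj_u i u 0 l).
  by apply/funext => u; rewrite mxE.
apply: CnM => //; last exact: Cinf_proj_u.
apply: CnM => //; first exact: Cn_cst.
by apply: CnV => //; exact: Cinf_den.
Qed.

Lemma chart_invK i sg u : sg ^+ 2 = 1 -> 0 <= discr i u -> den i sg u != 0 ->
  hvec (inv_chart i sg u) = (2 / den i sg u) *: lift_chart i u.
Proof.
move=> sg2 d0 n0; rewrite lift_chart_hom -homZ /hvec; congr Defs.hom.
have s2 := sqr_sqrtr d0; set s := Num.sqrt (discr i u) in s2.
rewrite /inv_chart dotZl dotZr.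
have key : den i sg u ^+ 2 + 4 * ep * dot (proj_u i u) (proj_u i u) = 2 * proj_w i u * den i sg u.
  have -> : 4 * ep * dot (proj_u i u) (proj_u i u) = proj_w i u ^+ 2 - s ^+ 2.
    by rewrite s2 /discr; ring.
  rewrite /den -/s sqrrD exprMn sg2; ring.
apply: (mulIf (mulf_neq0 n0 n0)); rewrite -expr2.
transitivity (den i sg u ^+ 2 + 4 * ep * dot (proj_u i u) (proj_u i u)).
  by move: (dot _ _) => D; field.
by rewrite key; field.
Qed.

Lemma chart_inv i sg u : sg ^+ 2 = 1 -> 0 <= discr i u -> den i sg u != 0 ->
  chart i (Phi_ j (inv_chart i sg u)) = u.
Proof.
move=> sg2 d0 n0; apply/rowP => l; rewrite chart_Phi chart_invK// !mxE unlift_none liftK mulr1.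
by field.
Qed.

Lemma lift_chart_Phi i x : hvec x 0 i != 0 ->
  lift_chart i (chart i (Phi_ j x)) = (hvec x 0 i)^-1 *: hvec x.
Proof.
move=> v0; apply/rowP => a; rewrite mxE [RHS]mxE.
case: unliftP => [l ->|->]; [by rewrite chart_Phi mulrC|by rewrite mulVf].
Qed.

(** The discriminant is the square of [rho x / v], so that the sign of
[v * rho x] tells which root recovers [x]. *)
Lemma inv_chartK i sg x : hvec x 0 i != 0 -> 0 < sg * (hvec x 0 i * rho x) -> sg ^+ 2 = 1 ->
  let u := chart i (Phi_ j x) in
  [/\ 0 < discr i u, den i sg u != 0 & inv_chart i sg u = x].
Proof.
move=> v0 sgp sg2 u; set v := hvec x 0 i in v0 sgp.
have [uE wE] : proj_u i u = v^-1 *: x /\ proj_w i u = v^-1 * (1 + ep * dot x x).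
  have := lift_chart_Phi v0; rewrite -/v -/u lift_chart_hom /hvec -homZ => E.
  have E' : (row_mx (proj_u i u) (proj_w i u)%:M : 'rV[R]_(3 + 1)) =
     row_mx (v^-1 *: x) (v^-1 * (1 + ep * dot x x))%:M by exact: E.
  have [-> /matrixP/(_ 0 0)] := eq_row_mx E'.
  by rewrite !mxE eqxx !mulr1n.
have dE : discr i u = (rho x / v) ^+ 2.
  by rewrite /discr uE wE dotZl dotZr /rho; field.
have r0 : rho x != 0 by apply: contraTneq sgp => ->; rewrite mulr0 mulr0 ltxx.
have sE : sg * Num.sqrt (discr i u) = rho x / v.
  rewrite dE sqrtr_sqr.
  have p : 0 < sg * (rho x / v).
    have -> : sg * (rho x / v) = sg * (v * rho x) / v ^+ 2 by field.
    by rewrite divr_gt0// exprn_even_gt0.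
  have -> : `|rho x / v| = sg * (rho x / v).
    have sg1 : `|sg| = 1.
      by apply/eqP; rewrite -(@eqrXn2 _ 2)// -normrX sg2 normr1 expr1n.
    by rewrite -[LHS]mul1r -[in LHS]sg1 -normrM ger0_norm// ltW.
  by rewrite mulrA -expr2 sg2 mul1r.
have nE : den i sg u = 2 / v by rewrite /den sE wE /rho; field.
split.
- by rewrite dE exprn_even_gt0//= mulf_neq0// invr_eq0.
- by rewrite nE mulf_neq0// ?invr_eq0// pnatr_eq0.
- rewrite /inv_chart uE nE scalerA -[RHS]scale1r; congr (_ *: _); field.
  by rewrite v0.
Qed.

Lemma hvec_neq0 x : exists i, hvec x 0 i != 0.
Proof.
apply: contrapT => H; have : hvec x = 0.
  by apply/rowP => i; rewrite [RHS]mxE; apply: contrapT => /eqP vi; apply: H; exists i.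
move=> /eqP; rewrite hom_eq0 => /andP[/eqP ->].
by rewrite dot0l mulr0 addr0 oner_eq0.
Qed.

(** The domain is the open set where [hvec x 0 i * rho x] has the sign [sg] that it
has at [P].  Its image is the set [W] of the [u] whose preimage [g u] satisfies
the same condition, and [g] is smooth there because neither the discriminant nor
the denominator vanishes. *)
Lemma model_local_diffeo P : rho P != 0 -> local_diffeo (Phi_ j) P.
Proof.
move=> rP; have [i vP] := hvec_neq0 P; exists i.
pose sg : R := if 0 < hvec P 0 i * rho P then 1 else -1.
have sg2 : sg ^+ 2 = 1 by rewrite /sg; case: ifP; rewrite ?sqrrN expr1n.
have n0 : hvec P 0 i * rho P != 0 by rewrite mulf_neq0.
have oT : open [set: 'rV[R]_3] by exact: openT.
pose h x := sg * (hvec x 0 i * rho x).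
have Crho U : open U -> Cinf U rho.
  move=> oU k; apply: CnB => //; first exact: Cn_cst.
  by apply: CnM => //; [exact: Cn_cst|exact: Cn_dotvv].
have Ch : Cinf [set: 'rV[R]_3] h.
  move=> k; apply: CnM => //; first exact: Cn_cst.
  by apply: CnM => //; [exact: Cinf_hvec|exact: Crho].
pose U := [set: 'rV[R]_3] `&` [set x | 0 < h x].
have oU : open U by apply: open_positive => // x _; exact: (Ch 0%N).
have Uv x : U x -> hvec x 0 i != 0.
  by move=> [_]; apply: contraTneq => vx; rewrite /= /h vx mul0r mulr0 ltxx.
have UP : U P.
  split=> //=; rewrite /h /sg.
  have [p|p] := ltP 0 (hvec P 0 i * rho P); first by rewrite mul1r.
  by rewrite mulN1r oppr_gt0 lt_neqAle n0.
exists U; split=> // [x /Uv|]; first by rewrite in_chart_Phi.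
pose W1 := [set: 'rV[R]_3] `&` [set u | 0 < discr i u].
have oW1 : open W1 by apply: open_positive => // u _; exact: (Cinf_discr i oT 0%N).
have dW1 u : W1 u -> 0 < discr i u by case.
pose W2 := W1 `&` [set u | 0 < den i sg u * den i sg u].
have CW1 := Cinf_den sg oW1 dW1.
have oW2 : open W2.
  apply: open_positive => // u W1u.
  have C2 : Cn 0 W1 (fun u => den i sg u * den i sg u) by exact: CnM.
  exact: C2 u W1u.
have dW2 u : W2 u -> 0 < discr i u by move=> [/dW1].
have nW2 u : W2 u -> den i sg u != 0.
  by move=> [_]; apply: contraTneq => z; rewrite /= z mul0r ltxx.
pose g := inv_chart i sg.
have Cg l : Cinf W2 (fun u => g u 0 l) by exact: Cinf_inv_chart.
pose h' u := sg * (2 * (den i sg u)^-1 * rho (g u)).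
have Ch' : Cinf W2 h'.
  move=> k; apply: CnM => //; first exact: Cn_cst.
  have CW2 : Cinf W2 (den i sg) by exact: Cinf_den.
  apply: CnM => //; first by apply: CnM => //; [exact: Cn_cst|exact: CnV].
  apply: CnB => //; first exact: Cn_cst.
  apply: CnM => //; first exact: Cn_cst.
  by apply: Cn_sum => // l _; apply: CnM => //; exact: Cg.
pose W := W2 `&` [set u | 0 < h' u].
have oW : open W by apply: open_positive => // u; exact: (Ch' 0%N).
have hg u : W2 u -> h (g u) = h' u.
  move=> W2u; rewrite /h /h' /g chart_invK ?nW2 ?ltW ?dW2//.
  by rewrite mxE lift_chart_i mulr1.
have fU : (fun x => chart i (Phi_ j x)) @` U = W.
  apply/seteqP; split=> [u [x Ux <-]|u [W2u hu]].
    have [d n gE] := inv_chartK (Uv x Ux) Ux.2 sg2.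
    have W2u : W2 (chart i (Phi_ j x)) by split=> //=; rewrite -expr2 exprn_even_gt0.
    split=> //; rewrite /= -hg// /g gE; exact: Ux.2.
  exists (g u); last by apply: chart_inv; rewrite ?nW2 ?ltW ?dW2.
  by split=> //=; rewrite hg.
split=> //.
- move=> k; apply: coord_class_C => // l.
  have E x : U x -> hvec x 0 (lift i l) * (hvec x 0 i)^-1 = chart i (Phi_ j x) 0 l.
    by move=> _; rewrite chart_Phi.
  exact: (Cn_eq oU E (CnM oU (Cinf_hvec (lift i l) oU k) (CnV oU Uv (Cinf_hvec i oU k)))).
- by rewrite fU.
exists g => [k|x Ux]; last by have [] := inv_chartK (Uv x Ux) Ux.2 sg2.
rewrite fU; apply: coord_class_C => // l.
by apply: Cn_sub (Cg l k) => u [].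
Qed.

(** A union of segments with a common end point. *)
Lemma ball_connected P (r : R) : 0 < r -> connected (ball P r).
Proof.
move=> r0.
have -> : ball P r = \bigcup_(x in ball P r)
    ((fun t : R => P + t *: (x - P)) @` `[0, 1]%classic).
  apply/seteqP; split=> [x Px|_ [x Px [t tI <-]]].
    exists x; first exact: Px.
    exists 1; first by rewrite /= in_itv /= ler01 lexx.
    by rewrite scale1r addrC subrK.
  move: Px tI; rewrite -!ball_normE /= in_itv /= => Px /andP[t0 t1].
  rewrite opprD addNKr normrN normrZ ger0_norm// distrC.
  by rewrite (le_lt_trans _ Px)// ler_piMl.
apply: bigcup_connected.
  exists P => x _; exists 0; first by rewrite /= in_itv /= lexx ler01.
  by rewrite scale0r addr0.
move=> x _; apply: connected_continuous_connected; first exact: segment_connected.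
apply: continuous_subspaceT => t.
have c : {for t, continuous (fun s : R => P + s *: (x - P))}.
  apply: continuousD; first exact: cst_continuous.
  by rewrite /prop_for /continuous_at; apply: cvgZr_tmp; exact: cvg_id.
exact: c.
Qed.

(** All circles going into lines form the rich family; the cone is made of all
directions. *)
Lemma model_rectifies_rich P : nonzero_jacobian (Phi_ j) P -> rectifies_rich (Phi_ j) P.
Proof.
move=> /jacobian_rho rP; split; first exact: model_local_diffeo.
have nr : \forall x \near P, rho x != 0.
  have C : {for P, continuous rho}.
    have : Cn 0 [set: 'rV[R]_3] rho.
      apply: CnB; [exact: openT|apply: Cn_cst; exact: openT|].
      by apply: CnM; [exact: openT|apply: Cn_cst; exact: openT|apply: Cn_dotvv; exact: openT].
    exact.
  exact: (cvgr_neq0 _ C rP).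
have [r /= r0 rPr] := (nbhs_ballP _ _).1 nr.
exists (ball P r), (rectified_by j); split.
- by split; [exact: ball_open|exact: ball_connected|exists P; exact: ballxx].
- exact: ballxx.
- split; first by move=> S [].
  have nz : e_ 0 != 0 :> 'rV[R]_3.
    by apply/eqP => /rowP/(_ 0)/eqP; rewrite !mxE !eqxx oner_eq0.
  exists (rectified_by j) => //; split=> [Q /rPr rQ|S RS].
    have [S RS [SQ _]] := geodesic_circle rQ nz.
    by exists S.
  exists (fun=> [set v | v != 0]).
    move=> Q _; split=> v vK.
      apply: (@filterS _ _ _ [set p : 'rV[R]_3 * 'rV[R]_3 | p.2 != 0]) => [p p0 _ //|].
      exists ([set: 'rV[R]_3], [set w | w != 0]) => /=; last by move=> p [].
      by split; [exact: filterT|exact: near_neq].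
    (* the closure of the cone is the whole space, as 0 is a limit of directions *)
    exfalso; apply: vK => B Bv.
    have [v0|v0] := eqVneq v 0; last by exists v; split=> //; exact: nbhs_singleton.
    have c : {for (0 : R), continuous (fun t : R => t *: (e_ 0 : 'rV[R]_3))}.
      by rewrite /prop_for /continuous_at; apply: cvgZr_tmp; exact: cvg_id.
    have nB : \forall t \near (0 : R), B (t *: e_ 0) by apply: c; rewrite scale0r -v0.
    have [d /= d0 dB] := (nbhs_ballP _ _).1 nB.
    exists ((d / 2) *: e_ 0); split; first by rewrite /= scaler_eq0 negb_or nz gt_eqF// divr_gt0.
    apply: dB; rewrite -ball_normE /= sub0r normrN ger0_norm; last by rewrite divr_ge0// ltW.
    by rewrite ltr_pdivrMr// ltr_pMr// ltr1n.
  move=> Q [SQ /rPr rQ]; split.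
  - split=> // [|t v t0 v0].
      by rewrite openE => v; exact: near_neq.
    by rewrite /= scaler_eq0 negb_or t0.
  - by move=> v [].
  - move=> v v0; have [S' RS' [S'Q tv]] := geodesic_circle rQ v0.
    by exists S'.
exists [set: 'rV[R]_3]; first exact: filterT.
by move=> S [_ [L [dL SL]]]; exists L; split=> // x [Sx _]; exact: SL.
Qed.

End ModelCharts.

Theorem theorem2p2 (R : realType) :
  [/\ (forall (P : 'rV[R]_3) (Phi : 'rV[R]_3 -> RP3 R),
         rectifies_rich Phi P ->
         exists j : 'I_3, equivalent_at P Phi (Phi_ j)),
      (forall (j : 'I_3) (P : 'rV[R]_3),
         nonzero_jacobian (Phi_ j) P -> rectifies_rich (Phi_ j) P)
    & (forall (j k : 'I_3) (P : 'rV[R]_3),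
         j <> k -> ~ equivalent_at P (Phi_ j) (Phi_ k))].
Proof.
split=> [P Phi|j P|j k P].
- exact: rectified_equivalent.
- exact: model_rectifies_rich.
- exact: models_inequivalent.
Qed.
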